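(* Let $h=(h_1,h_2)$ with $h_1,h_2>0$, let $c\in\mathbb C\setminus\{0\}$, and assume that $c\log h_2=-\log h_1$. Then the operator $$P=\frac{\partial}{\partial x_1}+c\frac{\partial}{\partial x_2}:H^{-\infty}_{L_h}(\Omega)\to H^{-\infty}_{L_h}(\Omega)$$ is globally $L_h$-hypoelliptic if and only if either $\mathrm{Im}(c)\neq0$, or $c$ is an irrational non-Liouville number. Moreover, $P$ is globally $L_h$-solvable if and only if either $\mathrm{Im}(c)\neq0$, or $c$ is a rational number, or $c$ is an irrational non-Liouville number.
   Context: $\Omega=(0,1)^2$ and $L_h=\partial_{x_1}^2+\partial_{x_2}^2$ on $\Omega$ with boundary conditions (BC), for $j=1,2$: $h_jf|_{x_j=0}=f|_{x_j=1}$ and $h_j\,\partial_{x_j}f|_{x_j=0}=\partial_{x_j}f|_{x_j=1}$, and domain $\mathrm{Dom}(L_h)=\{f\in L^2(\Omega):L_hf\in L^2(\Omega),\ f\text{ satisfies (BC)}\}$. Write $h^x=h_1^{x_1}h_2^{x_2}$. For $\xi\in\mathbb Z^2$, $u_\xi(x)=h^xe^{2\pi ix\cdot\xi}$ and $v_\xi(x)=h^{-x}e^{2\pi ix\cdot\xi}$ are biorthogonal systems of eigenfunctions of $L_h$ and its adjoint $L_h^*$, with eigenvalues $\lambda_\xi=(\log h_1+2\pi i\xi_1)^2+(\log h_2+2\pi i\xi_2)^2$ and $\overline{\lambda_\xi}$. Weight: $\langle\xi\rangle=(1+|\lambda_\xi|^2)^{1/4}$. $H^\infty_{L_h}(\overline\Omega)=\bigcap_{k\ge1}\mathrm{Dom}(L_h^k)$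 with seminorms $\max_{j\le k}\|L_h^j\varphi\|_{L^2(\Omega)}$ (also written $H^\infty_{L_h}(\Omega)$); $H^\infty_{L_h^*}(\overline\Omega)$ likewise; $H^{-\infty}_{L_h}(\Omega)$ is the space of continuous linear functionals on $H^\infty_{L_h^*}(\overline\Omega)$, containing $H^\infty_{L_h}(\overline\Omega)$ via $\langle\psi,\varphi\rangle=\int_\Omega\psi\varphi\,dx$. The $L_h$-Fourier transform is $\widehat f(\xi)=\int_\Omega f\overline{v_\xi}\,dx$, $\widehat w(\xi)=\langle w,\overline{v_\xi}\rangle$ for distributions. Standing fact: it is a bijective homeomorphism from $H^\infty_{L_h}(\overline\Omega)$ onto the rapidly decaying sequences $\mathcal S(\mathbb Z^2)$ and from $H^{-\infty}_{L_h}(\Omega)$ onto the sequences of moderate (polynomial) growth $\mathcal S'(\mathbb Z^2)$, both measured by $\langle\xi\rangle$ (so $H^\infty_{L_h}(\overline\Omega)=\{h^xg:g\in C^\infty(\mathbb T^2)\}$). Derivatives act on $H^{-\infty}_{L_h}(\Omega)$ by duality, $\langle\partial_{x_j}w,\varphi\rangle=-\langle w,\partial_{x_j}\varphi\rangle$, so that $\widehat{Pw}(\xi)=\sigma_P(\xi)\widehat w(\xi)$ with $\sigma_P(\xi)=\log h_1+2\pi i\xi_1+c(\log h_2+2\pi i\xi_2)$. $P$ is globally $L_h$-hypoelliptic if $w\in H^{-\infty}_{L_h}(\Omega)$ and $Pw\in H^\infty_{L_h}(\overline\Omega)$ imply $w\in H^\infty_{L_h}(\overline\Omega)$. $P$ is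 globally $L_h$-solvable if $PH^{-\infty}_{L_h}(\Omega)=\{f\in H^{-\infty}_{L_h}(\Omega):\sigma_P(\xi)=0\Rightarrow\widehat f(\xi)=0\}$. A Liouville number is a real number $y$ such that for every positive integer $n$ there exist infinitely many pairs of integers $(p,q)$ with $q>1$ and $0<|y-p/q|<1/q^n$. *)

(* Defs.v *)
From mathcomp Require Import all_boot all_order all_algebra.
From mathcomp Require Import all_classical all_reals all_analysis.
From mathcomp Require Import complex.

Set Implicit Arguments.
Unset Strict Implicit.
Unset Printing Implicit Defensive.

Import Order.TTheory GRing.Theory Num.Theory.
Import numFieldNormedType.Exports.

Local Open Scope classical_set_scope.
Local Open Scope ring_scope.
Local Open Scope complex_scope.

(* The values outside Omega (for an element of L^2) or outside its closure (for
   a function smooth up to the boundary) play no role. *)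
Notation cfun R := (R * R -> R[i])%type.

Section L2.
Context {R : realType}.
Implicit Types f g : cfun R.

Definition leb2 : {measure set (measurableTypeR R * measurableTypeR R) -> \bar R} :=
  (@lebesgue_measure R \x @lebesgue_measure R)%E.

Definition Omega : set (R * R) := `]0, 1[%classic `*` `]0, 1[%classic.

Definition Cmod (z : R[i]) : R := complex.Re `|z|.

Definition L2 f : Prop :=
  [/\ measurable_fun (Omega : set (measurableTypeR R * measurableTypeR R))
        (fun x => complex.Re (f x)),
      measurable_fun (Omega : set (measurableTypeR R * measurableTypeR R))
        (fun x => complex.Im (f x)) &
      (\int[leb2]_(x in Omega) (Cmod (f x) ^+ 2)%:E < +oo)%E].

Definition L2norm f : R :=
  Num.sqrt (\int[leb2]_(x in Omega) (Cmod (f x) ^+ 2))%R.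

Definition cintegral f : R[i] :=
  (\int[leb2]_(x in Omega) complex.Re (f x))%R
  +i* (\int[leb2]_(x in Omega) complex.Im (f x))%R.

Definition L2dot f g : R[i] := cintegral (fun x => f x * (g x)^*%C).

End L2.

Section Smooth.
Context {R : realType}.
Implicit Types (f : cfun R) (j : 'I_2).

Definition dir j : R * R := if j == ord0 then (1, 0) else (0, 1).

Definition smoothR (f : R * R -> R) : Prop :=
  forall s : seq 'I_2,
    let g := foldr (fun j g x => 'D_(dir j) g x) f s in
    continuous g /\ forall j x, derivable g x (dir j).

(* C^oo up to the boundary, as restrictions to the closed square of C^oo
   functions on R^2 (Whitney/Seeley extension); thus the derivatives at boundary
   points are the one-sided limits of those inside. *)
Definition smooth f : Prop :=
  smoothR (fun x => complex.Re (f x)) /\ smoothR (fun x => complex.Im (f x)).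

Definition pd j f : cfun R := fun x =>
  'D_(dir j) (fun y => complex.Re (f y)) x
  +i* 'D_(dir j) (fun y => complex.Im (f y)) x.

Definition pd1 : cfun R -> cfun R := pd ord0.
Definition pd2 : cfun R -> cfun R := pd ord_max.

Definition laplacian f : cfun R := pd1 (pd1 f) + pd2 (pd2 f).

Definition BC (h : R * R) f : Prop := forall t : R, 0 <= t <= 1 ->
  [/\ h.1%:C * f (0, t) = f (1, t),
      h.1%:C * pd1 f (0, t) = pd1 f (1, t),
      h.2%:C * f (t, 0) = f (t, 1) &
      h.2%:C * pd2 f (t, 0) = pd2 f (t, 1)].

End Smooth.

Section Operators.
Context {R : realType}.

(* An unbounded operator on L^2(Omega) is given by its graph, closed under a.e.
   equality: the value of T at f in dom T is a well-defined a.e. class, of which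
   [app T f] is a representative. *)
Definition operator := set (cfun R * cfun R).

Implicit Types (T : operator) (f : cfun R).

Definition dom T : set (cfun R) := [set f | exists g, T (f, g)].

Definition app T f : cfun R := xget 0 [set g | T (f, g)].

Definition dom_pow T (k : nat) : set (cfun R) :=
  [set f | forall j, (j < k)%N -> dom T (iter j (app T) f)].

Definition Hinf T : set (cfun R) := \bigcap_k dom_pow T k.+1.

Definition seminorm T (k : nat) f : R :=
  \big[Num.max/0]_(j < k.+1) L2norm (iter j (app T) f).

(* Hilbert space adjoint of a densely defined operator. *)
Definition adjoint T : operator :=
  [set fg | [/\ L2 fg.1, L2 fg.2 &
    forall u v, T (u, v) -> L2dot v fg.1 = L2dot u fg.2]].

(* L_h.  An element f of L^2 with (distributional) Laplacian g in L^2 has no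
   pointwise boundary values, so (BC) is understood in the graph norm: f is a
   limit of functions smooth up to the boundary which satisfy (BC) pointwise.
   (Traces on the open sides alone would be too weak: for h = (1, 1) the Green
   function of the torus with pole at the corners satisfies (BC) on the open
   sides and has a constant Laplacian in Omega.) *)
Definition Lop (h : R * R) : operator :=
  [set fg | [/\ L2 fg.1, L2 fg.2 &
    exists u : nat -> cfun R,
      [/\ forall n, smooth (u n) /\ BC h (u n),
          (fun n => L2norm (u n - fg.1)) @ \oo --> (0 : R) &
          (fun n => L2norm (laplacian (u n) - fg.2)) @ \oo --> (0 : R)]]].

Definition Hsmooth (h : R * R) : set (cfun R) := Hinf (Lop h).

Definition Htest (h : R * R) : set (cfun R) := Hinf (adjoint (Lop h)).

End Operators.

Section Distributions.
Context {R : realType}.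
Implicit Types (h : R * R) (xi : int * int) (c : R[i]).

(* Only the values of a functional on Htest h are meaningful; see [eq_dist]. *)
Notation functional := (cfun R -> R[i]).

Implicit Types w : functional.

Definition linear_dist h w : Prop :=
  forall (a : R[i]) (phi psi : cfun R), Htest h phi -> Htest h psi ->
    w (a *: phi + psi) = a * w phi + w psi.

(* Continuity for the topology of the (increasing) family of seminorms. *)
Definition continuous_dist h w : Prop :=
  forall phi0, Htest h phi0 -> forall eps : R, 0 < eps ->
    exists (k : nat) (delta : R), 0 < delta /\
      forall phi, Htest h phi ->
        seminorm (adjoint (Lop h)) k (phi - phi0) < delta ->
        Cmod (w phi - w phi0) < eps.

Definition Hdist h : set functional :=
  [set w | linear_dist h w /\ continuous_dist h w].

Definition eq_dist h w1 w2 : Prop := forall phi, Htest h phi -> w1 phi = w2 phi.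

Definition dist_of (psi : cfun R) : functional :=
  fun phi => cintegral (fun x => psi x * phi x).

Definition is_smooth_dist h w : Prop :=
  exists2 psi, Hsmooth h psi & eq_dist h w (dist_of psi).

(* The elements of Htest h are a.e. classes, each of which contains a function
   smooth up to the boundary, unique on Omega; it is the one to differentiate. *)
Definition smooth_rep (phi : cfun R) : cfun R :=
  xget phi [set F | smooth F /\ {ae leb2, forall x, Omega x -> F x = phi x}].

Definition dist_pd (j : 'I_2) w : functional :=
  fun phi => - w (pd j (smooth_rep phi)).

Definition P c w : functional :=
  fun phi => dist_pd ord0 w phi + c * dist_pd ord_max w phi.

Definition v h xi : cfun R := fun x =>
  (h.1 `^ (- x.1) * h.2 `^ (- x.2))%:C *
  let t := 2 * pi * (x.1 * xi.1%:~R + x.2 * xi.2%:~R) in cos t +i* sin t.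

Definition fourier h w xi : R[i] := w (fun x => (v h xi x)^*%C).

Definition sigmaP h c xi : R[i] :=
  (ln h.1 +i* (2 * pi * xi.1%:~R)) + c * (ln h.2 +i* (2 * pi * xi.2%:~R)).

Definition globally_hypoelliptic h c : Prop :=
  forall w, Hdist h w -> is_smooth_dist h (P c w) -> is_smooth_dist h w.

Definition globally_solvable h c : Prop :=
  [set f | exists2 w, Hdist h w & eq_dist h f (P c w)] =
  [set f | Hdist h f /\ forall xi, sigmaP h c xi = 0 -> fourier h f xi = 0].

End Distributions.

Definition Liouville (R : realType) (y : R) : Prop :=
  forall n : nat, (0 < n)%N ->
    infinite_set [set pq : int * int | 1 < pq.2 /\
      0 < `|y - pq.1%:~R / pq.2%:~R| < 1 / (pq.2%:~R ^+ n)].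

(* Main.v *)
Require Import Defs.
From mathcomp Require Import all_boot all_order all_algebra.
From mathcomp Require Import all_classical all_reals all_analysis.
From mathcomp Require Import measurable_realfun complex.
From mathcomp Require Import zify ring lra.
From Stdlib Require Cantor.
Set Implicit Arguments.
Unset Strict Implicit.
Unset Printing Implicit Defensive.
Import Order.TTheory GRing.Theory Num.Theory.
Import numFieldNormedType.Exports.
Local Open Scope classical_set_scope.
Local Open Scope ring_scope.
Local Open Scope complex_scope.

(** The functions [expo l s n], with [l] the logarithms of the boundary parameters,
    are the eigenfunctions of the operator ([s = 1]) and of its adjoint
    ([s = - 1]), and the two families are biorthogonal.  In terms of coefficients
    everything becomes multiplication of sequences.  Smooth vectors correspond to
    rapidly decaying sequences ([Hinf_rapid], [expsum_in_Hinf]), distributions to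
    sequences of moderate growth ([Hdist_represents], [represents_Hdist]), and the
    vector field to multiplication by its symbol ([represents_P]), which under the
    assumption on [h] and [c] is a nonzero multiple of the linear form
    [xi.1 + c * xi.2].

    Hypoellipticity then says that a moderate sequence is rapidly decaying as soon
    as its product with the symbol is; solvability says that a moderate sequence
    vanishing at the zeros of the symbol can be divided by it.  Both are governed
    by a lower bound of the symbol off its zeros by a negative power of the
    frequency ([diophantine]): solvability is equivalent to this bound
    ([solvable_diophantine]), hypoellipticity to the bound together with the
    finiteness of the set of zeros ([hypoelliptic_diophantine]).  The bound always
    holds for nonreal and for rational [c], and for irrational [c] exactly when [c]
    is not a Liouville number; zeros other than the origin occur only for rational
    [c], and then in infinite number.

    Three facts of analysis support the dictionary.  A series of exponentials with
    rapidly decaying coefficients is smooth up to the boundary and satisfies the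
    boundary conditions ([smooth_expsum], [BC_expsum]).  Green's formula has no
    boundary terms when the two functions satisfy reciprocal boundary conditions
    ([green]); it extends to the graph closure defining the operator
    ([Lop_green]), whence both the operator and its adjoint act diagonally on
    coefficients ([Lop_coef], [adjoint_coef]).  A square-integrable function whose
    coefficients vanish is zero almost everywhere ([coef_complete]): explicit
    trigonometric polynomials converge boundedly to indicators of boxes, and the
    pi-lambda theorem passes from boxes to measurable sets.

    A distribution is determined by its coefficients because the partial sums of a
    test function converge in every seminorm, and its coefficients grow
    moderately because it is bounded by one seminorm. *)

(** * Complex numbers and their modulus *)

Section Modulus.
Context {R : realType}.
Implicit Types (z w : R[i]).

Lemma ReD z w : complex.Re (z + w) = complex.Re z + complex.Re w.
Proof. by case: z w => [a b] [c d]. Qed.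

Lemma ImD z w : complex.Im (z + w) = complex.Im z + complex.Im w.
Proof. by case: z w => [a b] [c d]. Qed.

Lemma ReN z : complex.Re (- z) = - complex.Re z.
Proof. by case: z. Qed.

Lemma ImN z : complex.Im (- z) = - complex.Im z.
Proof. by case: z. Qed.

Lemma ReM z w : complex.Re (z * w) =
  complex.Re z * complex.Re w - complex.Im z * complex.Im w.
Proof. by case: z w => [a b] [c d]. Qed.

Lemma ImM z w : complex.Im (z * w) =
  complex.Re z * complex.Im w + complex.Im z * complex.Re w.
Proof. by case: z w => [a b] [c d]. Qed.

Lemma Re_conj z : complex.Re z^* = complex.Re z.
Proof. by case: z. Qed.

Lemma Im_conj z : complex.Im z^* = - complex.Im z.
Proof. by case: z. Qed.

Lemma Re_real (k : R) : complex.Re k%:C = k. Proof. by []. Qed.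

Lemma Im_real (k : R) : complex.Im k%:C = 0. Proof. by []. Qed.

Lemma complex_ext z w : complex.Re z = complex.Re w ->
  complex.Im z = complex.Im w -> z = w.
Proof. by case: z w => [a b] [c d] /= -> ->. Qed.

Definition ReImE := (ReD, ImD, ReN, ImN, ReM, ImM, Re_conj, Im_conj,
  Re_real, Im_real).

Lemma CmodE z : Cmod z = Num.sqrt (complex.Re z ^+ 2 + complex.Im z ^+ 2).
Proof. by case: z. Qed.

Lemma Cmod_norm z : `|z| = (Cmod z)%:C.
Proof. by case: z. Qed.

Lemma Cmod_ge0 z : 0 <= Cmod z.
Proof. by rewrite CmodE sqrtr_ge0. Qed.
Hint Extern 0 (is_true (0 <= Cmod _)) => exact: Cmod_ge0 : core.

Lemma CmodM z w : Cmod (z * w) = Cmod z * Cmod w.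
Proof. by apply: complexI; rewrite rmorphM /= -!Cmod_norm normrM. Qed.

Lemma Cmod_le_add z w : Cmod (z + w) <= Cmod z + Cmod w.
Proof. by rewrite -lecR rmorphD /= -!Cmod_norm ler_normD. Qed.

Lemma Cmod0 : Cmod (0 : R[i]) = 0.
Proof. by rewrite CmodE /= expr0n addr0 sqrtr0. Qed.

Lemma Cmod1 : Cmod (1 : R[i]) = 1.
Proof. by rewrite CmodE /= expr0n addr0 expr1n sqrtr1. Qed.

Lemma Cmod_eq0 z : (Cmod z == 0) = (z == 0).
Proof. by rewrite -[RHS]normr_eq0 Cmod_norm eq_complex /= eqxx andbT. Qed.

Lemma CmodN z : Cmod (- z) = Cmod z.
Proof. by apply: complexI; rewrite -!Cmod_norm normrN. Qed.

Lemma CmodX z n : Cmod (z ^+ n) = Cmod z ^+ n.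
Proof.
by elim: n => [|n ih]; rewrite ?expr0 ?Cmod1// !exprS CmodM ih.
Qed.

Lemma CmodV z : Cmod z^-1 = (Cmod z)^-1.
Proof. by apply: complexI; rewrite fmorphV /= -!Cmod_norm normfV. Qed.

Lemma Cmod_real (k : R) : Cmod k%:C = `|k|.
Proof. by rewrite CmodE /= expr0n addr0 sqrtr_sqr. Qed.

Lemma CmodNi : Cmod (- 'i : R[i]) = 1.
Proof. by rewrite CmodN CmodE /= expr0n add0r expr1n sqrtr1. Qed.

Lemma normr_Re_le z : `|complex.Re z| <= Cmod z.
Proof. by rewrite CmodE -sqrtr_sqr ler_wsqrtr// lerDl sqr_ge0. Qed.

Lemma normr_Im_le z : `|complex.Im z| <= Cmod z.
Proof. by rewrite CmodE -sqrtr_sqr ler_wsqrtr// lerDr sqr_ge0. Qed.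

Lemma Cmod_le_ReIm z : Cmod z <= `|complex.Re z| + `|complex.Im z|.
Proof.
case: z => a b; rewrite (_ : a +i* b = a%:C + 'i * b%:C); last first.
  by simpc.
apply: (le_trans (Cmod_le_add _ _)); rewrite CmodM !Cmod_real.
rewrite (_ : Cmod 'i = 1) ?mul1r; last by rewrite -[LHS]CmodN CmodNi.
by rewrite /=; simpc; rewrite /= ?subrr ?add0r.
Qed.

End Modulus.
#[global] Hint Extern 0 (is_true (0 <= Cmod _)) => exact: Cmod_ge0 : core.

(** * An enumeration of the dual lattice with polynomial control *)

Section Enumeration.

Definition int_of_nat (n : nat) : int :=
  if odd n then Negz n./2 else Posz n./2.

Definition nat_of_int (z : int) : nat :=
  match z with Posz k => k.*2 | Negz k => k.*2.+1 end.

Lemma int_of_natK : cancel int_of_nat nat_of_int.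
Proof.
move=> n; rewrite /int_of_nat -[in RHS](odd_double_half n).
by case: (odd n).
Qed.

Lemma nat_of_intK : cancel nat_of_int int_of_nat.
Proof.
by case=> k; rewrite /int_of_nat /= odd_double /= ?doubleK ?uphalf_double.
Qed.

(** Sums over the dual lattice are written as series over [nat]: Cantor's
    pairing makes the index of a frequency polynomial in its size, so that
    polynomial bounds in the index and in the frequency are equivalent. *)
Definition freq (n : nat) : int * int :=
  let ab := Cantor.of_nat n in (int_of_nat ab.1, int_of_nat ab.2).

Definition freq_index (xi : int * int) : nat :=
  Cantor.to_nat (nat_of_int xi.1, nat_of_int xi.2).

Lemma freqK : cancel freq freq_index.
Proof.
move=> n; rewrite /freq_index /freq !int_of_natK -surjective_pairing.
exact: Cantor.cancel_to_of.
Qed.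

Lemma freq_indexK : cancel freq_index freq.
Proof.
by move=> [a b]; rewrite /freq_index /freq Cantor.cancel_of_to !nat_of_intK.
Qed.

Lemma freq_inj : injective freq. Proof. exact: can_inj freqK. Qed.

Lemma absz_freq_le n : (`|(freq n).1| + `|(freq n).2| <= n.+1)%N.
Proof.
have zle m : (`|int_of_nat m| <= m)%N.
  by rewrite /int_of_nat; have := odd_double_half m; case: (odd m) => /=; lia.
have := Cantor.to_nat_non_decreasing (Cantor.of_nat n).1 (Cantor.of_nat n).2.
rewrite -surjective_pairing Cantor.cancel_to_of /freq /=.
have := zle (Cantor.of_nat n).1; have := zle (Cantor.of_nat n).2; lia.
Qed.

Lemma freq_index_le xi :
  ((freq_index xi).+1 <= (1 + 2 * `|xi.1| + 2 * `|xi.2|) ^ 2)%N.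
Proof.
have zle z : (nat_of_int z <= 2 * `|z|)%N by case: z => k /=; lia.
have := Cantor.to_nat_spec (nat_of_int xi.1) (nat_of_int xi.2).
rewrite -/(freq_index xi); set N := freq_index xi.
have := zle xi.1; have := zle xi.2.
move: (nat_of_int xi.1) (nat_of_int xi.2) `|xi.1|%N `|xi.2|%N => a b c d.
rewrite expnS expn1; nia.
Qed.

Lemma freq_index_leR (R : realDomainType) xi : (freq_index xi).+1%:R <=
  (1 + 2 * `|xi.1%:~R| + 2 * `|xi.2%:~R|) ^+ 2 :> R.
Proof.
have := freq_index_le xi; rewrite -!intr_norm -!abszE -(ler_nat R) => /le_trans; apply.
by rewrite natrX (natrD _ (1 + _)%N) (natrD _ 1) !natrM.
Qed.

End Enumeration.

(** * Rapidly decaying and moderately growing sequences, and their sums *)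

Section Sequences.
Context {R : realType}.
Implicit Types (a b : nat -> R[i]) (al be : nat -> R).

Definition rapid a := forall k, exists M : R, forall n,
  Cmod (a n) * n.+1%:R ^+ k <= M.

Definition moderate a := exists k, exists M : R, forall n,
  Cmod (a n) <= M * n.+1%:R ^+ k.

(** Quadratic decay with an explicit constant: it makes a series converge and
    bounds its sum ([csum_le]). *)
Definition qbounded (M : R) a := forall n, Cmod (a n) * n.+1%:R ^+ 2 <= M.

Let weight_ge0 (z : R[i]) n k : 0 <= Cmod z * n.+1%:R ^+ k.
Proof. by rewrite mulr_ge0 ?exprn_ge0 ?ler0n. Qed.

Lemma qbounded_ge0 M a : qbounded M a -> 0 <= M.
Proof. by move=> /(_ 0%N); exact/le_trans/weight_ge0. Qed.

Lemma rapid_qbounded a : rapid a -> exists M, qbounded M a.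
Proof. by move=> /(_ 2%N). Qed.

Lemma rapidD a b : rapid a -> rapid b -> rapid (fun n => a n + b n).
Proof.
move=> ra rb k; have [M aM] := ra k; have [N bN] := rb k.
exists (M + N) => n; apply: le_trans (lerD (aM n) (bN n)).
by rewrite -mulrDl ler_wpM2r ?exprn_ge0// Cmod_le_add.
Qed.

Lemma rapidM a b : moderate a -> rapid b -> rapid (fun n => a n * b n).
Proof.
move=> [j [M aM]] rb k; have [N bN] := rb (j + k)%N.
exists (M * N) => n; rewrite CmodM mulrAC.
have M0 : 0 <= M.
  by have := aM 0%N; rewrite expr1n mulr1; exact: le_trans.
apply: (le_trans _ (ler_wpM2l M0 (bN n))).
rewrite mulrAC exprD -!mulrA mulrCA [leRHS]mulrCA; apply: ler_wpM2l => //.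
by rewrite mulrA ler_wpM2r ?exprn_ge0.
Qed.

Lemma moderateM a b : moderate a -> moderate b -> moderate (fun n => a n * b n).
Proof.
move=> [j [M aM]] [k [N bN]]; exists (j + k)%N, (M * N) => n.
by rewrite CmodM exprD mulrACA ler_pM.
Qed.

Lemma moderateD a b : moderate a -> moderate b -> moderate (fun n => a n + b n).
Proof.
move=> [j [M aM]] [k [N bN]]; exists (j + k)%N, (`|M| + `|N|) => n.
apply: (le_trans (Cmod_le_add _ _)); rewrite mulrDl lerD//.
  apply: (le_trans (aM n)); apply: (le_trans (ler_wpM2r _ (ler_norm M))).
    by rewrite exprn_ge0.
  by rewrite ler_wpM2l// ler_weXn2l ?leq_addr// ler1n.
apply: (le_trans (bN n)); apply: (le_trans (ler_wpM2r _ (ler_norm N))).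
  by rewrite exprn_ge0.
by rewrite ler_wpM2l// ler_weXn2l ?leq_addl// ler1n.
Qed.

Lemma moderate_cst (c : R[i]) : moderate (fun=> c).
Proof. by exists 0%N, (Cmod c) => n; rewrite expr0 mulr1. Qed.

Lemma moderateX a k : moderate a -> moderate (fun n => a n ^+ k).
Proof.
move=> ma; elim: k => [|k ih]; first exact: moderate_cst.
under eq_fun do rewrite exprS; exact: moderateM.
Qed.

Lemma rapid_moderate a : rapid a -> moderate a.
Proof.
move=> /(_ 0%N)[M aM]; exists 0%N, M => n.
by have := aM n; rewrite expr0 !mulr1.
Qed.

Lemma rapidZ (c : R[i]) a : rapid a -> rapid (fun n => c * a n).
Proof. exact/rapidM/moderate_cst. Qed.

Lemma rapid_finite a N : (forall n, (N <= n)%N -> a n = 0) -> rapid a.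
Proof.
move=> a0 k; exists (\sum_(i < N) Cmod (a i) * i.+1%:R ^+ k) => n.
have [nN|Nn] := ltnP n N; last first.
  by rewrite a0// Cmod0 mul0r sumr_ge0// => i _; exact: weight_ge0.
rewrite (bigD1 (Ordinal nN))//= lerDl.
by apply: sumr_ge0 => i _; exact: weight_ge0.
Qed.

Definition delta m : nat -> R[i] := fun n => (n == m)%:R.

Lemma rapid_delta m : rapid (delta m).
Proof.
apply: (@rapid_finite _ m.+1) => n mn; rewrite /delta gtn_eqF//.
Qed.

Lemma series_telescope N :
  series (fun n => (n.+1%:R * n.+2%:R)^-1 : R) N = 1 - N.+1%:R^-1.
Proof.
elim: N => [|N ih]; first by rewrite /series /= big_geq// invr1 subrr.
rewrite seriesSr ih /=.
have h1 : N.+1%:R != 0 :> R by rewrite pnatr_eq0.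
have h2 : N.+2%:R != 0 :> R by rewrite pnatr_eq0.
have e : N.+2%:R = N.+1%:R + 1 :> R by rewrite -[in LHS]natr1.
by move: h1 h2; rewrite e; move: (N.+1%:R : R) => x h1 h2; field; rewrite h1 h2.
Qed.

Lemma cvg_series_telescope :
  series (fun n => (n.+1%:R * n.+2%:R)^-1 : R) @ \oo --> (1 : R).
Proof.
rewrite (_ : series _ = fun N => 1 - N.+1%:R^-1); last first.
  by apply/funext => N; rewrite series_telescope.
rewrite -[X in _ --> X]subr0; apply: cvgB; first exact: cvg_cst.
exact: cvg_harmonic.
Qed.

Lemma qbounded_series al (M : R) : (forall n, `|al n| * n.+1%:R ^+ 2 <= M) ->
  cvgn (series al) /\ `|limn (series al)| <= 2 * M.
Proof.
move=> alM.
(* Comparison with a telescoping series of sum 1 keeps the bound explicit. *)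
have le n : `|al n| <= (2 * M) * (n.+1%:R * n.+2%:R)^-1.
  rewrite ler_pdivlMr ?mulr_gt0//.
  apply: le_trans (_ : 2 * (`|al n| * n.+1%:R ^+ 2) <= _); last first.
    by rewrite ler_pM2l.
  rewrite [leRHS]mulrCA ler_wpM2l// expr2 [leRHS]mulrCA ler_wpM2l//.
  rewrite -natrM ler_nat; lia.
have M0 : 0 <= M.
  by have := alM 0%N; apply: le_trans; rewrite mulr_ge0 ?exprn_ge0 ?ler0n.
have cv2 : cvgn (series (fun n => (2 * M) * (n.+1%:R * n.+2%:R)^-1 : R)).
  by apply: is_cvg_seriesZ; apply/cvg_ex; exists 1; exact: cvg_series_telescope.
have cva : cvgn [normed series al].
  apply: (series_le_cvg _ _ le) => // n.
  by rewrite mulr_ge0 ?mulr_ge0// invr_ge0 mulr_ge0.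
split; first exact: normed_cvg.
apply: (le_trans (lim_series_norm cva)).
apply: (le_trans (lim_series_le cva cv2 le)).
have cv1 : cvgn (series (fun n => (n.+1%:R * n.+2%:R)^-1 : R)).
  by apply/cvg_ex; exists 1; exact: cvg_series_telescope.
rewrite (lim_seriesZ (2 * M) cv1).
by rewrite (cvg_lim _ cvg_series_telescope)// [leLHS]mulr1.
Qed.

Definition csum a : R[i] :=
  limn (series (fun n => complex.Re (a n))) +i*
  limn (series (fun n => complex.Im (a n))).

Lemma qbounded_Re M a : qbounded M a ->
  forall n, `|complex.Re (a n)| * n.+1%:R ^+ 2 <= M.
Proof.
by move=> aM n; apply: le_trans (aM n); rewrite ler_wpM2r ?exprn_ge0// normr_Re_le.
Qed.

Lemma qbounded_Im M a : qbounded M a ->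
  forall n, `|complex.Im (a n)| * n.+1%:R ^+ 2 <= M.
Proof.
by move=> aM n; apply: le_trans (aM n); rewrite ler_wpM2r ?exprn_ge0// normr_Im_le.
Qed.

Lemma is_cvg_Re M a : qbounded M a -> cvgn (series (fun n => complex.Re (a n))).
Proof. by move=> /qbounded_Re/qbounded_series[]. Qed.

Lemma is_cvg_Im M a : qbounded M a -> cvgn (series (fun n => complex.Im (a n))).
Proof. by move=> /qbounded_Im/qbounded_series[]. Qed.

Lemma csum_le M a : qbounded M a -> Cmod (csum a) <= 4 * M.
Proof.
move=> aM; apply: (le_trans (Cmod_le_ReIm _)).
rewrite [leRHS](_ : _ = 2 * M + 2 * M); last by ring.
apply: lerD; first by have [] := qbounded_series (qbounded_Re aM).
by have [] := qbounded_series (qbounded_Im aM).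
Qed.

Lemma csumD M N a b : qbounded M a -> qbounded N b ->
  csum (fun n => a n + b n) = csum a + csum b.
Proof.
move=> aM bN; apply: complex_ext; rewrite ReImE /=.
  rewrite -lim_seriesD; [|exact: is_cvg_Re aM|exact: is_cvg_Re bN].
  by congr (limn (series _)); apply/funext => n; rewrite ReImE.
rewrite -lim_seriesD; [|exact: is_cvg_Im aM|exact: is_cvg_Im bN].
by congr (limn (series _)); apply/funext => n; rewrite ReImE.
Qed.

Let real_sumZ (x : R) al : cvgn (series al) ->
  x * limn (series al) = limn (series (fun n => x * al n)) /\
  cvgn (series (fun n => x * al n)).
Proof.
by move=> c; split; [exact/esym/(lim_seriesZ x c)|exact: is_cvg_seriesZ].
Qed.

Lemma csumZ M a (c : R[i]) : qbounded M a ->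
  csum (fun n => c * a n) = c * csum a.
Proof.
move=> aM; have cr := is_cvg_Re aM; have ci := is_cvg_Im aM.
have [rr crr] := real_sumZ (complex.Re c) cr.
have [ri cri] := real_sumZ (complex.Re c) ci.
have [ir cir] := real_sumZ (complex.Im c) cr.
have [ii cii] := real_sumZ (complex.Im c) ci.
apply: complex_ext; rewrite ?ReM ?ImM /csum /= ?rr ?ri ?ir ?ii.
  rewrite -(lim_seriesB crr cii).
  by congr (limn (series _)); apply/funext => n; rewrite ReImE.
rewrite -(lim_seriesD cri cir).
by congr (limn (series _)); apply/funext => n; rewrite ReImE.
Qed.

Lemma csumB M N a b : qbounded M a -> qbounded N b ->
  csum (fun n => a n - b n) = csum a - csum b.
Proof.
move=> aM bN.
have bN' : qbounded N (fun n => (-1) * b n).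
  by move=> n; rewrite mulN1r CmodN.
rewrite (_ : (fun n => _) = (fun n => a n + (-1) * b n)); last first.
  by apply/funext => n; rewrite mulN1r.
by rewrite (csumD aM bN') (csumZ _ bN) mulN1r.
Qed.

Lemma csum_finite a N : (forall n, (N <= n)%N -> a n = 0) ->
  csum a = \sum_(n < N) a n.
Proof.
move=> a0.
have real_case al : (forall n, (N <= n)%N -> al n = 0) ->
    limn (series al) = \sum_(n < N) al n :> R.
  move=> al0; apply: cvg_lim => //; apply: cvg_near_cst.
  exists N => // n /= Nn; rewrite seriesEnat /=.
  have tail0 : \sum_(N <= i < n) al i = 0.
    by rewrite big_nat_cond big1// => i; rewrite andbT => /andP[Ni _]; exact: al0.
  by rewrite (big_cat_nat _ Nn)//= tail0 addr0 big_mkord.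
have ReS : complex.Re (\sum_(n < N) a n) = \sum_(n < N) complex.Re (a n).
  by elim/big_rec2: _ => // i x y _ <-; rewrite ReD.
have ImS : complex.Im (\sum_(n < N) a n) = \sum_(n < N) complex.Im (a n).
  by elim/big_rec2: _ => // i x y _ <-; rewrite ImD.
apply: complex_ext; rewrite ?ReS ?ImS; apply: real_case => n Nn; by rewrite a0.
Qed.

Lemma csum_delta a m : csum (fun n => a n * delta m n) = a m.
Proof.
rewrite (@csum_finite _ m.+1) => [|n mn]; last first.
  by rewrite /delta gtn_eqF// mulr0.
rewrite (bigD1 ord_max)//= /delta eqxx mulr1 big1 ?addr0// => i im.
rewrite (_ : (i == m :> nat) = false) ?mulr0//.
by apply/negbTE; apply: contra im => /eqP im; apply/eqP/val_inj.
Qed.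

Definition trunc N a : nat -> R[i] := fun n => if (n < N)%N then a n else 0.

Lemma rapid_trunc N a : rapid (trunc N a).
Proof. by apply: (@rapid_finite _ N) => n; rewrite /trunc leqNgt => /negbTE ->. Qed.

(** One extra power of decay turns into a rate of convergence. *)
Lemma qbounded_tail (M : R) a N : (forall n, Cmod (a n) * n.+1%:R ^+ 3 <= M) ->
  qbounded (M / N.+1%:R) (fun n => a n - trunc N a n).
Proof.
move=> aM n; rewrite /trunc; case: ltnP => [nN|Nn].
  rewrite subrr Cmod0 mul0r divr_ge0//.
  by have := aM 0%N; exact/le_trans/weight_ge0.
rewrite subr0 ler_pdivlMr//; apply: le_trans (aM n).
rewrite -mulrA ler_wpM2l// [leRHS]exprSr ler_wpM2l ?exprn_ge0// ler_nat//.
Qed.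

End Sequences.

(** * Exponential bases and rapidly converging series in them *)

Section Directional.
Context {R : realType}.
Implicit Types (f df : R -> R) (g : R * R -> R).

Lemma lipschitz_of_derive f df (r K : R) :
  (forall t : R, is_derive t 1 f (df t)) -> (forall t, `|t| <= r -> `|df t| <= K) ->
  forall s t, `|s| <= r -> `|t| <= r -> `|f t - f s| <= K * `|t - s|.
Proof.
move=> fd dfK s t; wlog st : s t / s <= t => [wl|] sr tr.
  have [st|/ltW ts] := leP s t; first exact: wl.
  by rewrite distrC [`|t - s|]distrC; exact: wl.
have [c cst ->] := @MVT_segment R f df s t st (fun x _ => fd x)
  (@derivable_within_continuous _ _ _ _ (fun x _ => @ex_derive _ _ _ _ _ _ _ (fd x))).
rewrite normrM ler_wpM2r// dfK//.
move: cst sr tr; rewrite in_itv /= !ler_norml => /andP[? ?] /andP[? ?] /andP[? ?].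
by apply/andP; split; lra.
Qed.

Lemma taylor2 f df ddf (K : R) :
  (forall t : R, is_derive t 1 f (df t)) -> (forall t : R, is_derive t 1 df (ddf t)) ->
  (forall t, `|t| <= 1 -> `|ddf t| <= K) ->
  forall t, `|t| <= 1 -> `|f t - f 0 - t * df 0| <= K * t ^+ 2.
Proof.
move=> fd dfd ddfK t t1.
have gd (u : R) : is_derive u 1 (fun u => f u - u * df 0) (df u - df 0).
  have := fd u => ?.
  apply: is_derive_eq.
  by rewrite /= !scaler0 add0r /GRing.scale /= mulr1.
have K0 : 0 <= K by apply: (le_trans _ (ddfK 0 _)); rewrite ?normr0.
have dg u : `|u| <= `|t| -> `|df u - df 0| <= K * `|t|.
  move=> ut; have u1 := le_trans ut t1.
  have := lipschitz_of_derive dfd ddfK (s := 0) (t := u).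
  rewrite normr0 subr0 => /(_ ler01 u1) h; apply: (le_trans h).
  by rewrite ler_wpM2l.
have := lipschitz_of_derive gd dg (s := 0) (t := t).
rewrite normr0 mul0r !subr0 => /(_ (normr_ge0 _) (lexx _)).
rewrite -mulrA -expr2 real_normK ?num_real//.
by rewrite (_ : f t - t * df 0 - f 0 = f t - f 0 - t * df 0)//; ring.
Qed.

Lemma is_derive_of_quadratic g (x v : R * R) (d C : R) :
  (forall t, `|t| <= 1 -> `|g (t *: v + x) - g x - t * d| <= C * t ^+ 2) ->
  is_derive x v g d.
Proof.
move=> gC.
suff h : (fun t => t^-1 *: (g (t *: v + x) - g x)) @ 0^' --> d.
  apply: DeriveDef; first by apply/cvg_ex; exists d.
  exact: cvg_lim h.
have C0 : 0 <= C by have := gC 1; rewrite normr1 expr1n mulr1 => /(_ (lexx _)); exact: le_trans.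
apply/cvgrPdist_le => e e0; near=> t.
have t0 : t != 0 by near: t; exact: nbhs_dnbhs_neq.
have t1 : `|t| <= 1.
  near: t; apply: dnbhs0_le; exact: ltr01.
have tC : `|t| <= e / (C + 1).
  by near: t; apply: dnbhs0_le; rewrite divr_gt0// ltr_wpDl.
rewrite distrC (_ : _ - d = t^-1 * (g (t *: v + x) - g x - t * d)); last first.
  by rewrite /GRing.scale /= [RHS]mulrBr mulKf.
rewrite normrM normfV ler_pdivrMl ?normr_gt0//.
apply: (le_trans (gC _ t1)).
rewrite -real_normK ?num_real// expr2 mulrCA ler_wpM2l//.
apply: (le_trans (ler_wpM2l C0 tC)); rewrite mulrCA ler_piMr ?(ltW e0)//.
rewrite ler_pdivrMr ?ltr_wpDl// mul1r; lra.
Unshelve. all: by end_near. Qed.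

Lemma is_derive_line g (x v : R * R) (d t : R) :
  is_derive (t *: v + x) v g d ->
  is_derive t 1 (fun t : R => g (t *: v + x)) d.
Proof.
move=> [gd gv].
have e : (fun h : R => h^-1 *: (g ((h *: 1 + t) *: v + x) - g (t *: v + x)))
       = (fun h : R => h^-1 *: (g (h *: v + (t *: v + x)) - g (t *: v + x))).
  apply/funext => h; congr (_ *: (g _ - _)).
  by rewrite addrA -scalerDl /GRing.scale /= mulr1.
by apply: DeriveDef; rewrite /derivable /derive /= e.
Qed.

Lemma section1E (x y : R) : (x, y) = x *: dir ord0 + (0, y).
Proof. by apply: injective_projections; rewrite /= ?scaler0 ?add0r ?addr0// [X in _ = X]mulr1. Qed.

Lemma section2E (x y : R) : (x, y) = y *: dir ord_max + (x, 0).
Proof. by apply: injective_projections; rewrite /= ?scaler0 ?add0r ?addr0// [X in _ = X]mulr1. Qed.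

Lemma is_derive_section1 g (x y d : R) : is_derive (x, y) (dir ord0) g d ->
  is_derive x 1 (fun t => g (t, y)) d.
Proof.
rewrite section1E => /is_derive_line.
by under eq_fun do rewrite -section1E.
Qed.

Lemma is_derive_section2 g (x y d : R) : is_derive (x, y) (dir ord_max) g d ->
  is_derive y 1 (fun t => g (x, t)) d.
Proof.
rewrite section2E => /is_derive_line.
by under eq_fun do rewrite -section2E.
Qed.

(** Bounded partial derivatives make a function Lipschitz on boxes. *)
Lemma continuous_of_bounded_partials g (d1 d2 : R * R -> R) (K : R -> R) :
  (forall x, is_derive x (dir ord0) g (d1 x)) ->
  (forall x, is_derive x (dir ord_max) g (d2 x)) ->
  (forall r x, `|x.1| <= r -> `|x.2| <= r -> `|d1 x| <= K r /\ `|d2 x| <= K r) ->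
  continuous g.
Proof.
move=> gd1 gd2 dK [x1 x2]; set r := `|x1| + `|x2| + 1.
have x1r : `|x1| <= r by rewrite /r; have := normr_ge0 x2; lra.
have x2r : `|x2| <= r by rewrite /r; have := normr_ge0 x1; lra.
have lip y1 y2 : `|y1| <= r -> `|y2| <= r ->
    `|g (x1, x2) - g (y1, y2)| <= K r * (`|x1 - y1| + `|x2 - y2|).
  move=> y1r y2r; rewrite mulrDr.
  rewrite (_ : _ - _ = (g (x1, x2) - g (y1, x2)) + (g (y1, x2) - g (y1, y2))); last ring.
  apply: (le_trans (ler_normD _ _)); apply: lerD.
    apply: (lipschitz_of_derive (r := r) (f := fun t => g (t, x2)) (df := fun t => d1 (t, x2))) => // t.
      exact: is_derive_section1.
    by move=> tr; have [] := dK r (t, x2) tr x2r.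
  apply: (lipschitz_of_derive (r := r) (f := fun t => g (y1, t)) (df := fun t => d2 (y1, t))) => // t.
    exact: is_derive_section2.
  by move=> tr; have [] := dK r (y1, t) y1r tr.
have K0 : 0 <= K r.
  by have [+ _] := dK r (x1, x2) x1r x2r; exact: le_trans.
apply/cvgrPdist_le => e e0.
near=> y.
have y1x : `|x1 - y.1| <= Num.min 1 (e / (2 * (K r + 1))).
  near: y; exists (ball x1 (Num.min 1 (e / (2 * (K r + 1)))), setT) => /=.
    split; last exact: filterT.
    by apply: nbhsx_ballx; rewrite lt_min ltr01 divr_gt0// mulr_gt0// ltr_wpDl.
  by move=> z [] /ltW.
have y2x : `|x2 - y.2| <= Num.min 1 (e / (2 * (K r + 1))).
  near: y; exists (setT, ball x2 (Num.min 1 (e / (2 * (K r + 1))))) => /=.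
    split; first exact: filterT.
    by apply: nbhsx_ballx; rewrite lt_min ltr01 divr_gt0// mulr_gt0// ltr_wpDl.
  by move=> z [] _ /ltW.
move: y1x y2x; rewrite !le_min => /andP[y11 y1e] /andP[y21 y2e].
have y1r : `|y.1| <= r.
  rewrite (_ : y.1 = x1 - (x1 - y.1)); last ring.
  apply: (le_trans (ler_normB _ _)); rewrite /r -addrA lerD2l.
  by apply: (le_trans y11); rewrite lerDr.
have y2r : `|y.2| <= r.
  rewrite (_ : y.2 = x2 - (x2 - y.2)); last ring.
  by apply: (le_trans (ler_normB _ _)); rewrite /r; apply: lerD; rewrite ?lerDr.
rewrite [y]surjective_pairing; apply: (le_trans (lip _ _ y1r y2r)).
apply: (le_trans (ler_wpM2l K0 (lerD y1e y2e))).
rewrite (_ : _ + _ = e / (K r + 1)); last by field; rewrite lt0r_neq0// ltr_wpDl.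
by rewrite mulrCA ler_piMr ?(ltW e0)// ler_pdivrMr ?ltr_wpDl// mul1r lerDl.
Unshelve. all: by end_near. Qed.

End Directional.

Section Exponentials.
Context {R : realType}.
Variable l : R * R.
Implicit Types (s t : R) (n : nat) (x y : R * R) (a b : nat -> R[i]) (j : 'I_2).

Definition coord (T : Type) j (p : T * T) : T := if j == ord0 then p.1 else p.2.

(** The logarithmic derivative of the exponential with frequency [freq n];
    [lam] is the eigenvalue of the Laplacian. *)
Definition mu j n : R[i] := coord j l +i* (2 * pi * (coord j (freq n))%:~R).

Definition lam n : R[i] := mu ord0 n ^+ 2 + mu ord_max n ^+ 2.

Definition phase n x : R :=
  2 * pi * (x.1 * (freq n).1%:~R + x.2 * (freq n).2%:~R).

(** [expo s n x] is the exponential of [s * (mu n . x)].  With [l] the logarithm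
    of the boundary parameters, [s = 1] gives the eigenfunctions of the operator
    and [s = - 1] those of its transpose, so one calculation serves both. *)
Definition expo s n x : R[i] :=
  (expR (s * (l.1 * x.1 + l.2 * x.2)))%:C *
  (cos (s * phase n x) +i* sin (s * phase n x)).

Lemma Cmod_expo s n x : Cmod (expo s n x) = expR (s * (l.1 * x.1 + l.2 * x.2)).
Proof.
rewrite /expo CmodM Cmod_real (ger0_norm (expR_ge0 _)) CmodE /=.
by rewrite cos2Dsin2 sqrtr1 mulr1.
Qed.

Lemma moderate_mu j : moderate (mu j).
Proof.
exists 1%N, (`|coord j l| + 2 * pi) => n; rewrite expr1.
apply: (le_trans (Cmod_le_ReIm _)); rewrite /= [leRHS]mulrDl. rewrite lerD//.
  by rewrite ler_peMr// ler1n.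
have p0 : 0 <= 2 * pi :> R by rewrite mulr_ge0// pi_ge0.
rewrite normrM (ger0_norm p0) ler_wpM2l//.
rewrite -intr_norm -abszE -[leRHS]/((n.+1%:Z)%:~R) ler_int.
have := absz_freq_le n; rewrite /coord; case: ifP => _; lia.
Qed.

Lemma moderate_lam : moderate lam.
Proof.
by apply: moderateD; under eq_fun do rewrite expr2;
  apply: moderateM; exact: moderate_mu.
Qed.

(** The real part of [lam] is a definite quadratic form in the frequency, up to
    a constant. *)
Lemma lam_growth : exists C : R, 0 < C /\
  forall n, n.+1%:R <= C * (1 + Cmod (lam n)).
Proof.
pose L := l.1 ^+ 2 + l.2 ^+ 2.
have L0 : 0 <= L by rewrite addr_ge0// sqr_ge0.
exists (3 + 12 * L + 12); split; first by lra.
move=> n; pose P : R := (freq n).1%:~R; pose Q : R := (freq n).2%:~R.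
have le1 : n.+1%:R <= (1 + 2 * `|P| + 2 * `|Q|) ^+ 2 :> R.
  by have := freq_index_leR R (freq n); rewrite freqK.
have le2 : (1 + 2 * `|P| + 2 * `|Q|) ^+ 2 <= 3 + 12 * (P ^+ 2 + Q ^+ 2).
  rewrite -[P ^+ 2]real_normK ?num_real// -[Q ^+ 2]real_normK ?num_real//.
  have := sqr_ge0 (1 - 2 * `|P|); have := sqr_ge0 (1 - 2 * `|Q|).
  have := sqr_ge0 (2 * `|P| - 2 * `|Q|); rewrite !expr2; lra.
have pi1 : 1 <= pi :> R by have := pi_ge2 R; lra.
have le3 : P ^+ 2 + Q ^+ 2 <= Cmod (lam n) + L.
  have := le_trans (ler_norm (- complex.Re (lam n))) (_ : _ <= Cmod (lam n)).
  rewrite normrN => /(_ (normr_Re_le _)).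
  rewrite /lam !expr2 /mu /coord /= /L -/P -/Q.
  have : 1 <= (2 * pi) ^+ 2 :> R by rewrite exprn_ege1//; lra.
  have := sqr_ge0 P; have := sqr_ge0 Q; rewrite !expr2; nra.
have := Cmod_ge0 (lam n); nra.
Qed.

(** Translation along an axis multiplies an exponential by a scalar one, so its
    directional derivatives are those of one-variable exponentials. *)
Lemma is_derive_expo_line (a : R[i]) s n j x t :
  is_derive t 1 (fun t : R => complex.Re (a * expo s n (t *: dir j + x)))
    (complex.Re (s%:C * mu j n * a * expo s n (t *: dir j + x))).
Proof.
have e z t' : complex.Re (z * expo s n (t' *: dir j + x)) =
  expR (s * (l.1 * x.1 + l.2 * x.2) + s * coord j l * t') *
  (complex.Re z * cos (s * phase n x + s * (2 * pi * (coord j (freq n))%:~R) * t')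
   - complex.Im z * sin (s * phase n x + s * (2 * pi * (coord j (freq n))%:~R) * t')).
  rewrite /expo ReM ReM ImM /= !mul0r subr0 addr0.
  rewrite (_ : s * (_ + _) = s * (l.1 * x.1 + l.2 * x.2) + s * coord j l * t').
    rewrite (_ : s * phase n (t' *: dir j + x) = s * phase n x +
       s * (2 * pi * (coord j (freq n))%:~R) * t'); first by ring.
    rewrite /phase /coord /dir; case: (j == ord0); rewrite /= /GRing.scale /=; ring.
  rewrite /coord /dir; case: (j == ord0); rewrite /= /GRing.scale /=; ring.
under eq_fun do rewrite e.
apply: is_derive_eq.
rewrite e !ReImE /= /GRing.scale /=; ring.
Qed.

Lemma expo_line_le s n j x t : `|t| <= 1 ->
  Cmod (expo s n (t *: dir j + x)) <=
  expR (`|s| * (`|l.1| + `|l.2|) * (`|x.1| + `|x.2| + 1)).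
Proof.
move=> t1; rewrite Cmod_expo ler_expR; apply: (le_trans (ler_norm _)).
rewrite normrM -mulrA ler_wpM2l// mulrDl; apply: (le_trans (ler_normD _ _)).
have h1 : `|(t *: dir j + x).1| <= `|x.1| + `|x.2| + 1.
  apply: (le_trans (ler_normD _ _)); rewrite /dir /=.
  have := normr_ge0 x.2; case: (j == ord0) => /=; rewrite /GRing.scale /= ?mulr1 ?mulr0 ?normr0; lra.
have h2 : `|(t *: dir j + x).2| <= `|x.1| + `|x.2| + 1.
  apply: (le_trans (ler_normD _ _)); rewrite /dir /=.
  have := normr_ge0 x.1; case: (j == ord0) => /=; rewrite /GRing.scale /= ?mulr1 ?mulr0 ?normr0; lra.
by rewrite !normrM; apply: lerD; rewrite ler_wpM2l.
Qed.

Lemma expo_box_le s n x r : `|x.1| <= r -> `|x.2| <= r ->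
  Cmod (expo s n x) <= expR (`|s| * (`|l.1| + `|l.2|) * r).
Proof.
move=> x1 x2; rewrite Cmod_expo ler_expR; apply: (le_trans (ler_norm _)).
rewrite normrM -mulrA ler_wpM2l// mulrDl; apply: (le_trans (ler_normD _ _)).
by rewrite !normrM; apply: lerD; rewrite ler_wpM2l.
Qed.

Definition expsum s a : R * R -> R[i] := fun x => csum (fun n => a n * expo s n x).

Lemma qbounded_expo (E M : R) s a x : (forall n, Cmod (expo s n x) <= E) ->
  qbounded M a -> qbounded (M * E) (fun n => a n * expo s n x).
Proof.
by move=> xE aM n; rewrite CmodM mulrAC; apply: ler_pM => //; rewrite mulr_ge0 ?exprn_ge0.
Qed.

Lemma expo_le s n x : Cmod (expo s n x) <=
  expR (`|s| * (`|l.1| + `|l.2|) * (`|x.1| + `|x.2|)).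
Proof. by apply: expo_box_le; rewrite ?lerDl ?lerDr. Qed.

Lemma expsum_qbounded s a x : rapid a ->
  exists M : R, qbounded M (fun n => a n * expo s n x).
Proof.
move=> /rapid_qbounded[M aM]; eexists.
by apply: qbounded_expo aM => n; exact: expo_le.
Qed.

Lemma expsum_box_le s a (M r : R) x : qbounded M a -> `|x.1| <= r -> `|x.2| <= r ->
  Cmod (expsum s a x) <= 4 * (M * expR (`|s| * (`|l.1| + `|l.2|) * r)).
Proof.
move=> aM x1 x2; apply: csum_le; apply: qbounded_expo aM => n.
exact: expo_box_le.
Qed.

Lemma expsumD s a b x : rapid a -> rapid b ->
  expsum s (fun n => a n + b n) x = expsum s a x + expsum s b x.
Proof.
move=> ra rb; have [M aM] := expsum_qbounded s x ra.
have [N bN] := expsum_qbounded s x rb.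
rewrite /expsum -(csumD aM bN); congr csum; apply/funext => n; exact: mulrDl.
Qed.

Lemma expsumZ s (c : R[i]) a x : rapid a ->
  expsum s (fun n => c * a n) x = c * expsum s a x.
Proof.
move=> ra; have [M aM] := expsum_qbounded s x ra.
by rewrite /expsum -(csumZ _ aM); congr csum; apply/funext => n; rewrite mulrA.
Qed.

Lemma expsum_delta s m : expsum s (delta m) = expo s m.
Proof.
apply/funext => x; rewrite /expsum -[RHS](csum_delta (fun n => expo s n x)).
by congr csum; apply/funext => n; rewrite mulrC.
Qed.

Definition dseq s j a : nat -> R[i] := fun n => s%:C * mu j n * a n.

Lemma rapid_dseq s j a : rapid a -> rapid (dseq s j a).
Proof. by apply: rapidM; apply: moderateM; [exact: moderate_cst|exact: moderate_mu]. Qed.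

(** Second-order Taylor estimates for the terms are summable because the
    coefficients decay rapidly; this is termwise differentiation with an
    explicit remainder. *)
Lemma is_derive_expsum s a j x : rapid a ->
  is_derive x (dir j) (fun y => complex.Re (expsum s a y))
    (complex.Re (expsum s (dseq s j a) x)).
Proof.
move=> ra; have r1 := rapid_dseq s j ra; have r2 := rapid_dseq s j r1.
pose E := expR (`|s| * (`|l.1| + `|l.2|) * (`|x.1| + `|x.2| + 1)).
have E0 : 0 <= E by exact: expR_ge0.
have [M aM] := rapid_qbounded r2.
apply: (@is_derive_of_quadratic _ _ _ _ _ (4 * (2 * E * M))) => t t1.
have [M0 h0] := expsum_qbounded s x ra.
have [Mt ht] := expsum_qbounded s (t *: dir j + x) ra.
have [M1 h1] := expsum_qbounded s x r1.
have h1t : qbounded (`|t| * M1) (fun n => t%:C * (dseq s j a n * expo s n x)).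
  by move=> n; rewrite CmodM Cmod_real -mulrA ler_wpM2l.
have h0t : qbounded (Mt + M0) (fun n => a n * expo s n (t *: dir j + x) - a n * expo s n x).
  move=> n; apply: le_trans (lerD (ht n) (h0 n)); rewrite -mulrDl ler_wpM2r ?exprn_ge0//.
  by apply: (le_trans (Cmod_le_add _ _)); rewrite CmodN.
rewrite (_ : _ - t * _ = complex.Re (csum (fun n =>
    a n * expo s n (t *: dir j + x) - a n * expo s n x -
    t%:C * (dseq s j a n * expo s n x)))); last first.
  by rewrite (csumB h0t h1t) (csumB ht h0) (csumZ _ h1) !ReImE /= mul0r subr0.
apply: (le_trans (normr_Re_le _)).
rewrite -mulrA; apply: csum_le => n.
set w := (X in Cmod X).
(* The real and imaginary parts of [w] are the real parts of its products with
   [1] and [- 'i], so one real estimate covers both. *)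
have term (c : R[i]) : Cmod c = 1 -> `|complex.Re (c * w)| <=
    E * Cmod (dseq s j (dseq s j a) n) * t ^+ 2.
  move=> c1.
  have := @taylor2 R (fun t : R => complex.Re (c * a n * expo s n (t *: dir j + x)))
    (fun t : R => complex.Re (s%:C * mu j n * (c * a n) * expo s n (t *: dir j + x)))
    (fun t : R => complex.Re (s%:C * mu j n * (s%:C * mu j n * (c * a n)) * expo s n (t *: dir j + x)))
    (E * Cmod (dseq s j (dseq s j a) n)) _ _ _ t t1.
  rewrite !scale0r !add0r (_ : t * complex.Re _ =
    complex.Re (t%:C * (s%:C * mu j n * (c * a n) * expo s n x))); last first.
    by rewrite [RHS]ReM /= mul0r subr0.
  rewrite -!ReN -!ReD (_ : _ + _ = c * w); last by rewrite /w /dseq; ring.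
  apply.
  - by move=> u; exact: is_derive_expo_line.
  - by move=> u; exact: is_derive_expo_line.
  - move=> u u1; apply: (le_trans (normr_Re_le _)).
    rewrite CmodM mulrC; apply: ler_pM => //; first exact: expo_line_le.
    by rewrite /dseq !CmodM c1 mul1r.
have im z : complex.Im z = complex.Re (- 'i * z) :> R.
  by case: z => p q; rewrite ReM ReN ImN /=; ring.
apply: (@le_trans _ _ (2 * (E * Cmod (dseq s j (dseq s j a) n) * t ^+ 2) * n.+1%:R ^+ 2)).
  rewrite ler_wpM2r ?exprn_ge0//; apply: (le_trans (Cmod_le_ReIm _)).
  rewrite [leRHS](_ : _ = E * Cmod (dseq s j (dseq s j a) n) * t ^+ 2 +
    E * Cmod (dseq s j (dseq s j a) n) * t ^+ 2); last by ring.
  apply: lerD; last by rewrite im; apply: term; exact: CmodNi.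
  by have := term 1; rewrite mul1r; apply; exact: Cmod1.
rewrite (_ : _ * _ = (2 * E * t ^+ 2) * (Cmod (dseq s j (dseq s j a) n) * n.+1%:R ^+ 2)); last by ring.
rewrite (_ : 2 * E * M * t ^+ 2 = (2 * E * t ^+ 2) * M); last by ring.
by rewrite ler_wpM2l// mulr_ge0 ?sqr_ge0// mulr_ge0.
Qed.

Lemma continuous_expsum s a : rapid a ->
  continuous (fun x => complex.Re (expsum s a x)).
Proof.
move=> ra; have [M0 h0] := rapid_qbounded (rapid_dseq s ord0 ra).
have [M1 h1] := rapid_qbounded (rapid_dseq s ord_max ra).
apply: (continuous_of_bounded_partials
  (K := fun r => 4 * ((M0 + M1) * expR (`|s| * (`|l.1| + `|l.2|) * r)))
  (fun x => is_derive_expsum s ord0 x ra) (fun x => is_derive_expsum s ord_max x ra)).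
move=> r x x1 x2; have M00 := qbounded_ge0 h0; have M10 := qbounded_ge0 h1.
split; apply: (le_trans (normr_Re_le _)); apply: expsum_box_le => // n.
  by apply: (le_trans (h0 n)); rewrite lerDl.
by apply: (le_trans (h1 n)); rewrite lerDr.
Qed.

Lemma smoothR_Re_expsum s a : rapid a ->
  smoothR (fun x => complex.Re (expsum s a x)).
Proof.
move=> ra q /=.
have [b rb ->] : exists2 b, rapid b &
    foldr (fun j (g : R * R -> R) x => 'D_(dir j) g x)
      (fun x => complex.Re (expsum s a x)) q =
    (fun x => complex.Re (expsum s b x)).
  elim: q => [|j q [b rb /= ->]]; first by exists a.
  exists (dseq s j b); first exact: rapid_dseq.
  by apply/funext => x; exact/derive_val/is_derive_expsum.
split; first exact: continuous_expsum.
by move=> j x; have [] := is_derive_expsum s j x rb.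
Qed.

Lemma Im_expsum s a x : rapid a ->
  complex.Im (expsum s a x) = complex.Re (expsum s (fun n => - 'i * a n) x).
Proof.
by move=> ra; rewrite expsumZ//; case: expsum => p q; rewrite ReM ReN ImN /=; ring.
Qed.

Lemma smooth_expsum s a : rapid a -> smooth (expsum s a).
Proof.
move=> ra; split; first exact: smoothR_Re_expsum.
rewrite (funext (fun x => Im_expsum s x ra)).
by apply: smoothR_Re_expsum; exact: rapidZ.
Qed.

Lemma pd_expsum s a j : rapid a -> pd j (expsum s a) = expsum s (dseq s j a).
Proof.
move=> ra; apply/funext => x; rewrite /pd; apply: complex_ext.
  exact/derive_val/is_derive_expsum.
rewrite (funext (fun x => Im_expsum s x ra)).
have -> := @derive_val _ _ _ _ _ _ _ (is_derive_expsum s j x (rapidZ (- 'i) ra)).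
rewrite [RHS]Im_expsum; last exact: rapid_dseq.
rewrite [LHS]/=.
by congr (complex.Re (expsum s _ x)); apply/funext => n; rewrite /dseq mulrCA.
Qed.

Lemma laplacian_expsum s a : s ^+ 2 = 1 -> rapid a ->
  laplacian (expsum s a) = expsum s (fun n => lam n * a n).
Proof.
move=> s2 ra; rewrite /laplacian /pd1 /pd2 !pd_expsum//; [|exact: rapid_dseq..].
apply/funext => x; rewrite /= fctE -expsumD; [|exact/rapid_dseq/rapid_dseq..].
congr (expsum s _ x); apply/funext => n; rewrite /dseq /lam.
have sC : s%:C ^+ 2 = 1 :> R[i] by rewrite -rmorphXn /= s2.
transitivity (s%:C ^+ 2 * ((mu ord0 n ^+ 2 + mu ord_max n ^+ 2) * a n)); first by ring.
by rewrite sC mul1r.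
Qed.

End Exponentials.

(** * Integration over the unit square *)

Section Square.
Context {R : realType}.
Notation plane := (measurableTypeR R * measurableTypeR R)%type.
Notation area := (@leb2 R).
Implicit Types (f g : R * R -> R) (A B : set R).

Lemma measurable_Omega : measurable (Omega : set plane).
Proof. by apply: measurableX; exact: measurable_itv. Qed.
Hint Resolve measurable_Omega : core.

Lemma area_box (a b c d : R) : a <= b -> c <= d ->
  area (`]a, b[ `*` `]c, d[)%classic = ((b - a) * (d - c))%:E.
Proof.
move=> ab cd; rewrite [LHS]product_measure1E; [|exact: measurable_itv..].
have len (x y : R) : x <= y -> lebesgue_measure `]x, y[%classic = (y - x)%:E.
  by move=> xy; rewrite lebesgue_measure_itv /= lte_fin; case: ltgtP xy => // -> _; rewrite subrr.
by rewrite EFinM; congr (_ * _)%E; exact: len.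
Qed.

Lemma area_Omega : area Omega = 1%E.
Proof. by rewrite area_box// subr0 mulr1. Qed.

Lemma area_Omega_lty : (area Omega < +oo)%E.
Proof. by rewrite area_Omega ltry. Qed.

(** An open set is the union of the countably many squares with rational centre
    and radius inside it, so the product sigma-algebra contains the Borel one. *)
Lemma open_measurable_plane (U : set (R * R)) : open U ->
  measurable (U : set plane).
Proof.
move=> oU.
pose box (q : rat * rat * rat) : set plane :=
  ball (ratr q.1.1 : R) (ratr q.2) `*` ball (ratr q.1.2 : R) (ratr q.2).
have -> : U = \bigcup_q (if `[< box q `<=` U >] then box q else set0).
  apply/seteqP; split => [[x y] Uxy|z [q _]]; last by case: asboolP => // + bz; exact.
  have [e /= e0 eU] : exists2 e : R, 0 < e & ball x e `*` ball y e `<=` U.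
    have [[P Q] /= [Px Qy] PQU] := oU _ Uxy.
    move/nbhs_ballP: Px => [d /= d0 dP]; move/nbhs_ballP: Qy => [e /= e0 eQ].
    exists (Num.min d e); first by rewrite lt_min d0 e0.
    move=> [u v] [/= xu yv]; apply: PQU; split => /=.
      by apply: dP; apply: le_ball xu; rewrite ge_min lexx.
    by apply: eQ; apply: le_ball yv; rewrite ge_min lexx orbT.
  have [r] := @rat_in_itvoo R 0 (e / 2) (divr_gt0 e0 (ltr0Sn _ _)).
  rewrite in_itv /= => /andP[r0 re].
  have rat_near (u : R) : exists q : rat, `|ratr q - u| < ratr r.
    have [q] := @rat_in_itvoo R u (u + ratr r) (ltac:(by rewrite ltrDl)).
    rewrite in_itv /= => /andP[uq qu]; exists q; rewrite ltr_norml; apply/andP; split; lra.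
  have [p px] := rat_near x; have [q qy] := rat_near y.
  exists (p, q, r) => //; case: asboolP => [_|bad]; first by split.
  exfalso; apply: bad => -[u v] [/= pu qv]; apply: eU; split => /=.
    rewrite /ball /= (_ : x - u = (x - ratr p) + (ratr p - u)); last ring.
    apply: (le_lt_trans (ler_normD _ _)); rewrite distrC.
    move: px pu; rewrite /ball /=; lra.
  rewrite /ball /= (_ : y - v = (y - ratr q) + (ratr q - v)); last ring.
  apply: (le_lt_trans (ler_normD _ _)); rewrite distrC.
  move: qy qv; rewrite /ball /=; lra.
apply: countable_bigcupT_measurable => [|q]; first exact: countableP.
case: asboolP => _ //.
by apply: measurableX; rewrite ball_itv; exact: measurable_itv.
Qed.

Lemma continuous_measurable_plane f (D : set plane) : continuous f ->
  measurable D -> measurable_fun D (f : plane -> R).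
Proof.
move=> cf mD; apply: (measurability _ (RGenOpens.measurableE R)).
move=> _ [_ [a [b ->] <-]]; apply: measurableI => //.
by apply: open_measurable_plane; apply: open_comp => // x _; exact: cf.
Qed.

Lemma continuous_bounded_square f : continuous f ->
  exists M : R, 0 <= M /\ forall x, Omega x -> `|f x| <= M.
Proof.
move=> cf.
have cs : compact (`[0, 1]%classic `*` `[0, 1]%classic : set (R * R)).
  by apply: compact_setX; exact: segment_compact.
have [M [_ Mf]] := compact_bounded (continuous_compact (continuous_subspaceT cf) cs).
exists (`|M| + 1); split; first by rewrite addr_ge0.
move=> x [x1 x2]; apply: (Mf (`|M| + 1)); first by rewrite ltr_pwDr ?ler_norm.
exists x => //; split; [move: x1|move: x2] => /=;
  by rewrite !in_itv /= => /andP[/ltW -> /ltW ->].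
Qed.

Definition integrableO f := area.-integrable Omega (EFin \o (f : plane -> R)).

Lemma bounded_integrableO f (M : R) : measurable_fun (Omega : set plane) f ->
  (forall x, Omega x -> `|f x| <= M) -> integrableO f.
Proof.
move=> mf fM; apply: measurable_bounded_integrable => //.
  exact: area_Omega_lty.
exists M; split; first exact: num_real.
by move=> y My x Ox; apply: (le_trans (fM _ Ox)); exact: ltW.
Qed.

Lemma integrableO_mul f g : integrableO f -> continuous g ->
  integrableO (fun x => f x * g x).
Proof.
move=> intf cg; have [M [_ Mg]] := continuous_bounded_square cg.
apply: (@integrableMl _ _ _ area _ _ (EFin \o f) g) => //.
  exact: continuous_measurable_plane.
exists M; split; first exact: num_real.
by move=> y My x Ox; apply: (le_trans (Mg _ Ox)); exact: ltW.
Qed.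

Lemma continuous_integrableO f : continuous f -> integrableO f.
Proof.
move=> cf; have [M [_ Mf]] := continuous_bounded_square cf.
by apply: bounded_integrableO Mf; exact: continuous_measurable_plane.
Qed.

Lemma integrableOD f g : integrableO f -> integrableO g ->
  integrableO (fun x => f x + g x).
Proof. by move=> hf hg; have := integrableD measurable_Omega hf hg. Qed.

Lemma integrableOZ (k : R) f : integrableO f -> integrableO (fun x => k * f x).
Proof. by move=> hf; have := integrableZl measurable_Omega k hf. Qed.

Lemma integrableO_norm f : integrableO f -> integrableO (fun x => `|f x|).
Proof. exact: integrable_norm. Qed.

Lemma integrableO_measurable f : integrableO f ->
  measurable_fun (Omega : set plane) f.
Proof. by move=> /integrableP[/measurable_EFinP]. Qed.

Lemma le_integrableO f g : measurable_fun (Omega : set plane) f ->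
  (forall x, Omega x -> `|f x| <= g x) -> integrableO g -> integrableO f.
Proof.
move=> mf fg ig; apply: (le_integrable measurable_Omega _ _ ig).
  exact/measurable_EFinP.
by move=> x Ox; rewrite lee_fin; apply: (le_trans (fg _ Ox)); exact: ler_norm.
Qed.

Notation intO f := (\int[area]_(x in Omega) f x)%R.

Lemma intOD f g : integrableO f -> integrableO g ->
  intO (fun x => f x + g x) = intO f + intO g.
Proof. by move=> hf hg; rewrite RintegralD. Qed.

Lemma intOZ (k : R) f : integrableO f -> intO (fun x => k * f x) = k * intO f.
Proof. by move=> hf; rewrite RintegralZl. Qed.

Lemma intO_cst (k : R) : intO (fun=> k) = k.
Proof. by rewrite Rintegral_cst// area_Omega /= mulr1. Qed.

Lemma le_intO f g : integrableO f -> integrableO g ->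
  (forall x, Omega x -> f x <= g x) -> intO f <= intO g.
Proof. by move=> hf hg fg; apply: le_Rintegral. Qed.

Lemma normr_intO f : integrableO f -> `|intO f| <= intO (fun x => `|f x|).
Proof. by move=> hf; exact: le_normr_Rintegral. Qed.

Lemma eq_intO f g : (forall x, Omega x -> f x = g x) -> intO f = intO g.
Proof. by move=> fg; apply: eq_Rintegral => x /set_mem; exact: fg. Qed.

Definition aeq (T : Type) (f g : R * R -> T) :=
  {ae area, forall x, Omega x -> f x = g x}.

Lemma ae_mono (P Q : R * R -> Prop) : (forall x, P x -> Q x) ->
  {ae area, forall x, P x} -> {ae area, forall x, Q x}.
Proof. by move=> PQ; apply: (@filterS _ _ (ae_filter_ringOfSetsType area)). Qed.

Lemma ae_and (P Q : R * R -> Prop) : {ae area, forall x, P x} ->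
  {ae area, forall x, Q x} -> {ae area, forall x, P x /\ Q x}.
Proof. exact: (@filterI _ _ (ae_filter_ringOfSetsType area)). Qed.

Lemma aeq_refl (T : Type) (f g : R * R -> T) :
  (forall x, Omega x -> f x = g x) -> aeq f g.
Proof. by move=> fg; exact: aeW. Qed.

Lemma aeq_sym (T : Type) (f g : R * R -> T) : aeq f g -> aeq g f.
Proof. by apply: ae_mono => x /[apply] ->. Qed.

Lemma aeq_trans (T : Type) (f g k : R * R -> T) : aeq f g -> aeq g k -> aeq f k.
Proof.
by move=> fg gk; apply: ae_mono (ae_and fg gk) => x [p q] Ox; rewrite p// q.
Qed.

Lemma ae_eq_intO f g : measurable_fun (Omega : set plane) f ->
  measurable_fun (Omega : set plane) g -> aeq f g -> intO f = intO g.
Proof.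
move=> mf mg fg; congr fine; apply: ae_eq_integral => //.
- exact/measurable_EFinP.
- exact/measurable_EFinP.
- by apply: ae_mono fg => x /[apply] /= ->.
Qed.

Lemma continuous_section1 f (y : R) : continuous f ->
  continuous (fun x : R => f (x, y)).
Proof.
move=> cf x; apply: (@continuous_comp _ _ _ (fun x : R => (x, y)) f); last exact: cf.
by apply: (@cvg_pair _ _ _ (nbhs x) (nbhs x) (nbhs y)); [exact: cvg_id|exact: cvg_cst].
Qed.

Lemma continuous_section2 f (x : R) : continuous f ->
  continuous (fun y : R => f (x, y)).
Proof.
move=> cf y; apply: (@continuous_comp _ _ _ (fun y : R => (x, y)) f); last exact: cf.
by apply: (@cvg_pair _ _ _ (nbhs y) (nbhs x) (nbhs y)); [exact: cvg_cst|exact: cvg_id].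
Qed.

Lemma integral_periodic_primitive (G D : R -> R) : continuous D ->
  (forall x : R, is_derive x 1 G (D x)) -> G 0 = G 1 ->
  (\int[@lebesgue_measure R]_(x in `]0%R, 1%R[) (D x)%:E = 0)%E.
Proof.
move=> cD GD G01; have cG : continuous G.
  by move=> x; apply/differentiable_continuous/derivable1_diffP.
rewrite -(@integral_itv_bndoo R 0 1 _ true false); last first.
  apply/measurable_EFinP; apply: measurable_funTS.
  exact: continuous_measurable_fun.
apply: (etrans (@continuous_FTC2 R D G 0 1 ltr01 _ _ _)).
- exact: continuous_subspaceT.
- split => [x _ | | ].
  + by have [] := GD x.
  + exact/cvg_at_right_filter/cG.
  + exact/cvg_at_left_filter/cG.
- by move=> x _; rewrite derive1E; have [_] := GD x.
- by rewrite G01 subee.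
Qed.

Lemma integrable_restrict_Omega f : continuous f ->
  area.-integrable setT (EFin \o (f \_ (Omega : set plane))).
Proof.
move=> cf; rewrite -restrict_EFin; apply/integrable_restrict => //; rewrite ?setTI//.
exact: continuous_integrableO.
Qed.

(** Fubini reduces the vanishing of the integral of a partial derivative of a
    periodic function to the fundamental theorem of calculus on each line. *)
Lemma intO_partial1 g (d : R * R -> R) : continuous d ->
  (forall x, is_derive x (dir ord0) g (d x)) ->
  (forall t, 0 <= t <= 1 -> g (0, t) = g (1, t)) -> intO d = 0.
Proof.
move=> cd gd per; rewrite Rintegral_mkcond /Rintegral.
rewrite -(integral21_prod_meas1 (integrable_restrict_Omega cd)).
rewrite (_ : (\int[_]_x _)%E = 0%E)//.
apply: integral0_eq => y _; rewrite /fubini_G.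
have [y01|y01] := boolP (y \in `]0, 1[); last first.
  apply: integral0_eq => x _ /=; rewrite patchE ifF//.
  by apply/negbTE/negP => /set_mem[_] /=; apply/negP.
transitivity (\int[@lebesgue_measure R]_(x in `]0%R, 1%R[) (d (x, y))%:E)%E.
  rewrite [RHS]integral_mkcond; apply: eq_integral => x _ /=.
  rewrite !patchE; case: ifPn => [/set_mem[/= x01 _]|xy]; first by rewrite mem_set.
  rewrite ifF//; apply/negbTE/negP => /set_mem x01; move/negP: xy; apply.
  by apply/mem_set; split.
apply: (integral_periodic_primitive (G := fun x => g (x, y))).
- exact: continuous_section1.
- by move=> x; exact: is_derive_section1.
- by apply: per; move: y01; rewrite in_itv /= => /andP[/ltW -> /ltW ->].
Qed.

Lemma intO_partial2 g (d : R * R -> R) : continuous d ->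
  (forall x, is_derive x (dir ord_max) g (d x)) ->
  (forall t, 0 <= t <= 1 -> g (t, 0) = g (t, 1)) -> intO d = 0.
Proof.
move=> cd gd per; rewrite Rintegral_mkcond /Rintegral.
rewrite -(integral12_prod_meas1 (integrable_restrict_Omega cd)).
rewrite (_ : (\int[_]_x _)%E = 0%E)//.
apply: integral0_eq => x _; rewrite /fubini_F.
have [x01|x01] := boolP (x \in `]0, 1[); last first.
  apply: integral0_eq => y _ /=; rewrite patchE ifF//.
  by apply/negbTE/negP => /set_mem[+ _] /=; apply/negP.
transitivity (\int[@lebesgue_measure R]_(y in `]0%R, 1%R[) (d (x, y))%:E)%E.
  rewrite [RHS]integral_mkcond; apply: eq_integral => y _ /=.
  rewrite !patchE; case: ifPn => [/set_mem[/= _ y01]|xy]; first by rewrite mem_set.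
  rewrite ifF//; apply/negbTE/negP => /set_mem y01; move/negP: xy; apply.
  by apply/mem_set; split.
apply: (integral_periodic_primitive (G := fun y => g (x, y))).
- exact: continuous_section2.
- by move=> y; exact: is_derive_section2.
- by apply: per; move: x01; rewrite in_itv /= => /andP[/ltW -> /ltW ->].
Qed.

End Square.
#[global] Hint Resolve measurable_Omega : core.
Notation plane R := (measurableTypeR R * measurableTypeR R)%type.
Notation intO f := (\int[leb2]_(x in Omega) f x)%R.

(** * Complex-valued integrals and the L2 norm *)

Section ComplexIntegral.
Context {R : realType}.
Notation area := (@leb2 R).
Implicit Types (f g : R * R -> R[i]) (j : 'I_2).

Definition cint f := integrableO (fun x => complex.Re (f x)) /\
  integrableO (fun x => complex.Im (f x)).

Definition ccont f := continuous (fun x => complex.Re (f x)) /\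
  continuous (fun x => complex.Im (f x)).

Definition cmeas f :=
  measurable_fun (Omega : set (plane R)) (fun x => complex.Re (f x)) /\
  measurable_fun (Omega : set (plane R)) (fun x => complex.Im (f x)).

Lemma cint_cmeas f : cint f -> cmeas f.
Proof. by move=> [? ?]; split; exact: integrableO_measurable. Qed.

Lemma ccont_cmeas f : ccont f -> cmeas f.
Proof. by move=> [? ?]; split; exact: continuous_measurable_plane. Qed.

Lemma ccont_cint f : ccont f -> cint f.
Proof. by move=> [? ?]; split; exact: continuous_integrableO. Qed.

Lemma cintM f g : cint f -> ccont g -> cint (fun x => f x * g x).
Proof.
move=> [fr fi] [gr gi]; split.
  rewrite (_ : (fun x => _) = fun x => complex.Re (f x) * complex.Re (g x) +
      (-1) * (complex.Im (f x) * complex.Im (g x))); last first.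
    by apply/funext => x; rewrite ReM mulN1r.
  by apply: integrableOD; [|apply: integrableOZ]; exact: integrableO_mul.
under eq_fun do rewrite ImM.
by apply: integrableOD; exact: integrableO_mul.
Qed.

Lemma ccont_cst (c : R[i]) : ccont (fun=> c).
Proof. by split; move=> x; exact: cvg_cst. Qed.

Lemma cintZ (c : R[i]) f : cint f -> cint (fun x => c * f x).
Proof.
move=> hf; under eq_fun do rewrite mulrC.
by apply: cintM => //; exact: ccont_cst.
Qed.

Lemma cintegralD f g : cint f -> cint g ->
  cintegral (fun x => f x + g x) = cintegral f + cintegral g.
Proof.
move=> [fr fi] [gr gi]; apply: complex_ext; rewrite ?ReD ?ImD /cintegral /=.
  by rewrite -intOD//; apply: eq_intO => x _; rewrite ReD.
by rewrite -intOD//; apply: eq_intO => x _; rewrite ImD.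
Qed.

Lemma cintegralZ (c : R[i]) f : cint f ->
  cintegral (fun x => c * f x) = c * cintegral f.
Proof.
move=> [fr fi]; apply: complex_ext; rewrite ?ReM ?ImM /cintegral /=.
  rewrite -!intOZ// -[X in _ = _ + X]mulN1r -intOZ; last exact: integrableOZ.
  rewrite -intOD; [|exact: integrableOZ|exact/integrableOZ/integrableOZ].
  by apply: eq_intO => x _; rewrite ReM mulN1r.
rewrite -!intOZ// -intOD; [|exact: integrableOZ..].
by apply: eq_intO => x _; rewrite ImM.
Qed.

Lemma cintegralB f g : cint f -> cint g ->
  cintegral (fun x => f x - g x) = cintegral f - cintegral g.
Proof.
move=> hf hg; rewrite -[- cintegral g]mulN1r -cintegralZ// -cintegralD//; last exact: cintZ.
by congr cintegral; apply/funext => x; rewrite mulN1r.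
Qed.

Lemma cintegral_conj f : cint f -> cintegral (fun x => (f x)^*) = (cintegral f)^*.
Proof.
move=> [fr fi]; apply: complex_ext; rewrite ?Re_conj ?Im_conj /cintegral /=.
  by apply: eq_intO => x _; rewrite Re_conj.
rewrite -[RHS]mulN1r -intOZ//; apply: eq_intO => x _; by rewrite Im_conj mulN1r.
Qed.

Lemma aeq_cintegral f g : cmeas f -> cmeas g -> aeq f g -> cintegral f = cintegral g.
Proof.
move=> [fr fi] [gr gi] fg; apply: complex_ext; apply: ae_eq_intO => //.
  by apply: ae_mono fg => x /[apply] ->.
by apply: ae_mono fg => x /[apply] ->.
Qed.

Lemma Cmod_measurable f : cmeas f ->
  measurable_fun (Omega : set (plane R)) (fun x => Cmod (f x)).
Proof.
move=> [fr fi]; under eq_fun do rewrite CmodE.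
apply: (@measurableT_comp _ _ _ _ _ _ (@Num.sqrt R)).
  by apply: continuous_measurable_fun; exact: sqrt_continuous.
by apply: measurable_funD; exact: measurable_funX.
Qed.

Lemma cint_Cmod f : cint f -> integrableO (fun x => Cmod (f x)).
Proof.
move=> /[dup] cf [fr fi].
apply: (@le_integrableO _ _ (fun x => `|complex.Re (f x)| + `|complex.Im (f x)|)).
- by apply: Cmod_measurable; exact: cint_cmeas.
- by move=> x _; rewrite ger0_norm//; exact: Cmod_le_ReIm.
- by apply: integrableOD; exact: integrableO_norm.
Qed.

Lemma Cmod_cintegral f : cint f ->
  Cmod (cintegral f) <= 2 * intO (fun x => Cmod (f x)).
Proof.
move=> /[dup] cf [fr fi]; have im := cint_Cmod cf.
apply: (le_trans (Cmod_le_ReIm _)); rewrite [leRHS]mulr_natl [leRHS]mulr2n.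
apply: lerD; apply: (le_trans (normr_intO _)) => //; apply: le_intO => //.
- exact: integrableO_norm.
- by move=> x _; exact: normr_Re_le.
- exact: integrableO_norm.
- by move=> x _; exact: normr_Im_le.
Qed.

Lemma Cmod_cintegral_mul f g (M : R) : cint f -> ccont g ->
  (forall x, Omega x -> Cmod (g x) <= M) ->
  Cmod (cintegral (fun x => f x * g x)) <= 2 * M * intO (fun x => Cmod (f x)).
Proof.
move=> cf cg gM; have ifg := cintM cf cg.
apply: (le_trans (Cmod_cintegral ifg)).
rewrite -mulrA ler_pM2l// -intOZ; last exact: cint_Cmod.
apply: le_intO; [exact: cint_Cmod|exact/integrableOZ/cint_Cmod|].
by move=> x Ox; rewrite CmodM mulrC ler_wpM2r// gM.
Qed.

Lemma L2_cmeas f : L2 f -> cmeas f.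
Proof. by case. Qed.

Lemma L2_integrable_sqr f : L2 f -> integrableO (fun x => Cmod (f x) ^+ 2).
Proof.
move=> /[dup] /L2_cmeas mf [_ _ fin]; apply/integrableP; split.
  by apply/measurable_EFinP; apply: measurable_funX; exact: Cmod_measurable.
apply: le_lt_trans fin; rewrite le_eqVlt; apply/orP; left; apply/eqP.
by apply: eq_integral => x _ /=; rewrite ger0_norm// exprn_ge0.
Qed.

Lemma integrable_sqr_L2 f : cmeas f -> integrableO (fun x => Cmod (f x) ^+ 2) ->
  L2 f.
Proof.
move=> [fr fi] /integrableP[_ fin]; split => //.
apply: le_lt_trans fin; rewrite le_eqVlt; apply/orP; left; apply/eqP.
by apply: eq_integral => x _ /=; rewrite ger0_norm// exprn_ge0.
Qed.

Lemma ccont_bounded f : ccont f -> exists M : R, 0 <= M /\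
  forall x, Omega x -> Cmod (f x) <= M.
Proof.
move=> [fr fi]; have [M [M0 fM]] := continuous_bounded_square fr.
have [N [N0 fN]] := continuous_bounded_square fi.
exists (M + N); split; first exact: addr_ge0.
by move=> x Ox; apply: (le_trans (Cmod_le_ReIm _)); apply: lerD; [exact: fM|exact: fN].
Qed.

Lemma aeq_bounded_L2 f g (M : R) : cmeas f -> aeq f g ->
  (forall x, Omega x -> Cmod (g x) <= M) -> L2 f.
Proof.
move=> /[dup] mf [fr fi] fg gM; split => //.
have le : (\int[area]_(x in Omega) (Cmod (f x) ^+ 2)%:E <=
    \int[area]_(x in Omega) (M ^+ 2)%:E)%E.
  apply: ae_ge0_le_integral => //.
  - by move=> x _; rewrite lee_fin exprn_ge0.
  - by apply/measurable_EFinP; apply: measurable_funX; exact: Cmod_measurable.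
  - by move=> x _; rewrite lee_fin exprn_even_ge0.
  - apply: ae_mono fg => x /[swap] Ox /(_ Ox) ->; rewrite lee_fin.
    by rewrite lerXn2r ?nnegrE ?gM// (le_trans _ (gM x Ox)).
by apply: (le_lt_trans le); rewrite integral_cst// area_Omega mule1 ltry.
Qed.

Lemma ccont_L2 f : ccont f -> L2 f.
Proof.
move=> cf; have [M [_ fM]] := ccont_bounded cf.
by apply: (aeq_bounded_L2 (ccont_cmeas cf) _ fM); exact: aeq_refl.
Qed.

Lemma L2_cint f : L2 f -> cint f.
Proof.
move=> /[dup] /L2_cmeas [fr fi] /L2_integrable_sqr i2.
have i3 : integrableO (fun x => 1 + Cmod (f x) ^+ 2).
  by apply: integrableOD => //; apply: continuous_integrableO => x; exact: cvg_cst.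
have le x : Cmod (f x) <= 1 + Cmod (f x) ^+ 2.
  by have := Cmod_ge0 (f x); have := sqr_ge0 (1 - Cmod (f x)); rewrite !expr2; nra.
by split; apply: (le_integrableO _ _ i3) => // x _; apply: (le_trans _ (le x));
  [exact: normr_Re_le|exact: normr_Im_le].
Qed.

Lemma L2D f g : L2 f -> L2 g -> L2 (f + g).
Proof.
move=> f2 g2; have [fr fi] := L2_cmeas f2; have [gr gi] := L2_cmeas g2.
have mfg : cmeas (f + g).
  split; first by under eq_fun do rewrite ReD; exact: measurable_funD.
  by under eq_fun do rewrite ImD; exact: measurable_funD.
apply: integrable_sqr_L2 => //.
apply: (@le_integrableO _ _ (fun x => 2 * Cmod (f x) ^+ 2 + 2 * Cmod (g x) ^+ 2)).
- by apply: measurable_funX; exact: Cmod_measurable.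
- move=> x _; rewrite ger0_norm ?exprn_ge0//.
  apply: (@le_trans _ _ ((Cmod (f x) + Cmod (g x)) ^+ 2)).
    by rewrite lerXn2r ?nnegrE ?addr_ge0// Cmod_le_add.
  by have := sqr_ge0 (Cmod (f x) - Cmod (g x)); rewrite !expr2; nra.
- by apply: integrableOD; apply: integrableOZ; exact: L2_integrable_sqr.
Qed.

Lemma L2Z (c : R[i]) f : L2 f -> L2 (c *: f).
Proof.
move=> f2; have [fr fi] := L2_cmeas f2.
apply: integrable_sqr_L2.
  by apply: cint_cmeas; apply: cintZ; exact: L2_cint.
rewrite (_ : (fun x => _) = fun x => Cmod c ^+ 2 * Cmod (f x) ^+ 2).
  by apply: integrableOZ; exact: L2_integrable_sqr.
by apply/funext => x; rewrite -exprMn -CmodM.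
Qed.

Lemma L2B f g : L2 f -> L2 g -> L2 (f - g).
Proof. by move=> f2 g2; rewrite -[- g]scaleN1r; apply: L2D => //; exact: L2Z. Qed.

Lemma L2norm_ge0 f : 0 <= L2norm f.
Proof. exact: sqrtr_ge0. Qed.

Lemma aeq_L2norm f g : L2 f -> L2 g -> aeq f g -> L2norm f = L2norm g.
Proof.
move=> f2 g2 fg; rewrite /L2norm; congr Num.sqrt; apply: ae_eq_intO.
- by apply: measurable_funX; apply: Cmod_measurable; exact: L2_cmeas.
- by apply: measurable_funX; apply: Cmod_measurable; exact: L2_cmeas.
- by apply: ae_mono fg => x /[apply] ->.
Qed.

Lemma L2norm_sqr f : L2norm f ^+ 2 = intO (fun x => Cmod (f x) ^+ 2).
Proof. by rewrite sqr_sqrtr// Rintegral_ge0// => x _; rewrite exprn_ge0. Qed.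

Lemma L2norm_le_sup f g (M : R) : 0 <= M -> L2 f -> aeq f g -> ccont g ->
  (forall x, Omega x -> Cmod (g x) <= M) -> L2norm f <= M.
Proof.
move=> M0 f2 fg cg gM; have g2 := ccont_L2 cg.
rewrite (aeq_L2norm f2 g2 fg) -(@ler_pXn2r _ 2) ?nnegrE ?L2norm_ge0//.
rewrite L2norm_sqr -[leRHS]intO_cst; apply: le_intO.
- exact: L2_integrable_sqr.
- by apply: continuous_integrableO => x; exact: cvg_cst.
- by move=> x Ox; rewrite lerXn2r ?nnegrE ?gM.
Qed.

(** Cauchy-Schwarz against the constant 1 on a probability space, from
    [2 t |f| <= t^2 + |f|^2] with the best [t]. *)
Lemma intO_Cmod_le_L2norm f : L2 f -> intO (fun x => Cmod (f x)) <= L2norm f.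
Proof.
move=> f2; have if1 := cint_Cmod (L2_cint f2); have if2 := L2_integrable_sqr f2.
set N := L2norm f; set A := (X in X <= N).
have N0 : 0 <= N by exact: L2norm_ge0.
have key t : 0 < t -> 2 * t * A <= t ^+ 2 + N ^+ 2.
  move=> t0; rewrite -intOZ// L2norm_sqr -[t ^+ 2]intO_cst -intOD//; last first.
    by apply: continuous_integrableO => x; exact: cvg_cst.
  apply: le_intO; first exact: integrableOZ.
    apply: integrableOD => //; apply: continuous_integrableO => x; exact: cvg_cst.
  by move=> x _; have := sqr_ge0 (t - Cmod (f x)); rewrite !expr2; nra.
apply/ler_addgt0Pl => e e0.
have t0 : 0 < e + N by rewrite ltr_pwDl.
have := key _ t0; rewrite -mulrA => h.
rewrite -(ler_pM2l t0) -(ler_pM2l (ltr0Sn R 1)); apply: (le_trans h).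
have : N ^+ 2 <= (e + N) ^+ 2 by rewrite lerXn2r ?nnegrE ?lerDr// ltW.
by rewrite !expr2; lra.
Qed.

Lemma cint_ccont_L2_le f g (M : R) : L2 f -> ccont g -> 0 <= M ->
  (forall x, Omega x -> Cmod (g x) <= M) ->
  Cmod (cintegral (fun x => f x * g x)) <= 2 * M * L2norm f.
Proof.
move=> f2 cg M0 gM; apply: (le_trans (Cmod_cintegral_mul (L2_cint f2) cg gM)).
by rewrite ler_wpM2l ?mulr_ge0//; exact: intO_Cmod_le_L2norm.
Qed.

(** A box around a point where continuous functions differ has positive area. *)
Lemma aeq_continuous f g : ccont f -> ccont g -> aeq f g ->
  forall x, Omega x -> f x = g x.
Proof.
have near (u t e r : R) : e <= r -> u - e < t -> t < u + e -> `|u - t| < r.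
  by move=> ? ? ?; rewrite ltr_norml; apply/andP; split; lra.
have inside (u t e : R) : e <= u -> e <= 1 - u -> u - e < t -> t < u + e -> 0 < t < 1.
  by move=> ? ? ? ?; apply/andP; split; lra.
move=> [fr fi] [gr gi] [N [mN N0 sub]] x Ox; apply: contrapT => fgx.
pose d y := `|complex.Re (f y) - complex.Re (g y)| + `|complex.Im (f y) - complex.Im (g y)|.
have cd : continuous d.
  by move=> y; apply: cvgD; apply: cvg_norm; apply: cvgB;
    [exact: fr|exact: gr|exact: fi|exact: gi].
have dx : 0 < d x.
  rewrite lt_neqAle eq_sym addr_ge0// andbT; apply/eqP => /eqP.
  rewrite paddr_eq0// !normr_eq0 !subr_eq0 => /andP[/eqP p /eqP q].
  exact/fgx/complex_ext.
have [[P Q] /= [Px Qx] PQ] : nbhs x [set y | 0 < d y].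
  by apply: (cd x [set t | 0 < t]); exact: lt_nbhsr.
move: Ox => [/=]; rewrite !in_itv /= => /andP[x10 x11] /andP[x20 x21].
move/nbhs_ballP: Px => [p /= p0 pP]; move/nbhs_ballP: Qx => [q /= q0 qQ].
pose e := Num.min (Num.min p q) (Num.min (Num.min x.1 (1 - x.1)) (Num.min x.2 (1 - x.2))).
have e0 : 0 < e by rewrite !lt_min p0 q0 x10 x20 !subr_gt0 x11.
have [ep eq ex1 ex1' [ex2 ex2']] :
    [/\ e <= p, e <= q, e <= x.1, e <= 1 - x.1 & e <= x.2 /\ e <= 1 - x.2].
  by split; [| | | | split]; rewrite /e !ge_min !lexx ?orbT.
pose bx : set (plane R) :=
  `]x.1 - e, x.1 + e[%classic `*` `]x.2 - e, x.2 + e[%classic.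
have boxN : bx `<=` N.
  move=> y [/=]; rewrite !in_itv /= => /andP[y1 y1'] /andP[y2 y2'].
  apply: sub => /= fgy.
  have Oy : Omega y.
    by split; rewrite /= in_itv /=; [exact: (inside x.1 _ e)|exact: (inside x.2 _ e)].
  have : 0 < d y.
    rewrite [y]surjective_pairing; apply: PQ; split => /=.
      by apply: pP; exact: near y1 y1'.
    by apply: qQ; exact: near y2 y2'.
  by rewrite /d (fgy Oy) !subrr normr0 addr0 ltxx.
have : (area bx <= area N)%E.
  apply: le_measure boxN; rewrite inE//.
  by apply: measurableX; exact: measurable_itv.
have wide (u : R) : u - e < u + e by rewrite ltrD2l gtrN.
rewrite N0 area_box; [|exact/ltW/wide|exact/ltW/wide].
by rewrite lee_fin leNgt mulr_gt0// subr_gt0.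
Qed.

End ComplexIntegral.

(** * Integration by parts and termwise integration *)

Section ByParts.
Context {R : realType}.
Implicit Types (f g : R * R -> R[i]) (j : 'I_2) (h k : R * R).

(** The point at position [s] across the two sides orthogonal to direction [j]
    and at position [t] along them. *)
Definition face j (s t : R) : R * R := if j == ord0 then (s, t) else (t, s).

Lemma smoothR_partial (u : R * R -> R) j : smoothR u -> smoothR (fun x => 'D_(dir j) u x).
Proof.
move=> su s /=; have := su (rcons s j).
by rewrite -cats1 foldr_cat.
Qed.

Lemma smooth_ccont f : smooth f -> ccont f.
Proof. by move=> [fr fi]; split; [have [] := fr [::]|have [] := fi [::]]. Qed.

Lemma smooth_pd j f : smooth f -> smooth (pd j f).
Proof. by move=> [fr fi]; split; [exact: (smoothR_partial j fr)|exact: (smoothR_partial j fi)]. Qed.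

Lemma smooth_laplacian_ccont f : smooth f -> ccont (laplacian f).
Proof.
move=> sf.
have [r1 i1] := smooth_ccont (smooth_pd ord0 (smooth_pd ord0 sf)).
have [r2 i2] := smooth_ccont (smooth_pd ord_max (smooth_pd ord_max sf)).
split.
  rewrite (_ : (fun x => _) = fun x => complex.Re (pd ord0 (pd ord0 f) x) +
    complex.Re (pd ord_max (pd ord_max f) x)); last by apply/funext => x; rewrite -ReD.
  by move=> x; apply: cvgD; [exact: r1|exact: r2].
rewrite (_ : (fun x => _) = fun x => complex.Im (pd ord0 (pd ord0 f) x) +
  complex.Im (pd ord_max (pd ord_max f) x)); last by apply/funext => x; rewrite -ImD.
by move=> x; apply: cvgD; [exact: i1|exact: i2].
Qed.

Lemma ccontM f g : ccont f -> ccont g -> ccont (fun x => f x * g x).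
Proof.
move=> [fr fi] [gr gi]; split.
  under eq_fun do rewrite ReM.
  by move=> x; apply: cvgB; apply: cvgM; [exact: fr|exact: gr|exact: fi|exact: gi].
under eq_fun do rewrite ImM.
by move=> x; apply: cvgD; apply: cvgM; [exact: fr|exact: gi|exact: fi|exact: gr].
Qed.

Lemma ccontD f g : ccont f -> ccont g -> ccont (fun x => f x + g x).
Proof.
move=> [fr fi] [gr gi]; split.
  by under eq_fun do rewrite ReD; move=> x; apply: cvgD; [exact: fr|exact: gr].
by under eq_fun do rewrite ImD; move=> x; apply: cvgD; [exact: fi|exact: gi].
Qed.

Lemma is_derive_Re f j x : smooth f ->
  is_derive x (dir j) (fun y => complex.Re (f y)) (complex.Re (pd j f x)).
Proof. by move=> [fr _]; have [_ d] := fr [::]; apply: DeriveDef; [exact: d|]. Qed.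

Lemma is_derive_Im f j x : smooth f ->
  is_derive x (dir j) (fun y => complex.Im (f y)) (complex.Im (pd j f x)).
Proof. by move=> [_ fi]; have [_ d] := fi [::]; apply: DeriveDef; [exact: d|]. Qed.

Lemma direction_cases j : j = ord0 \/ j = ord_max.
Proof. by case: j => -[|[|//]] i; [left|right]; exact: val_inj. Qed.

Lemma intO_partial (g d : R * R -> R) j : continuous d ->
  (forall x, is_derive x (dir j) g (d x)) ->
  (forall t, 0 <= t <= 1 -> g (face j 0 t) = g (face j 1 t)) -> intO d = 0.
Proof.
by case: (direction_cases j) => ->; [exact: intO_partial1|exact: intO_partial2].
Qed.

Lemma cintegral_by_parts j f g : smooth f -> smooth g ->
  (forall t, 0 <= t <= 1 ->
    f (face j 0 t) * g (face j 0 t) = f (face j 1 t) * g (face j 1 t)) ->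
  cintegral (fun x => pd j f x * g x) = - cintegral (fun x => f x * pd j g x).
Proof.
move=> sf sg per; have cf := smooth_ccont sf; have cg := smooth_ccont sg.
have cdf := smooth_ccont (smooth_pd j sf); have cdg := smooth_ccont (smooth_pd j sg).
have cfdg := ccontM cf cdg; have cdfg := ccontM cdf cg.
apply/eqP; rewrite -addr_eq0 -cintegralD; [|exact: ccont_cint..].
have [cr ci] := ccontD cdfg cfdg.
apply/eqP/complex_ext.
  apply: (intO_partial (j := j) (g := fun x => complex.Re (f x * g x))) => //.
    move=> x; have := is_derive_Re j x sf => ?; have := is_derive_Re j x sg => ?.
    have := is_derive_Im j x sf => ?; have := is_derive_Im j x sg => ?.
    under eq_fun do rewrite ReM.
    by apply: is_derive_eq; rewrite ReD !ReM /GRing.scale /=; ring.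
  by move=> t t01; rewrite per.
apply: (intO_partial (j := j) (g := fun x => complex.Im (f x * g x))) => //.
  move=> x; have := is_derive_Re j x sf => ?; have := is_derive_Re j x sg => ?.
  have := is_derive_Im j x sf => ?; have := is_derive_Im j x sg => ?.
  under eq_fun do rewrite ImM.
  by apply: is_derive_eq; rewrite ImD !ImM /GRing.scale /=; ring.
by move=> t t01; rewrite per.
Qed.

Lemma BC_face h f j t : BC h f -> 0 <= t <= 1 ->
  f (face j 1 t) = (coord j h)%:C * f (face j 0 t) /\
  pd j f (face j 1 t) = (coord j h)%:C * pd j f (face j 0 t).
Proof.
move=> bf t01; have [b1 b2 b3 b4] := bf t t01.
by case: (direction_cases j) => ->; rewrite /face /coord /= ?b1 ?b2 ?b3 ?b4.
Qed.

(** Green's formula: boundary terms cancel against the reciprocal boundary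
    conditions. *)
Lemma green h k f g : h.1 * k.1 = 1 -> h.2 * k.2 = 1 ->
  smooth f -> BC h f -> smooth g -> BC k g ->
  cintegral (fun x => laplacian f x * g x) =
  cintegral (fun x => f x * laplacian g x).
Proof.
move=> hk1 hk2 sf bf sg bg.
have one j : cintegral (fun x => pd j (pd j f) x * g x) =
    cintegral (fun x => f x * pd j (pd j g) x).
  have hkj : (coord j h)%:C * (coord j k)%:C = 1 :> R[i].
    by rewrite -rmorphM /= /coord; case: ifP; rewrite ?hk1 ?hk2.
  apply: etrans (cintegral_by_parts (smooth_pd j sf) sg _) _.
    move=> t t01; have [_ ->] := BC_face j bf t01; have [-> _] := BC_face j bg t01.
    by rewrite mulrACA hkj mul1r.
  apply: etrans (congr1 -%R _) (opprK _).
  apply: (cintegral_by_parts sf (smooth_pd j sg)).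
  move=> t t01; have [-> _] := BC_face j bf t01; have [_ ->] := BC_face j bg t01.
  by rewrite mulrACA hkj mul1r.
have cf := smooth_ccont sf; have cg := smooth_ccont sg.
have cd j (u : R * R -> R[i]) : smooth u -> ccont (pd j (pd j u)).
  by move=> su; apply: smooth_ccont; do 2! apply: smooth_pd.
transitivity (cintegral (fun x => pd ord0 (pd ord0 f) x * g x + pd ord_max (pd ord_max f) x * g x)).
  by congr cintegral; apply/funext => x; rewrite -mulrDl.
have c1 j : cint (fun x => pd j (pd j f) x * g x).
  by apply: ccont_cint; apply: ccontM => //; exact: cd.
have c2 j : cint (fun x => f x * pd j (pd j g) x).
  by apply: ccont_cint; apply: ccontM => //; exact: cd.
apply: etrans (cintegralD (c1 ord0) (c1 ord_max)) _.
apply: etrans (congr2 +%R (one ord0) (one ord_max)) _.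
apply: etrans (esym (cintegralD (c2 ord0) (c2 ord_max))) _.
by congr cintegral; apply/funext => x; rewrite -mulrDr.
Qed.

End ByParts.

Section Expansions.
Context {R : realType}.
Variable l : R * R.
Implicit Types (s : R) (a b : nat -> R[i]) (f : R * R -> R[i]).
Local Notation expo := (expo l).
Local Notation expsum := (expsum l).

Lemma smooth_expo s n : smooth (expo s n).
Proof. by rewrite -expsum_delta; apply: smooth_expsum; exact: rapid_delta. Qed.

Lemma ccont_expo s n : ccont (expo s n).
Proof. exact/smooth_ccont/smooth_expo. Qed.

Lemma ccont_expsum s a : rapid a -> ccont (expsum s a).
Proof. by move=> ra; apply: smooth_ccont; exact: smooth_expsum. Qed.

Lemma pd_expo s n j : pd j (expo s n) = fun x => s%:C * mu l j n * expo s n x.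
Proof.
rewrite -expsum_delta pd_expsum; last exact: rapid_delta.
apply/funext => x; rewrite -expsumZ; last exact: rapid_delta.
congr csum; apply/funext => m; rewrite /dseq /delta.
by case: eqVneq => [->//|_]; rewrite !mulr0 !mul0r.
Qed.

(** The frequencies are integers, so the phase changes by a multiple of [2 * pi]
    across the square. *)
Lemma expo_face s n j t : s ^+ 2 = 1 ->
  expo s n (face j 1 t) = (expR (s * coord j l))%:C * expo s n (face j 0 t).
Proof.
move=> s2.
have s1 : s = 1 \/ s = - 1.
  by move/eqP: s2; rewrite sqrf_eq1 => /orP[/eqP|/eqP]; [left|right].
have perN (k : nat) (y : R) :
    cos (y + 2 * pi * k%:R) = cos y /\ sin (y + 2 * pi * k%:R) = sin y.
  rewrite (_ : 2 * pi * k%:R = (pi *+ 2) *+ k); last by rewrite -[pi *+ 2]mulr_natl mulr_natr.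
  by rewrite !periodicn//; [exact: sinD2pi|exact: cosD2pi].
have perZ (z : int) (y : R) :
    cos (y + 2 * pi * z%:~R) = cos y /\ sin (y + 2 * pi * z%:~R) = sin y.
  case: (intP z) => [|k|k]; first by rewrite mulr0 addr0.
    exact: perN.
  have [c d] := perN k.+1 (y + 2 * pi * (- k.+1%:Z)%:~R).
  have e : y + 2 * pi * (- k.+1%:Z)%:~R + 2 * pi * k.+1%:R = y.
    by rewrite rmorphN /= mulrN -addrA addNr addr0.
  by move: c d; rewrite e => <- <-.
have per y : cos (s * (2 * pi * (coord j (freq n))%:~R) + y) = cos y /\
             sin (s * (2 * pi * (coord j (freq n))%:~R) + y) = sin y.
  rewrite addrC; case: s1 => ->; first by rewrite mul1r; exact: perZ.
  by rewrite mulN1r -mulrN -rmorphN; exact: perZ.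
rewrite /expo /face /coord /phase; move: per; rewrite /coord.
case: ifP => _ per /=.
  have -> : s * (l.1 * 1 + l.2 * t) = s * l.1 + s * (l.1 * 0 + l.2 * t) by ring.
  rewrite (_ : s * (2 * pi * _) = s * (2 * pi * (freq n).1%:~R) +
    s * (2 * pi * (0 * (freq n).1%:~R + t * (freq n).2%:~R))); last by ring.
  set y := s * (2 * pi * (0 * _ + _)); have [-> ->] := per y.
  by rewrite expRD rmorphM /= mulrA.
have -> : s * (l.1 * t + l.2 * 1) = s * l.2 + s * (l.1 * t + l.2 * 0) by ring.
rewrite (_ : s * (2 * pi * _) = s * (2 * pi * (freq n).2%:~R) +
  s * (2 * pi * (t * (freq n).1%:~R + 0 * (freq n).2%:~R))); last by ring.
set y := s * (2 * pi * (_ + 0 * _)); have [-> ->] := per y.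
by rewrite expRD rmorphM /= mulrA.
Qed.

Lemma expsum_face s a j t : s ^+ 2 = 1 -> rapid a ->
  expsum s a (face j 1 t) = (expR (s * coord j l))%:C * expsum s a (face j 0 t).
Proof.
move=> s2 ra; have [M aM] := expsum_qbounded l s (face j 0 t) ra.
rewrite /expsum -(csumZ _ aM); congr csum; apply/funext => n.
by rewrite expo_face// mulrCA.
Qed.

Lemma BC_expsum s a : s ^+ 2 = 1 -> rapid a ->
  BC (expR (s * l.1), expR (s * l.2)) (expsum s a).
Proof.
move=> s2 ra t _; rewrite /pd1 /pd2 !pd_expsum//=.
have r j := rapid_dseq l s j ra.
split.
- exact/esym/(expsum_face ord0 t s2 ra).
- exact/esym/(expsum_face ord0 t s2 (r ord0)).
- exact/esym/(expsum_face ord_max t s2 ra).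
- exact/esym/(expsum_face ord_max t s2 (r ord_max)).
Qed.

Lemma expoVK s n x : expo s n x * expo (- s) n x = 1.
Proof.
rewrite /expo mulrACA -rmorphM -expRD mulNr addrN expR0 mul1r.
rewrite mulNr cosN sinN; apply: complex_ext; rewrite /= ?mulrN ?opprK.
  by rewrite -!expr2 cos2Dsin2.
by rewrite [sin _ * _]mulrC addNr.
Qed.

(** Biorthogonality follows from one integration by parts in a direction where
    the frequencies differ. *)
Lemma expo_orthogonal s n m : s ^+ 2 = 1 ->
  cintegral (fun x => expo s n x * expo (- s) m x) = delta m n.
Proof.
move=> s2; rewrite /delta; case: eqVneq => [->|nm].
  apply: complex_ext.
    by transitivity (intO (fun=> 1 : R)); [apply: eq_intO => x _; rewrite expoVK|exact: intO_cst].
  by transitivity (intO (fun=> 0 : R)); [apply: eq_intO => x _; rewrite expoVK|exact: intO_cst].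
have [j fj] : exists j, coord j (freq n) != coord j (freq m).
  have : freq n != freq m by apply: contra nm => /eqP/freq_inj ->.
  case: (freq n) (freq m) => [a b] [c d]; rewrite xpair_eqE negb_and.
  by case/orP => ne; [exists ord0|exists ord_max].
have Ns2 : (- s) ^+ 2 = 1 by rewrite sqrrN.
have s0 : s != 0.
  by apply/eqP => s00; move/eqP: s2; rewrite s00 expr0n eq_sym oner_eq0.
have := @cintegral_by_parts _ j (expo s n) (expo (- s) m) (smooth_expo _ _) (smooth_expo _ _).
rewrite !pd_expo => h.
have ci : cint (fun x => expo s n x * expo (- s) m x).
  by apply: ccont_cint; apply: ccontM; exact: ccont_expo.
have {h}: s%:C * mu l j n * cintegral (fun x => expo s n x * expo (- s) m x) =
    s%:C * mu l j m * cintegral (fun x => expo s n x * expo (- s) m x).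
  rewrite -(cintegralZ _ ci) -(cintegralZ _ ci).
  transitivity (cintegral (fun x => s%:C * mu l j n * expo s n x * expo (- s) m x)).
    by congr cintegral; apply/funext => x; rewrite mulrA.
  rewrite h => [|t _].
    transitivity (- cintegral (fun x => (- 1) * (s%:C * mu l j m * (expo s n x * expo (- s) m x)))).
      congr (- cintegral _); apply/funext => x; rewrite rmorphN /=; ring.
    by rewrite (cintegralZ (- 1)) ?mulN1r ?opprK//; exact: cintZ.
  by rewrite !expo_face// [RHS]mulrACA -rmorphM -expRD mulNr addrN expR0 mul1r.
move=> /eqP; rewrite -subr_eq0 -mulrBl mulf_eq0 => /orP[|/eqP//].
rewrite -mulrBr mulf_eq0 => /orP[/eqP|].
  by case => s00; rewrite s00 eqxx in s0.
rewrite /mu /coord subr_eq0 => /eqP[] /eqP.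
have p0 : 2 * pi != 0 :> R by rewrite mulf_neq0// lt0r_neq0// pi_gt0.
by rewrite (inj_eq (mulfI p0)) eqr_int => e; move: fj; rewrite /coord e.
Qed.

Lemma Cmod_expo_Omega s n x : Omega x -> Cmod (expo s n x) <= expR (`|s| * (`|l.1| + `|l.2|)).
Proof.
move=> [] /=; rewrite !in_itv /= => /andP[x10 x11] /andP[x20 x21].
rewrite -[_ * _]mulr1; apply: expo_box_le; rewrite ger0_norm ltW//.
Qed.

Lemma expsum_Omega_le s a (M : R) x : qbounded M a -> Omega x ->
  Cmod (expsum s a x) <= 4 * (M * expR (`|s| * (`|l.1| + `|l.2|))).
Proof.
move=> aM Ox; apply: csum_le; apply: qbounded_expo aM => n; exact: Cmod_expo_Omega.
Qed.

(** The [n]-th coefficient of [f] in the basis [expo s], computed against the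
    dual exponential. *)
Definition coef s f n : R[i] := cintegral (fun x => f x * expo (- s) n x).

Lemma coef_le s f n : L2 f ->
  Cmod (coef s f n) <= 2 * expR (`|s| * (`|l.1| + `|l.2|)) * L2norm f.
Proof.
move=> f2; apply: cint_ccont_L2_le => //; rewrite ?expR_ge0//; first exact: ccont_expo.
by move=> x Ox; rewrite -[`|s|]normrN; exact: Cmod_expo_Omega.
Qed.

Lemma moderate_coef s f : L2 f -> moderate (coef s f).
Proof. by move=> f2; exists 0%N; eexists => n; rewrite mulr1; exact: coef_le. Qed.

(** Truncations converge uniformly on the square at rate [1/N]. *)
Lemma cintegral_expsum s a f : L2 f -> rapid a ->
  cintegral (fun x => f x * expsum s a x) = csum (fun n => a n * coef (- s) f n).
Proof.
move=> f2 ra; have cf := L2_cint f2.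
have mc := moderate_coef (- s) f2.
have rc b : rapid b -> rapid (fun n => b n * coef (- s) f n).
  by move=> rb; under eq_fun do rewrite mulrC; exact: rapidM.
have ci b : rapid b -> cint (fun x => f x * expsum s b x).
  by move=> rb; apply: cintM => //; exact: ccont_expsum.
(* The defect [J] is linear and vanishes on the sequences [delta m], hence on all
   truncations of [a]. *)
pose J b := cintegral (fun x => f x * expsum s b x) - csum (fun n => b n * coef (- s) f n).
have JD b d : rapid b -> rapid d -> J (fun n => b n + d n) = J b + J d.
  move=> rb rd; have [M bM] := rapid_qbounded (rc _ rb); have [N dN] := rapid_qbounded (rc _ rd).
  have eI : cintegral (fun x => f x * expsum s (fun n => b n + d n) x) =
      cintegral (fun x => f x * expsum s b x) + cintegral (fun x => f x * expsum s d x).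
    apply: etrans (cintegralD (ci _ rb) (ci _ rd)).
    by congr cintegral; apply/funext => x; rewrite -mulrDr expsumD.
  have eS : csum (fun n => (b n + d n) * coef (- s) f n) =
      csum (fun n => b n * coef (- s) f n) + csum (fun n => d n * coef (- s) f n).
    apply: etrans (csumD bM dN).
    by congr csum; apply/funext => n; rewrite mulrDl.
  by rewrite /J eI eS opprD addrACA.
have JZ (k : R[i]) b : rapid b -> J (fun n => k * b n) = k * J b.
  move=> rb; have [M bM] := rapid_qbounded (rc _ rb).
  rewrite /J mulrBr -(csumZ _ bM) -cintegralZ; last exact: ci.
  congr (cintegral _ - csum _); first by apply/funext => x; rewrite expsumZ// mulrCA.
  by apply/funext => n; rewrite mulrA.
have Jdelta m : J (delta m) = 0.
  rewrite /J expsum_delta (_ : (fun n => _) = fun n => coef (- s) f n * delta m n); last first.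
    by apply/funext => n; rewrite mulrC.
  by rewrite csum_delta /coef opprK subrr.
have Jtrunc N : J (trunc N a) = 0.
  elim: N => [|N ih].
    rewrite (_ : trunc 0 a = fun n => 0 * delta 0 n); last first.
      by apply/funext => n; rewrite mul0r.
    by rewrite JZ ?mul0r//; exact: rapid_delta.
  rewrite (_ : trunc N.+1 a = fun n => trunc N a n + a N * delta N n); last first.
    apply/funext => n; rewrite /trunc /delta ltnS leq_eqVlt.
    by case: eqVneq => [->|_] /=; rewrite ?ltnn ?add0r ?mulr1 ?mulr0 ?addr0.
  rewrite JD ?ih ?JZ ?Jdelta ?mulr0 ?addr0//; last exact/rapidZ/rapid_delta.
  - exact: rapid_delta.
  - exact: rapid_trunc.
have [M aM] := ra 3%N.
have [k [C cC]] := mc; have [M' aM'] := rc _ ra 3%N.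
pose E := expR (`|s| * (`|l.1| + `|l.2|)).
pose K := 2 * (4 * (M * E)) * L2norm f + 4 * M'.
have JN N : Cmod (J a) <= K / N.+1%:R.
  have rt : rapid (fun n => a n - trunc N a n).
    under eq_fun do rewrite -mulN1r; apply: rapidD => //; apply: rapidZ; exact: rapid_trunc.
  have -> : J a = J (fun n => a n - trunc N a n).
    rewrite -[RHS]addr0 -(Jtrunc N) -JD//; last exact: rapid_trunc.
    by congr J; apply/funext => n; rewrite subrK.
  have qt := qbounded_tail N aM; have qt' := qbounded_tail N aM'.
  rewrite /J; apply: (le_trans (Cmod_le_add _ _)); rewrite CmodN /K mulrDl; apply: lerD.
    rewrite [leRHS](_ : _ = 2 * (4 * ((M / N.+1%:R) * E)) * L2norm f); last by field.
    apply: cint_ccont_L2_le => //; first exact: ccont_expsum.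
      have M0 : 0 <= M by apply: le_trans (aM 0%N); rewrite mulr_ge0 ?exprn_ge0.
      by rewrite !mulr_ge0 ?expR_ge0 ?invr_ge0.
    by move=> x Ox; exact: expsum_Omega_le.
  rewrite -mulrA; apply: csum_le.
  rewrite (_ : (fun n => _) = fun n => a n * coef (- s) f n -
    trunc N (fun n => a n * coef (- s) f n) n)//.
  by apply/funext => n; rewrite mulrBl /trunc; case: ifP; rewrite ?mul0r.
apply/eqP; rewrite -subr_eq0 -/(J a) -Cmod_eq0 eq_le Cmod_ge0 andbT.
apply/ler_addgt0Pl => e e0; rewrite addr0.
have [N NK] : exists N, K / e < N.+1%:R.
  by exists (Num.truncn (K / e)); exact: truncnS_gt.
apply: (le_trans (JN N)); rewrite ler_pdivrMr// mulrC -ler_pdivrMr//; exact: ltW.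
Qed.

Lemma coef_expsum s a : s ^+ 2 = 1 -> rapid a -> coef s (expsum s a) = a.
Proof.
move=> s2 ra; apply/funext => n; rewrite /coef.
transitivity (cintegral (fun x => expo (- s) n x * expsum s a x)).
  by congr cintegral; apply/funext => x; rewrite mulrC.
rewrite cintegral_expsum//; last exact/ccont_L2/ccont_expo.
rewrite -[RHS](csum_delta a n); congr csum; apply/funext => m; congr (_ * _).
rewrite /coef opprK.
have := @expo_orthogonal (- s) n m; rewrite sqrrN opprK => -> //.
by rewrite /delta eq_sym.
Qed.

Lemma coefD s f g n : L2 f -> L2 g ->
  coef s (fun x => f x + g x) n = coef s f n + coef s g n.
Proof.
move=> f2 g2; rewrite /coef -cintegralD; last first.
- by apply: cintM; [exact: L2_cint|exact: ccont_expo].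
- by apply: cintM; [exact: L2_cint|exact: ccont_expo].
- by congr cintegral; apply/funext => x; rewrite mulrDl.
Qed.

Lemma coefZ s (c : R[i]) f n : L2 f -> coef s (fun x => c * f x) n = c * coef s f n.
Proof.
move=> f2; rewrite /coef -cintegralZ; last by apply: cintM; [exact: L2_cint|exact: ccont_expo].
by congr cintegral; apply/funext => x; rewrite mulrA.
Qed.

Lemma aeq_coef s f g : L2 f -> L2 g -> aeq f g -> coef s f = coef s g.
Proof.
move=> f2 g2 fg; apply/funext => n; apply: aeq_cintegral.
- by apply: cint_cmeas; apply: cintM; [exact: L2_cint|exact: ccont_expo].
- by apply: cint_cmeas; apply: cintM; [exact: L2_cint|exact: ccont_expo].
- by apply: ae_mono fg => x /[apply] ->.
Qed.

End Expansions.

(** * Completeness of the exponentials *)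

Section StepPolynomials.
Context {R : realType}.

Lemma bernoulli_lower (u : R) m : 0 <= u <= 1 -> 1 - m%:R * u <= (1 - u) ^+ m.
Proof.
move=> /andP[u0 u1]; elim: m => [|m ih]; first by rewrite mul0r subr0 expr0.
rewrite exprS -natr1; have := ler_wpM2l (_ : 0 <= 1 - u) ih.
rewrite subr_ge0 => /(_ u1); apply: le_trans.
have := mulr_ge0 (ler0n R m) (mulr_ge0 u0 u0); lra.
Qed.

Lemma bernoulli_upper (u : R) m : 0 <= u -> 1 + m%:R * u <= (1 + u) ^+ m.
Proof.
move=> u0; elim: m => [|m ih]; first by rewrite mul0r addr0 expr0.
rewrite exprS -natr1; have := ler_wpM2l (_ : 0 <= 1 + u) ih.
rewrite addr_ge0// => /(_ isT); apply: le_trans.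
have := mulr_ge0 (ler0n R m) (mulr_ge0 u0 u0); lra.
Qed.

(** Polynomials converging boundedly on [0, 1] to a step at 1/2, as in the
    elementary proof of the Stone-Weierstrass theorem by Brosowski and Deutsch;
    Bernoulli's inequality gives both limits. *)
Definition step_poly n (t : R) : R := (1 - t ^+ n) ^+ (2 ^ n)%N.

Lemma step_poly_01 n t : 0 <= t <= 1 -> 0 <= step_poly n t <= 1.
Proof.
move=> /andP[t0 t1]; have tn0 : 0 <= t ^+ n by exact: exprn_ge0.
have tn1 : t ^+ n <= 1 by exact: exprn_ile1.
by rewrite exprn_ge0 ?exprn_ile1 ?subr_ge0// gerBl.
Qed.

Lemma step_poly_cvg1 t : 0 <= t < 1 / 2 -> step_poly ^~ t @ \oo --> (1 : R).
Proof.
move=> /andP[t0 t2].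
have c : (fun n => 1 - (2 * t) ^+ n) @ \oo --> (1 : R).
  rewrite -[X in _ --> X]subr0; apply: cvgB; first exact: cvg_cst.
  apply: cvg_expr; rewrite ger0_norm ?mulr_ge0//; lra.
apply: squeeze_cvgr c (cvg_cst _); apply: nearW => n.
have tn : 0 <= t ^+ n <= 1 by rewrite exprn_ge0// exprn_ile1//; lra.
have /andP[_ ->] := @step_poly_01 n t (ltac:(apply/andP; split; lra)).
by rewrite andbT exprMn -natrX; exact: bernoulli_lower.
Qed.

Lemma step_poly_cvg0 t : 1 / 2 < t <= 1 -> step_poly ^~ t @ \oo --> (0 : R).
Proof.
move=> /andP[t2 t1]; have t0 : 0 < t by lra.
have c : (fun n => (2 * t)^-1 ^+ n) @ \oo --> (0 : R).
  apply: cvg_expr; rewrite ger0_norm ?invr_ge0 ?mulr_ge0 ?(ltW t0)//.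
  rewrite invf_lt1 ?mulr_gt0//; lra.
apply: squeeze_cvgr (cvg_cst _) c; apply: nearW => n.
have /andP[-> _] := @step_poly_01 n t (ltac:(apply/andP; split; lra)).
have tn0 : 0 < t ^+ n by exact: exprn_gt0.
have tn1 : t ^+ n <= 1 by apply: exprn_ile1 => //; exact: ltW.
have m0 : 0 < (2 * t) ^+ n by rewrite exprn_gt0// mulr_gt0.
rewrite exprVn /step_poly -[leRHS]mul1r ler_pdivlMr//.
apply: (@le_trans _ _ ((1 - t ^+ n) ^+ (2 ^ n)%N * (1 + t ^+ n) ^+ (2 ^ n)%N)).
  rewrite ler_wpM2l ?exprn_ge0 ?subr_ge0// exprMn -natrX.
  apply: le_trans (bernoulli_upper _ (ltW tn0)); rewrite lerDr//.
rewrite -exprMn exprn_ile1//; nra.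
Qed.

(** The cosine of [2 * pi * y] is a decreasing function of the distance from [y] to
    the nearest integer, so comparison with its value at half the length of the
    interval detects whether [x] lies inside. *)
Lemma cos_arc (a b x : R) : 0 <= a -> a <= b -> b <= 1 -> 0 < x < 1 ->
  let c := cos (2 * pi * (x - (a + b) / 2)) in
  (a < x < b -> cos (pi * (b - a)) < c) /\
  (x < a \/ b < x -> c < cos (pi * (b - a))).
Proof.
move=> a0 ab b1 /andP[x0 x1] /=.
have p0 := pi_gt0 R.
set y := x - (a + b) / 2.
have -> : cos (2 * pi * y) = cos (2 * pi * `|y|).
  by have [y0|y0] := ger0P y; rewrite ?mulrN ?cosN.
have dom (u : R) : 0 <= u <= 1 -> pi * u \in `[0, pi]%R.
  move=> /andP[u0 u1]; rewrite in_itv /= mulr_ge0 ?(ltW p0)//=.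
  exact: (ler_piMr (ltW p0) u1).
have refl (u : R) : cos (2 * pi * u) = cos (2 * pi * (1 - u)).
  rewrite mulrBr mulr1 -[RHS]cosN opprB (_ : 2 * pi = pi *+ 2); last by rewrite mulr_natl.
  by rewrite -[RHS](cosD2pi) subrK.
have ay : `|y| < 1 by rewrite ltr_norml; apply/andP; split; rewrite /y; lra.
have lt_cos (u v : R) : 0 <= u -> u < v -> v <= 1 -> cos (pi * v) < cos (pi * u).
  move=> u0 uv v1; rewrite ltr_cos ?dom//; first by rewrite ltr_pM2l.
  - by apply/andP; split; lra.
  - by apply/andP; split; lra.
have two (u : R) : 2 * pi * u = pi * (2 * u) by ring.
split => [/andP[ax xb]|out].
  rewrite two; apply: lt_cos; rewrite ?mulr_ge0//; last by lra.
  have : `|y| < (b - a) / 2 by rewrite ltr_norml; apply/andP; split; rewrite /y; lra.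
  lra.
have [y2|y2] := leP `|y| (1 / 2).
  rewrite two; apply: lt_cos; [lra| |lra].
  have : (b - a) / 2 < `|y|.
    by case: out => ?; rewrite lter_normr; apply/orP; rewrite /y; [right|left]; lra.
  lra.
rewrite refl two; apply: lt_cos; [lra| |lra].
have : `|y| < 1 - (b - a) / 2 by rewrite ltr_norml; apply/andP; split; rewrite /y; lra.
lra.
Qed.

End StepPolynomials.

Section Completeness.
Context {R : realType}.
Notation area := (@leb2 R).
Implicit Types (g T : R * R -> R) (l : R * R).

Definition trig_orthogonal g := integrableO g /\
  forall n, intO (fun x => g x * cos (phase n x)) = 0 /\
            intO (fun x => g x * sin (phase n x)) = 0.

(** Multiplication by a trigonometric polynomial preserves orthogonality to all
    trigonometric polynomials.  Quantifying over [g] makes the multipliers an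
    algebra at once. *)
Definition multiplier T := continuous T /\
  forall g, trig_orthogonal g -> trig_orthogonal (fun x => g x * T x).

Lemma phase_continuous n : continuous (@phase R n).
Proof.
move=> x; rewrite /phase; apply: cvgM; first exact: cvg_cst.
apply: cvgD; apply: cvgM; [exact: cvg_fst|exact: cvg_cst|exact: cvg_snd|exact: cvg_cst].
Qed.

Lemma cos_phase_continuous n : continuous (fun x : R * R => cos (phase n x)).
Proof.
by move=> x; apply: continuous_comp; [exact: phase_continuous|exact: continuous_cos].
Qed.

Lemma sin_phase_continuous n : continuous (fun x : R * R => sin (phase n x)).
Proof.
by move=> x; apply: continuous_comp; [exact: phase_continuous|exact: continuous_sin].
Qed.

Lemma multiplier_cst (k : R) : multiplier (fun=> k).
Proof.
split=> [x|g [ig g0]]; first exact: cvg_cst.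
have e f : intO (fun x => g x * k * f x) = intO (fun x => k * (g x * f x)).
  by apply: eq_intO => x _; ring.
split; first by under eq_fun do rewrite mulrC; exact: integrableOZ.
move=> n; have [c s] := g0 n; rewrite !e !intOZ ?c ?s ?mulr0//.
- by apply: integrableO_mul => //; exact: sin_phase_continuous.
- by apply: integrableO_mul => //; exact: cos_phase_continuous.
Qed.

Lemma multiplierM T1 T2 : multiplier T1 -> multiplier T2 ->
  multiplier (fun x => T1 x * T2 x).
Proof.
move=> [c1 m1] [c2 m2]; split; first by move=> x; apply: cvgM; [exact: c1|exact: c2].
by move=> g /m1/m2; under eq_fun do rewrite -mulrA.
Qed.

Lemma multiplierD T1 T2 : multiplier T1 -> multiplier T2 ->
  multiplier (fun x => T1 x + T2 x).
Proof.
move=> [c1 m1] [c2 m2]; split; first by move=> x; apply: cvgD; [exact: c1|exact: c2].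
move=> g Zg; have [i1 z1] := m1 _ Zg; have [i2 z2] := m2 _ Zg.
split; first by under eq_fun do rewrite mulrDr; exact: integrableOD.
move=> n; have [a1 b1] := z1 n; have [a2 b2] := z2 n; split.
  rewrite -[RHS]addr0 -[X in _ = X + _]a1 -[X in _ = _ + X]a2 -intOD.
  - by apply: eq_intO => x _; ring.
  - by apply: integrableO_mul => //; exact: cos_phase_continuous.
  - by apply: integrableO_mul => //; exact: cos_phase_continuous.
rewrite -[RHS]addr0 -[X in _ = X + _]b1 -[X in _ = _ + X]b2 -intOD.
- by apply: eq_intO => x _; ring.
- by apply: integrableO_mul => //; exact: sin_phase_continuous.
- by apply: integrableO_mul => //; exact: sin_phase_continuous.
Qed.

Lemma multiplierX T k : multiplier T -> multiplier (fun x => T x ^+ k).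
Proof.
move=> mT; elim: k => [|k ih]; first exact: multiplier_cst.
by under eq_fun do rewrite exprS; exact: multiplierM.
Qed.

Definition freq_add m n : nat :=
  freq_index ((freq m).1 + (freq n).1, (freq m).2 + (freq n).2).

Definition freq_sub m n : nat :=
  freq_index ((freq m).1 - (freq n).1, (freq m).2 - (freq n).2).

Lemma phase_add m n (x : R * R) : phase (freq_add m n) x = phase m x + phase n x.
Proof. by rewrite /phase /freq_add freq_indexK /= !intrD; ring. Qed.

Lemma phase_sub m n (x : R * R) : phase (freq_sub m n) x = phase m x - phase n x.
Proof. by rewrite /phase /freq_sub freq_indexK /= !intrB; ring. Qed.

Let icos g n : trig_orthogonal g -> integrableO (fun x => g x * cos (phase n x)).
Proof. by move=> [ig _]; apply: integrableO_mul => //; exact: cos_phase_continuous. Qed.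

Let isin g n : trig_orthogonal g -> integrableO (fun x => g x * sin (phase n x)).
Proof. by move=> [ig _]; apply: integrableO_mul => //; exact: sin_phase_continuous. Qed.

Lemma multiplier_cos m : multiplier (fun x => cos (phase m x)).
Proof.
split=> [|g Zg]; first exact: cos_phase_continuous.
split; first exact: icos.
move=> n; have [p q] := Zg.2 (freq_add n m); have [r s] := Zg.2 (freq_sub n m).
split.
  transitivity (1 / 2 * (intO (fun x => g x * cos (phase (freq_add n m) x)) +
      intO (fun x => g x * cos (phase (freq_sub n m) x)))); last by rewrite p r addr0 mulr0.
  rewrite -(intOD (icos _ Zg) (icos _ Zg)) -(intOZ _ (integrableOD (icos _ Zg) (icos _ Zg))).
  by apply: eq_intO => x _; rewrite phase_add phase_sub cosB cosD; field.
transitivity (1 / 2 * (intO (fun x => g x * sin (phase (freq_add n m) x)) +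
    intO (fun x => g x * sin (phase (freq_sub n m) x)))); last by rewrite q s addr0 mulr0.
rewrite -(intOD (isin _ Zg) (isin _ Zg)) -(intOZ _ (integrableOD (isin _ Zg) (isin _ Zg))).
by apply: eq_intO => x _; rewrite phase_add phase_sub sinD sinB; field.
Qed.

Lemma multiplier_sin m : multiplier (fun x => sin (phase m x)).
Proof.
split=> [|g Zg]; first exact: sin_phase_continuous.
split; first exact: isin.
move=> n; have [p q] := Zg.2 (freq_add n m); have [r s] := Zg.2 (freq_sub n m).
have [p' q'] := Zg.2 (freq_sub m n).
split.
  transitivity (1 / 2 * (intO (fun x => g x * sin (phase (freq_add n m) x)) +
      intO (fun x => g x * sin (phase (freq_sub m n) x)))); last by rewrite q q' addr0 mulr0.
  rewrite -(intOD (isin _ Zg) (isin _ Zg)) -(intOZ _ (integrableOD (isin _ Zg) (isin _ Zg))).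
  by apply: eq_intO => x _; rewrite phase_add phase_sub sinD sinB; field.
transitivity (1 / 2 * (intO (fun x => g x * cos (phase (freq_sub n m) x)) +
    (-1) * intO (fun x => g x * cos (phase (freq_add n m) x)))); last by rewrite p r mulr0 addr0 mulr0.
have i1 := icos (freq_sub n m) Zg; have i2 := integrableOZ (-1) (icos (freq_add n m) Zg).
rewrite -(intOZ _ (icos (freq_add n m) Zg)) -(intOD i1 i2) -(intOZ _ (integrableOD i1 i2)).
by apply: eq_intO => x _; rewrite phase_add phase_sub cosB cosD; field.
Qed.

(** These approximate the indicator of [a < coord j x < b]: by [cos_arc] the
    argument of the step polynomial is below 1/2 exactly in this strip, and the
    factor 1/4 keeps it in [0, 1]. *)
Definition strip_poly (j : 'I_2) (a b : R) (n : nat) (x : R * R) : R :=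
  step_poly n (1 / 2 - (cos (2 * pi * (coord j x - (a + b) / 2)) - cos (pi * (b - a))) / 4).

Lemma multiplier_strip j a b n : multiplier (strip_poly j a b n).
Proof.
pose m := freq_index (if j == ord0 then (1, 0) else (0, 1)).
have ph x : phase m x = 2 * pi * coord j x :> R.
  by rewrite /phase /m freq_indexK /coord; case: ifP => _ /=; rewrite mulr0 mulr1 ?addr0 ?add0r.
set c := cos (pi * (b - a)); set q := 2 * pi * ((a + b) / 2).
rewrite (_ : strip_poly j a b n = fun x => (1 + (-1) * ((1 / 2 + c / 4) +
   ((- 1 / 4 * cos q) * cos (phase m x) + (- 1 / 4 * sin q) * sin (phase m x))) ^+ n)
   ^+ (2 ^ n)%N); last first.
  apply/funext => x; rewrite /strip_poly /step_poly ph.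
  rewrite (_ : 2 * pi * (_ - _) = 2 * pi * coord j x - q); last by rewrite /q; ring.
  by rewrite cosB mulN1r -/c; congr ((1 - _ ^+ n) ^+ _); field.
have mt := multiplierD (multiplier_cst (1 / 2 + c / 4)) (multiplierD
  (multiplierM (multiplier_cst (- 1 / 4 * cos q)) (multiplier_cos m))
  (multiplierM (multiplier_cst (- 1 / 4 * sin q)) (multiplier_sin m))).
exact: (multiplierX (2 ^ n)%N (multiplierD (multiplier_cst 1)
  (multiplierM (multiplier_cst (- 1)) (multiplierX n mt)))).
Qed.

Lemma strip_poly_01 j a b n x : 0 <= strip_poly j a b n x <= 1.
Proof.
apply: step_poly_01; set u := cos _; set v := cos _.
have := cos_le1 (2 * pi * (coord j x - (a + b) / 2)); rewrite -/u.
have := cos_geN1 (2 * pi * (coord j x - (a + b) / 2)); rewrite -/u.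
have := cos_le1 (pi * (b - a)); have := cos_geN1 (pi * (b - a)); rewrite -/v.
by move=> *; apply/andP; split; lra.
Qed.

Lemma strip_poly_cvg j a b x : 0 <= a -> a <= b -> b <= 1 -> Omega x ->
  coord j x != a -> coord j x != b ->
  strip_poly j a b ^~ x @ \oo --> ((a < coord j x < b)%R%:R : R).
Proof.
move=> a0 ab b1 Ox xa xb.
have x01 : 0 < coord j x < 1.
  by move: Ox => [] /=; rewrite !in_itv /= /coord; case: ifP.
have [arc1 arc0] := cos_arc a0 ab b1 x01.
have u1 := cos_le1 (2 * pi * (coord j x - (a + b) / 2)).
have u2 := cos_geN1 (2 * pi * (coord j x - (a + b) / 2)).
have v1 := cos_le1 (pi * (b - a)); have v2 := cos_geN1 (pi * (b - a)).
have [ax|xa'] := boolP (a < coord j x < b).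
  by apply: step_poly_cvg1; have := arc1 ax; move=> ?; apply/andP; split; lra.
have out : coord j x < a \/ b < coord j x.
  move: xa'; rewrite negb_and -!leNgt !le_eqVlt (negbTE xa) /= [_ == coord _ _]eq_sym.
  by rewrite (negbTE xb) /= => /orP.
by apply: step_poly_cvg0; have := arc0 out; move=> ?; apply/andP; split; lra.
Qed.

(** Dominated convergence in the form needed to replace polynomials by the step
    functions that they approximate. *)
Lemma intO_mul_limit g (T_ : nat -> R * R -> R) T : integrableO g ->
  (forall n, measurable_fun (Omega : set (plane R)) (T_ n)) ->
  measurable_fun (Omega : set (plane R)) T ->
  (forall n x, `|T_ n x| <= 1) ->
  {ae area, forall x, Omega x -> T_ ^~ x @ \oo --> T x} ->
  (forall n, intO (fun x => g x * T_ n x) = 0) ->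
  intO (fun x => g x * T x) = 0.
Proof.
move=> ig mT_ mT T1 cT z.
have mg := integrableO_measurable ig.
have mgT n : measurable_fun (Omega : set (plane R)) (fun x => g x * T_ n x).
  exact: measurable_funM.
have igT n : integrableO (fun x => g x * T_ n x).
  apply: (le_integrableO (mgT n) _ (integrableO_norm ig)) => x _.
  by rewrite normrM ler_piMr.
have emgT n : measurable_fun (Omega : set (plane R)) (fun x => (g x * T_ n x)%:E).
  by apply/measurable_EFinP; exact: mgT.
have emg : measurable_fun (Omega : set (plane R)) (fun x => (g x * T x)%:E).
  by apply/measurable_EFinP; exact: measurable_funM.
have ae_cv : {ae area, forall x, Omega x ->
    (fun n => (g x * T_ n x)%:E) @ \oo --> (g x * T x)%:E}.
  apply: ae_mono cT => x /[apply] c.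
  by apply: cvg_EFin; [exact: nearW|apply: cvgM; [exact: cvg_cst|exact: c]].
have dom : {ae area, forall x n, Omega x -> (`|(g x * T_ n x)%:E| <= `|g x|%:E)%E}.
  by apply: aeW => x n _; rewrite lee_fin normrM ler_piMr.
have [i _ cv] := dominated_convergence measurable_Omega emgT emg ae_cv
  (integrableO_norm ig) dom.
have zz : (fun n => \int[area]_(x in Omega) (g x * T_ n x)%:E)%E = fun=> 0%E.
  apply/funext => n; rewrite -[RHS](congr1 EFin (z n)) fineK//.
  by apply: (integrable_fin_num measurable_Omega); exact: igT.
rewrite zz in cv; have e := cvg_unique _ cv (cvg_cst _).
by rewrite /Rintegral e.
Qed.

End Completeness.

Section Boxes.
Context {R : realType}.
Notation area := (@leb2 R).
Implicit Types (g : R * R -> R).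

Definition box (a b c d : R) : set (plane R) :=
  `]a, b[%classic `*` `]c, d[%classic.

Lemma measurable_box a b c d : measurable (box a b c d).
Proof. by apply: measurableX; exact: measurable_itv. Qed.

Lemma area_line (j : 'I_2) (a : R) : area.-negligible [set x | coord j x = a].
Proof.
have m1 : measurable ([set a] : set (measurableTypeR R)) by exact: measurable_set1.
have l0 : (@lebesgue_measure R) [set a] = 0%E by exact: lebesgue_measure_set1.
case: (direction_cases j) => ->.
  exists (([set a] : set (measurableTypeR R)) `*` (setT : set (measurableTypeR R))).
  split; first by apply: measurableX.
    by rewrite [LHS]product_measure1E// [X in (X * _)%E]l0 mul0e.
  by move=> [x y] /= <-.
exists ((setT : set (measurableTypeR R)) `*` ([set a] : set (measurableTypeR R))).
split; first by apply: measurableX.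
  by rewrite [LHS]product_measure1E// [X in (_ * X)%E]l0 mule0.
by move=> [x y] /= <-.
Qed.

Lemma ae_off_line j (a : R) : {ae area, forall x, coord j x != a}.
Proof.
by apply: negligibleS (area_line j a) => x /= /negP; rewrite negbK => /eqP.
Qed.

Lemma trig_orthogonal_total g : trig_orthogonal g -> intO g = 0.
Proof.
move=> [_ /(_ (freq_index (0, 0)))[z _]]; rewrite -[RHS]z; apply: eq_intO => x _.
by rewrite /phase freq_indexK /= !mulr0 addr0 mulr0 cos0 mulr1.
Qed.

(** Products of strip polynomials converge to the indicator of a box off the four
    lines through its sides, which are negligible. *)
Lemma intO_box_unit g a b c d : trig_orthogonal g ->
  0 <= a -> a <= b -> b <= 1 -> 0 <= c -> c <= d -> d <= 1 ->
  intO (fun x => g x * \1_(box a b c d) x) = 0.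
Proof.
move=> Zg a0 ab b1 c0 cd d1.
apply: (@intO_mul_limit _ _
  (fun n x => strip_poly ord0 a b n x * strip_poly ord_max c d n x)).
- by have [] := Zg.
- move=> n; apply: measurable_funM; apply: continuous_measurable_plane => //.
    by have [] := multiplier_strip ord0 a b n.
  by have [] := multiplier_strip ord_max c d n.
- by apply: measurable_funTS; apply: measurable_indic; exact: measurable_box.
- move=> n x; have /andP[p0 p1] := strip_poly_01 ord0 a b n x.
  have /andP[q0 q1] := strip_poly_01 ord_max c d n x.
  by rewrite ger0_norm ?mulr_ge0// mulr_ile1.
- apply: ae_mono (ae_and (ae_and (ae_off_line ord0 a) (ae_off_line ord0 b))
    (ae_and (ae_off_line ord_max c) (ae_off_line ord_max d))).
  move=> x [[xa xb] [xc xd]] Ox.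
  rewrite (_ : \1_(box a b c d) x = (a < coord ord0 x < b)%R%:R * (c < coord ord_max x < d)%R%:R).
    by apply: cvgM; exact: strip_poly_cvg.
  have mem_oo (u v w : R) : (w \in `]u, v[%classic) = (u < w < v).
    by apply/idP/idP; rewrite inE /= in_itv.
  by rewrite indicE /box /coord /= in_setX !mem_oo -natrM mulnb.
- move=> n; have m := multiplierM (multiplier_strip ord0 a b n) (multiplier_strip ord_max c d n).
  exact: trig_orthogonal_total (m.2 _ Zg).
Qed.

Lemma intO_box g a b c d : trig_orthogonal g ->
  intO (fun x => g x * \1_(box a b c d) x) = 0.
Proof.
move=> Zg; pose a' := Num.max a 0; pose b' := Num.min b 1.
pose c' := Num.max c 0; pose d' := Num.min d 1.
have e : intO (fun x => g x * \1_(box a b c d) x) =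
         intO (fun x => g x * \1_(box a' b' c' d') x).
  apply: eq_intO => -[x y] [/=]; rewrite !in_itv /= => /andP[x0 x1] /andP[y0 y1].
  rewrite !indicE; congr (_ * (nat_of_bool _)%:R).
  by apply/idP/idP; rewrite !inE /box /= !in_itv /= /a' /b' /c' /d'
    !gt_max !lt_min x0 x1 y0 y1 !andbT.
have [ab|ba] := leP a' b'; last first.
  rewrite e -[RHS](intO_cst 0); apply: eq_intO => x _.
  rewrite indicE (_ : _ \in _ = false) ?mulr0//; apply/negbTE/negP; rewrite inE => -[/=].
  rewrite in_itv /= => /andP[p q] _; have := lt_trans p q; rewrite ltNge ltW//.
have [cd|dc] := leP c' d'; last first.
  rewrite e -[RHS](intO_cst 0); apply: eq_intO => x _.
  rewrite indicE (_ : _ \in _ = false) ?mulr0//; apply/negbTE/negP; rewrite inE => -[/= _].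
  rewrite in_itv /= => /andP[p q]; have := lt_trans p q; rewrite ltNge ltW//.
rewrite e; apply: intO_box_unit => //; rewrite ?le_max ?ge_min ?lexx ?orbT//.
Qed.

Definition boxes : set (set (plane R)) :=
  [set X | exists a b c d, X = box a b c d].

Lemma boxes_setI : setI_closed boxes.
Proof.
move=> _ _ [a [b [c [d ->]]]] [a' [b' [c' [d' ->]]]].
exists (Num.max a a'), (Num.min b b'), (Num.max c c'), (Num.min d d').
apply/seteqP; split => -[x y]; rewrite /box /= !in_itv /= !gt_max !lt_min.
  by move=> [[/andP[-> ->] /andP[-> ->]] [/andP[-> ->] /andP[-> ->]]].
by move=> [/andP[/andP[-> ->] /andP[-> ->]] /andP[/andP[-> ->] /andP[-> ->]]].
Qed.

(** A strip over an interval is a countable union of boxes, and the two families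
    of strips generate the product sigma-algebra. *)
Lemma measurable_boxes : measurable `<=` (<<s boxes >> : set (set (plane R))).
Proof.
pose S : set (set (plane R)) := <<s boxes >>.
have sS : sigma_algebra setT S by exact: smallest_sigma_algebra.
have strip (pr : plane R -> measurableTypeR R) :
    (forall a b : R, S (pr @^-1` `]a, b[%classic)) ->
    forall A : set (measurableTypeR R), measurable A -> S (pr @^-1` A).
  move=> prS A; rewrite [X in X A -> _](RGenOpens.measurableE R).
  suff sub : <<s @RGenOpens.G R >> `<=` [set A | S (pr @^-1` A)] by exact: sub.
  apply: smallest_sub => [|_ [a [b ->]]]; last exact: prS.
  split.
  - by rewrite /= preimage_set0; have [] := sS.
  - by move=> B SB; rewrite /= setTD preimage_setC -setTD; have [_ + _] := sS; apply.
  - by move=> F SF; rewrite /= preimage_bigcup; have [_ _] := sS; apply.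
have S1 : forall A : set (measurableTypeR R), measurable A -> S (fst @^-1` A).
  apply: strip => a b.
  rewrite (_ : _ @^-1` _ = \bigcup_n box a b (- n%:R) n%:R).
    have [_ _] := sS; apply => n; apply: sub_sigma_algebra.
    by exists a, b, (- n%:R), n%:R.
  apply/seteqP; split => [[x y] /= xab|[x y] [n _] [] //].
  exists (Num.truncn `|y|).+1 => //; split => //=.
  by rewrite in_itv /= -ltr_norml; exact: truncnS_gt.
have S2 : forall A : set (measurableTypeR R), measurable A -> S (snd @^-1` A).
  apply: strip => a b.
  rewrite (_ : _ @^-1` _ = \bigcup_n box (- n%:R) n%:R a b).
    have [_ _] := sS; apply => n; apply: sub_sigma_algebra.
    by exists (- n%:R), n%:R, a, b.
  apply/seteqP; split => [[x y] /= yab|[x y] [n _] [] //].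
  exists (Num.truncn `|x|).+1 => //; split => //=.
  by rewrite in_itv /= -ltr_norml; exact: truncnS_gt.
apply: smallest_sub => //; rewrite subUset; split.
  by move=> _ [A mA <-]; rewrite setTI; exact: S1.
by move=> _ [A mA <-]; rewrite setTI; exact: S2.
Qed.

(** By the pi-lambda theorem, vanishing integrals over boxes give vanishing
    integrals over all measurable sets. *)
Lemma trig_orthogonal_eq0 g : trig_orthogonal g -> aeq g (fun=> 0).
Proof.
move=> /[dup] Zg [ig _]; have mg := integrableO_measurable ig.
pose H : set (set (plane R)) :=
  [set X | measurable X /\ intO (fun x => g x * \1_X x) = 0].
have ind X : measurable X -> measurable_fun (Omega : set (plane R)) (\1_X : plane R -> R).
  by move=> mX; apply: measurable_funTS; exact: measurable_indic.
have ind1 X (x : plane R) : `|\1_X x : R| <= 1.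
  by rewrite indicE; case: (_ \in _); rewrite ?normr1 ?normr0.
have igX X : measurable X -> integrableO (fun x => g x * \1_X x).
  move=> mX; apply: (le_integrableO _ _ (integrableO_norm ig)).
    by apply: measurable_funM => //; exact: ind.
  by move=> x _; rewrite normrM ler_piMr.
have lH : lambda_system setT H.
  split => //.
  - split; first exact: measurableT.
    by rewrite -[RHS](trig_orthogonal_total Zg); apply: eq_intO => x _; rewrite indicE in_setT mulr1.
  - move=> A B BA [mA A0] [mB B0]; split; first exact: measurableD.
    transitivity (intO (fun x => g x * \1_A x) + (-1) * intO (fun x => g x * \1_B x)).
      rewrite -intOZ; last exact: igX.
      rewrite -intOD; [|exact: igX|by apply: integrableOZ; exact: igX].
      apply: eq_intO => x _; rewrite !indicE in_setD.
      have [xB|xB] := boolP (x \in B).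
        by rewrite (mem_set (BA _ (set_mem xB))) /= ?xB /=; ring.
      by rewrite ?(negbTE xB) /= ?andbT mulr0 mulr0 addr0.
    by rewrite A0 B0 mulr0 addr0.
  - move=> F ndF HF; split; first by apply: bigcupT_measurable => n; have [] := HF n.
    apply: (@intO_mul_limit _ _ (fun n => \1_(F n))) => //.
    + by move=> n; apply: ind; have [] := HF n.
    + by apply: ind; apply: bigcupT_measurable => n; have [] := HF n.
    + apply: aeW => x _; apply: cvg_near_cst.
      have [[N _ xN]|nx] := pselect ((\bigcup_n F n) x).
        exists N => // n /= Nn; rewrite !indicE !mem_set//; first by exists N.
        by have /subsetPset := ndF _ _ Nn; apply.
      have nU : (x \in \bigcup_n F n) = false by apply/negbTE/negP => /set_mem.
      have nF n : (x \in F n) = false.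
        by apply/negbTE/negP => /set_mem xn; apply: nx; exists n.
      by apply: nearW => n; rewrite !indicE nF nU.
    + by move=> n; have [] := HF n.
have bH : boxes `<=` H.
  by move=> _ [a [b [c [d ->]]]]; split; [exact: measurable_box|exact: intO_box].
have all X : measurable X -> H X.
  move=> /measurable_boxes; apply: (lambda_system_subset boxes_setI lH bH).
  by move=> ? _; exact: subsetT.
have := @integral_ae_eq _ _ _ area _ measurable_Omega (fun=> 0%E) (EFin \o g) ig.
have mz : measurable_fun (Omega : set (plane R)) (fun=> 0%E : \bar R) by exact: measurable_cst.
move=> /(_ mz) h.
suff h0 : ae_eq area Omega (EFin \o g) (fun=> 0%E).
  by apply: ae_mono h0 => x /= p Ox; have [] := p Ox.
apply: h => E EO mE; rewrite integral0 -[E](setIidr EO) integral_mkcondr.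
have [_ z] := all _ mE.
transitivity (\int[area]_(x in Omega) (g x * \1_E x)%:E)%E.
  apply: eq_integral => x _; rewrite restrict_EFin /= patchE indicE.
  by case: (x \in E); rewrite ?mulr1 ?mulr0.
rewrite -[LHS]fineK; last by apply: (integrable_fin_num measurable_Omega); exact: igX.
by rewrite [fine _]z.
Qed.

End Boxes.

Section L2Completeness.
Context {R : realType}.
Variable l : R * R.
Implicit Types (f : R * R -> R[i]) (s : R).

Definition freq_opp n := freq_index (- (freq n).1, - (freq n).2).

Lemma phase_opp n (x : R * R) : phase (freq_opp n) x = - phase n x.
Proof. by rewrite /phase /freq_opp freq_indexK /= !rmorphN; ring. Qed.

(** The weight [rho] reduces the claim to trigonometric functions, and comparing
    a frequency with its opposite separates the real and imaginary parts. *)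
Lemma coef_complete s f : s ^+ 2 = 1 -> L2 f -> (forall n, coef l s f n = 0) ->
  aeq f (fun=> 0).
Proof.
move=> s2 f2 c0; have [ir ii] := L2_cint f2.
have s0 : s != 0.
  by apply/eqP => s00; move/eqP: s2; rewrite s00 expr0n eq_sym oner_eq0.
pose rho (x : R * R) := expR (- s * (l.1 * x.1 + l.2 * x.2)).
have crho : continuous rho.
  move=> x; apply: continuous_comp; last exact: continuous_expR.
  apply: cvgM; first exact: cvg_cst.
  apply: cvgD; apply: cvgM; [exact: cvg_cst|exact: cvg_fst|exact: cvg_cst|exact: cvg_snd].
pose a x := complex.Re (f x) * rho x; pose b x := complex.Im (f x) * rho x.
have ia : integrableO a by exact: integrableO_mul.
have ib : integrableO b by exact: integrableO_mul.
have ic (g : R * R -> R) n : integrableO g -> integrableO (fun x => g x * cos (phase n x)).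
  by move=> ig; apply: integrableO_mul => //; exact: cos_phase_continuous.
have is' (g : R * R -> R) n : integrableO g -> integrableO (fun x => g x * sin (phase n x)).
  by move=> ig; apply: integrableO_mul => //; exact: sin_phase_continuous.
have s1 : s = 1 \/ s = - 1.
  by move/eqP: s2; rewrite sqrf_eq1 => /orP[/eqP|/eqP]; [left|right].
have cs (t : R) : cos (- s * t) = cos t /\ sin (- s * t) = - s * sin t.
  by case: s1 => ->; rewrite ?opprK ?mulN1r ?mul1r ?cosN ?sinN.
have re n : intO (fun x => a x * cos (phase n x)) + s * intO (fun x => b x * sin (phase n x)) = 0.
  have := congr1 (@complex.Re R) (c0 n); rewrite /= => <-.
  rewrite -intOZ; last exact: is'.
  rewrite -intOD; [|exact: ic|by apply: integrableOZ; exact: is'].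
  apply: eq_intO => x _; rewrite /expo ReM ReM ImM /= !(mul0r, subr0, addr0).
  by have [-> ->] := cs (phase n x); rewrite /a /b /rho; ring.
have im n : intO (fun x => b x * cos (phase n x)) + (- s) * intO (fun x => a x * sin (phase n x)) = 0.
  have := congr1 (@complex.Im R) (c0 n); rewrite /= => <-.
  rewrite -intOZ; last exact: is'.
  rewrite -intOD; [|exact: ic|by apply: integrableOZ; exact: is'].
  apply: eq_intO => x _; rewrite /expo ImM ReM ImM /= !(mul0r, subr0, addr0).
  by have [-> ->] := cs (phase n x); rewrite /a /b /rho; ring.
have oc (g : R * R -> R) n :
    intO (fun x => g x * cos (phase (freq_opp n) x)) = intO (fun x => g x * cos (phase n x)).
  by apply: eq_intO => x _; rewrite phase_opp cosN.
have os (g : R * R -> R) n : integrableO g ->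
    intO (fun x => g x * sin (phase (freq_opp n) x)) = - intO (fun x => g x * sin (phase n x)).
  move=> ig; rewrite -[RHS]mulN1r -intOZ; last exact: is'.
  by apply: eq_intO => x _; rewrite phase_opp sinN; ring.
have split0 (p q : R) : p + s * q = 0 -> p + s * - q = 0 -> p = 0 /\ q = 0.
  by move=> e e'; split; [lra|apply: (mulfI s0); rewrite mulr0; lra].
have Re0 n : intO (fun x => a x * cos (phase n x)) = 0 /\ intO (fun x => b x * sin (phase n x)) = 0.
  by apply: (split0 _ _ (re n)); have := re (freq_opp n); rewrite (oc a) (os b n ib).
have Im0 n : intO (fun x => b x * cos (phase n x)) = 0 /\ intO (fun x => a x * sin (phase n x)) = 0.
  apply: split0; last by rewrite mulrN -mulNr; exact: im.
  by have := im (freq_opp n); rewrite (oc b) (os a n ia) mulrNN.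
have [za zb] : trig_orthogonal a /\ trig_orthogonal b.
  split; split; [exact: ia| |exact: ib|] => n.
    by split; [have [] := Re0 n|have [] := Im0 n].
  by split; [have [] := Im0 n|have [] := Re0 n].
apply: ae_mono (ae_and (trig_orthogonal_eq0 za) (trig_orthogonal_eq0 zb)).
move=> x [pa pb] Ox; apply: complex_ext => /=.
  apply: (mulIf (lt0r_neq0 (expR_gt0 (- s * (l.1 * x.1 + l.2 * x.2))))).
  by rewrite mul0r; exact: pa.
apply: (mulIf (lt0r_neq0 (expR_gt0 (- s * (l.1 * x.1 + l.2 * x.2))))).
by rewrite mul0r; exact: pb.
Qed.

Lemma coef_inj s f g : s ^+ 2 = 1 -> L2 f -> L2 g ->
  (forall n, coef l s f n = coef l s g n) -> aeq f g.
Proof.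
move=> s2 f2 g2 fg; have fg2 := L2B f2 g2.
have z : forall n, coef l s (f - g) n = 0.
  move=> n; rewrite (_ : f - g = fun x => f x + (-1) *: g x); last first.
    by apply/funext => x; rewrite scaleN1r.
  rewrite (coefD _ _ _ f2 (L2Z (-1) g2)).
  by rewrite (coefZ _ _ _ _ g2) fg mulN1r subrr.
apply: ae_mono (coef_complete s2 fg2 z) => x /[apply] /eqP.
by rewrite subr_eq0 => /eqP.
Qed.

End L2Completeness.

(** * Smooth vectors of the operator and of its adjoint *)

Section Conjugation.
Context {R : realType}.
Implicit Types (f g : R * R -> R[i]) (j : 'I_2) (h : R * R).

Definition cconj f : R * R -> R[i] := fun x => (f x)^*.

Lemma smoothR_opp (u : R * R -> R) : smoothR u -> smoothR (fun x => - u x).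
Proof.
move=> su s; pose D := foldr (fun j (g : R * R -> R) x => 'D_(dir j) g x).
have e : D (fun x => - u x) s = fun x => - D u s x.
  elim: s => [//|j s ih] /=; rewrite -/D ih; apply/funext => x.
  by have [_ d] := su s; exact: (deriveN (d j x)).
rewrite -/D e; have [c d] := su s; split; first by move=> x; apply: cvgN; exact: c.
by move=> j x; apply: derivableN; exact: d.
Qed.

Lemma Re_cconj f : (fun x => complex.Re (cconj f x)) = (fun x => complex.Re (f x)).
Proof. by apply/funext => x; rewrite Re_conj. Qed.

Lemma Im_cconj f : (fun x => complex.Im (cconj f x)) = (fun x => - complex.Im (f x)).
Proof. by apply/funext => x; rewrite Im_conj. Qed.

Lemma smooth_conj f : smooth f -> smooth (cconj f).
Proof.
by move=> [fr fi]; split; [rewrite Re_cconj; exact: fr|rewrite Im_cconj; exact: smoothR_opp fi].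
Qed.

Lemma pd_conj j f : smooth f -> pd j (cconj f) = cconj (pd j f).
Proof.
move=> [_ fi]; apply/funext => x; rewrite /pd Re_cconj Im_cconj.
apply: complex_ext; rewrite ?Re_conj ?Im_conj //=.
by have [_ d] := fi [::]; exact: (deriveN (d j x)).
Qed.

Lemma laplacian_conj f : smooth f -> laplacian (cconj f) = cconj (laplacian f).
Proof.
move=> sf; have two j : pd j (pd j (cconj f)) = cconj (pd j (pd j f)).
  by rewrite (pd_conj j sf) (pd_conj j (smooth_pd j sf)).
rewrite /laplacian /pd1 /pd2 (two ord0) (two ord_max).
by apply/funext => x; rewrite /cconj !fctE rmorphD.
Qed.

Lemma BC_conj h f : smooth f -> BC h f -> BC h (cconj f).
Proof.
move=> sf bf t t01; have [b1 b2 b3 b4] := bf t t01.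
have realM (k : R) (z : R[i]) : k%:C * z^*%C = (k%:C * z)^*%C.
  by apply: complex_ext; rewrite !ReImE; ring.
rewrite /pd1 /pd2 !pd_conj// /cconj.
by rewrite !realM; split; apply: (congr1 (@conjc R)).
Qed.

Lemma cmeasM f g : cmeas f -> cmeas g -> cmeas (fun x => f x * g x).
Proof.
move=> [fr fi] [gr gi]; split.
  by under eq_fun do rewrite ReM; apply: measurable_funB; exact: measurable_funM.
by under eq_fun do rewrite ImM; apply: measurable_funD; exact: measurable_funM.
Qed.

Lemma cmeas_conj f : cmeas f -> cmeas (cconj f).
Proof.
move=> [fr fi]; split; rewrite ?Re_cconj ?Im_cconj//.
exact: measurable_funN.
Qed.

End Conjugation.

Section SmoothVectors.
Context {R : realType}.
Variables (l : R * R) (s : R) (T : @operator R).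
Hypothesis s2 : s ^+ 2 = 1.
Local Notation expsum := (expsum l s).
Local Notation coef := (coef l s).
Local Notation lam := (lam l).
Implicit Types (f g : R * R -> R[i]) (a : nat -> R[i]).

(** These two properties hold for the operator with [s = 1] and for its adjoint
    with [s = - 1], so that their smooth vectors are described together. *)
Hypothesis T_coef : forall f g, T (f, g) ->
  [/\ L2 f, L2 g & forall n, coef g n = lam n * coef f n].
Hypothesis T_expsum : forall f g a, L2 f -> L2 g -> rapid a ->
  aeq f (expsum a) -> aeq g (expsum (fun n => lam n * a n)) -> T (f, g).

Lemma app_graph f : dom T f -> T (f, app T f).
Proof. by move=> Tf; exact: (@xgetPex _ 0 [set g | T (f, g)] Tf). Qed.

Lemma Hinf_graph f k : Hinf T f -> T (iter k (app T) f, iter k.+1 (app T) f).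
Proof. by move=> Hf; apply: app_graph; exact: (Hf k I). Qed.

Lemma Hinf_coef f k : Hinf T f -> L2 (iter k (app T) f) /\
  forall n, coef (iter k (app T) f) n = lam n ^+ k * coef f n.
Proof.
move=> Hf; elim: k => [|k [_ ih]].
  have [f2 _ _] := T_coef (Hinf_graph 0 Hf).
  by split => // n; rewrite expr0 mul1r.
have [_ g2 e] := T_coef (Hinf_graph k Hf); split => // n.
by rewrite e ih exprS mulrA.
Qed.

Lemma Hinf_L2 f : Hinf T f -> L2 f.
Proof. by move=> Hf; have [] := Hinf_coef 0 Hf. Qed.

Lemma L2norm_le_seminorm f j k : (j <= k)%N ->
  L2norm (iter j (app T) f) <= seminorm T k f.
Proof.
move=> jk; rewrite /seminorm.
rewrite -[j]/(nat_of_ord (Ordinal (jk : (j < k.+1)%N))).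
by apply: (@le_bigmax _ _ _ 0 (fun i : 'I_k.+1 => L2norm (iter i (app T) f))).
Qed.

Lemma seminorm_ge0 f k : 0 <= seminorm T k f.
Proof. exact: le_trans (L2norm_ge0 _) (L2norm_le_seminorm f (leq0n k)). Qed.

(** Each application of [T] multiplies the coefficients by [lam], which grows at
    least linearly in the index; so a seminorm of order [k] gives [k] powers of
    decay. *)
Lemma coef_decay k : exists C : R, 0 <= C /\ forall f, Hinf T f ->
  forall n, Cmod (coef f n) * n.+1%:R ^+ k <= C * seminorm T k f.
Proof.
have [D [D0 Dn]] := lam_growth l.
pose E := 2 * expR (`|s| * (`|l.1| + `|l.2|)).
have E0 : 0 <= E by rewrite mulr_ge0// expR_ge0.
exists ((2 * D) ^+ k * (2 * E)).
have D20 : 0 <= (2 * D) ^+ k by rewrite exprn_ge0// mulr_ge0// ltW.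
split=> [|f Hf n]; first by rewrite !mulr_ge0.
set N := seminorm T k f.
have bound j : (j <= k)%N -> Cmod (lam n) ^+ j * Cmod (coef f n) <= E * N.
  move=> jk; have [g2 e] := Hinf_coef j Hf.
  rewrite -CmodX -CmodM -e; apply: (le_trans (coef_le l s n g2)).
  by rewrite ler_wpM2l//; exact: L2norm_le_seminorm.
(* [(1 + x) ^+ k <= 2 ^+ k * (1 + x ^+ k)], on either side of [x = 1]. *)
have weight : n.+1%:R ^+ k <= (2 * D) ^+ k * (1 + Cmod (lam n) ^+ k).
  set x := Cmod (lam n); have x0 : 0 <= x by exact: Cmod_ge0.
  apply: (@le_trans _ _ ((D * (1 + x)) ^+ k)).
    by rewrite lerXn2r ?nnegrE ?mulr_ge0 ?addr_ge0 ?(ltW D0)// Dn.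
  rewrite !exprMn [2 ^+ k * _]mulrC -mulrA ler_wpM2l ?exprn_ge0 ?(ltW D0)//.
  rewrite -[2 ^+ k]mulr1; have [x1|/ltW x1] := leP x 1.
    apply: (@le_trans _ _ (2 ^+ k)); first by rewrite lerXn2r ?nnegrE ?addr_ge0//; lra.
    by rewrite mulr1 ler_peMr ?exprn_ge0// lerDl exprn_ge0.
  apply: (@le_trans _ _ ((2 * x) ^+ k)).
    by rewrite lerXn2r ?nnegrE ?addr_ge0 ?mulr_ge0//; lra.
  by rewrite mulr1 exprMn ler_wpM2l ?exprn_ge0// lerDr.
rewrite mulrC; apply: (le_trans (ler_wpM2r (Cmod_ge0 _) weight)).
rewrite -!mulrA ler_wpM2l// [leLHS]mulrDl mul1r [leRHS](_ : _ = E * N + E * N); last by rewrite /E; ring.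
apply: lerD; last exact: bound.
by have := bound 0%N (leq0n k); rewrite expr0 mul1r.
Qed.

Lemma Hinf_rapid f : Hinf T f -> rapid (coef f).
Proof.
by move=> Hf k; have [C [_ fC]] := coef_decay k; exists (C * seminorm T k f); exact: fC.
Qed.

Lemma Hinf_expsum f : Hinf T f -> aeq f (expsum (coef f)).
Proof.
move=> Hf; have rf := Hinf_rapid Hf.
apply: (@coef_inj _ l s) => //; first exact: Hinf_L2.
  exact/ccont_L2/ccont_expsum.
by move=> n; rewrite coef_expsum.
Qed.

Lemma rapid_lamX k a : rapid a -> rapid (fun n => lam n ^+ k * a n).
Proof. exact/rapidM/moderateX/moderate_lam. Qed.

Lemma L2_expsum a : rapid a -> L2 (expsum a).
Proof. by move=> ra; apply: ccont_L2; exact: ccont_expsum. Qed.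

Lemma iter_app_expsum f a k : L2 f -> rapid a -> aeq f (expsum a) ->
  [/\ L2 (iter k (app T) f),
      aeq (iter k (app T) f) (expsum (fun n => lam n ^+ k * a n)) &
      dom T (iter k (app T) f)].
Proof.
move=> f2 ra fa; have r k := rapid_lamX k ra.
have step g m : L2 g -> aeq g (expsum (fun n => lam n ^+ m * a n)) ->
    T (g, expsum (fun n => lam n ^+ m.+1 * a n)).
  move=> g2 ga; apply: (T_expsum g2 (L2_expsum (r m.+1)) (r m) ga).
  by apply: aeq_refl => x _; congr (expsum _ x); apply/funext => n; rewrite exprS mulrA.
elim: k => [|k [g2 ga gd]].
  have fa' : aeq f (expsum (fun n => lam n ^+ 0 * a n)).
    by apply: ae_mono fa => x /[apply] ->; congr (expsum _ x); apply/funext => n; rewrite expr0 mul1r.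
  by split => //; eexists; exact: step fa'.
have Tg := app_graph gd; have [_ g2' e] := T_coef Tg.
have ga' : aeq (iter k.+1 (app T) f) (expsum (fun n => lam n ^+ k.+1 * a n)).
  apply: (@coef_inj _ l s) => //; first exact: L2_expsum.
  move=> n; rewrite e coef_expsum//.
  rewrite (aeq_coef l s g2 (L2_expsum (r k)) ga) coef_expsum//.
  by rewrite exprS mulrA.
by split => //; eexists; exact: step ga'.
Qed.

Lemma expsum_Hinf f a : L2 f -> rapid a -> aeq f (expsum a) -> Hinf T f.
Proof. by move=> f2 ra fa k _ j _; have [_ _] := iter_app_expsum j f2 ra fa. Qed.

Lemma expsum_in_Hinf a : rapid a -> Hinf T (expsum a).
Proof.
by move=> ra; apply: (expsum_Hinf (L2_expsum ra) ra); exact: aeq_refl.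
Qed.

Lemma seminorm_le k : exists C : R, 0 <= C /\ forall f a (M : R), L2 f -> rapid a ->
  aeq f (expsum a) -> (forall j, (j <= k)%N -> qbounded M (fun n => lam n ^+ j * a n)) ->
  seminorm T k f <= C * M.
Proof.
pose E := expR (`|s| * (`|l.1| + `|l.2|)).
exists (4 * E); split; first by rewrite mulr_ge0// expR_ge0.
move=> f a M f2 ra fa q.
have M0 := qbounded_ge0 (q 0%N (leq0n k)).
apply: bigmax_le => [|j _]; first by rewrite !mulr_ge0// expR_ge0.
have [g2 ga _] := iter_app_expsum j f2 ra fa.
apply: L2norm_le_sup g2 ga _ _; first by rewrite !mulr_ge0// expR_ge0.
  exact/ccont_expsum/rapid_lamX.
move=> x Ox; rewrite -mulrA [E * M]mulrC.
by apply: expsum_Omega_le => //; apply: q; rewrite -ltnS.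
Qed.

End SmoothVectors.

Section OperatorAndAdjoint.
Context {R : realType}.
Variable h : R * R.
Hypotheses (h1_gt0 : 0 < h.1) (h2_gt0 : 0 < h.2).
Implicit Types (f g u v : R * R -> R[i]) (a : nat -> R[i]).

Definition logh : R * R := (ln h.1, ln h.2).
Definition recip : R * R := (h.1^-1, h.2^-1).
Local Notation lam := (lam logh).

Let sqr1 : 1 ^+ 2 = 1 :> R. Proof. by rewrite expr1n. Qed.
Let sqrN1 : (- 1) ^+ 2 = 1 :> R. Proof. by rewrite sqrrN expr1n. Qed.

Lemma BC_expsum_pos a : rapid a -> BC h (expsum logh 1 a).
Proof.
move=> ra; have := BC_expsum logh sqr1 ra.
by rewrite !mul1r /= !lnK ?posrE// -surjective_pairing.
Qed.

Lemma BC_expsum_neg a : rapid a -> BC recip (expsum logh (- 1) a).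
Proof.
move=> ra; have := BC_expsum logh sqrN1 ra.
by rewrite !mulN1r /= !expRN !lnK ?posrE.
Qed.

Lemma aeq_L2norm0 f g : L2 f -> L2 g -> aeq f g -> L2norm (f - g) = 0.
Proof.
move=> f2 g2 fg; apply/eqP; rewrite eq_le L2norm_ge0 andbT.
apply: (@L2norm_le_sup _ _ (fun=> 0)) => //.
- exact: L2B.
- by apply: ae_mono fg => x /[apply] e; rewrite !fctE e subrr.
- exact: ccont_cst.
- by move=> x _; rewrite Cmod0.
Qed.

Lemma Lop_smooth f : smooth f -> BC h f -> Lop h (f, laplacian f).
Proof.
move=> sf bf; have f2 := ccont_L2 (smooth_ccont sf).
have lf2 := ccont_L2 (smooth_laplacian_ccont sf).
split; [exact: f2|exact: lf2|exists (fun=> f); split => //=].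
  by rewrite (aeq_L2norm0 f2 f2); [exact: cvg_cst|exact: aeq_refl].
by rewrite (aeq_L2norm0 lf2 lf2); [exact: cvg_cst|exact: aeq_refl].
Qed.

(** Both sides of Green's formula are continuous in the graph norm, by which the
    operator is the closure of the Laplacian on smooth functions. *)
Lemma Lop_green f g u : Lop h (f, g) -> smooth u -> BC recip u ->
  cintegral (fun x => g x * u x) = cintegral (fun x => f x * laplacian u x).
Proof.
move=> [/= f2 g2 [w [sw cf cg]]] su bu.
have cu := smooth_ccont su; have clu := smooth_laplacian_ccont su.
have [M [M0 uM]] := ccont_bounded cu; have [N [N0 luN]] := ccont_bounded clu.
have w2 n : L2 (w n) by have [? _] := sw n; exact/ccont_L2/smooth_ccont.
have lw2 n : L2 (laplacian (w n)).
  by have [? _] := sw n; exact/ccont_L2/smooth_laplacian_ccont.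
have ci (p q : R * R -> R[i]) : L2 p -> ccont q -> cint (fun x => p x * q x).
  by move=> p2 cq; apply: cintM => //; exact: L2_cint.
have split_int (p q r : R * R -> R[i]) : L2 p -> L2 q -> ccont r ->
    cintegral (fun x => (p - q) x * r x) =
    cintegral (fun x => p x * r x) - cintegral (fun x => q x * r x).
  move=> p2 q2 cr; rewrite -(cintegralB (ci _ _ p2 cr) (ci _ _ q2 cr)).
  by congr cintegral; apply/funext => x; rewrite !fctE mulrBl.
set z := cintegral _; set z' := cintegral _.
have bound n : Cmod (z - z') <= 2 * M * L2norm (laplacian (w n) - g) + 2 * N * L2norm (w n - f).
  have [swn bwn] := sw n.
  have G : cintegral (fun x => laplacian (w n) x * u x) = cintegral (fun x => w n x * laplacian u x).
    by apply: (green _ _ swn bwn su bu); rewrite mulfV// lt0r_neq0.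
  have -> : z - z' = - cintegral (fun x => (laplacian (w n) - g) x * u x) +
      cintegral (fun x => (w n - f) x * laplacian u x).
    by rewrite !split_int// G /z /z'; ring.
  apply: (le_trans (Cmod_le_add _ _)); rewrite CmodN; apply: lerD.
    exact: (cint_ccont_L2_le (L2B (lw2 n) g2) cu M0 uM).
  exact: (cint_ccont_L2_le (L2B (w2 n) f2) clu N0 luN).
have lim0 : (fun n => 2 * M * L2norm (laplacian (w n) - g) + 2 * N * L2norm (w n - f)) @ \oo --> (0 : R).
  have cv := cvgD (cvgM (cvg_cst (2 * M)) cg) (cvgM (cvg_cst (2 * N)) cf).
  by rewrite !mulr0 addr0 in cv; exact: cv.
apply/eqP; rewrite -subr_eq0 -Cmod_eq0 eq_le Cmod_ge0 andbT.
apply: (@ler_cvg_to _ _ _ _ (fun=> Cmod (z - z')) _ _ _ (cvg_cst _) lim0).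
exact: nearW.
Qed.

Lemma laplacian_expo s n : s ^+ 2 = 1 ->
  laplacian (expo logh s n) = fun x => lam n * expo logh s n x.
Proof.
move=> s2; have rd := rapid_delta (R := R) n; apply/funext => x.
rewrite -expsum_delta laplacian_expsum// -expsumZ//.
congr (expsum _ _ _ x); apply/funext => m; rewrite /delta.
by case: eqVneq => [->//|_]; rewrite !mulr0.
Qed.

(** Exponentials are smooth vectors of the transposed problem, so testing
    against them in Green's formula reads off the eigenvalues. *)
Lemma Lop_coef f g : Lop h (f, g) ->
  [/\ L2 f, L2 g & forall n, coef logh 1 g n = lam n * coef logh 1 f n].
Proof.
move=> Lfg; have [/= f2 g2 _] := Lfg; split => // n.
have rd := rapid_delta (R := R) n.
have bu : BC recip (expo logh (- 1) n).
  by rewrite -expsum_delta; exact: BC_expsum_neg.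
have -> : coef logh 1 g n = _ := Lop_green Lfg (smooth_expo logh (- 1) n) bu.
rewrite /coef -cintegralZ; last by apply: cintM; [exact: L2_cint|exact: ccont_expo].
by congr cintegral; apply/funext => x; rewrite laplacian_expo// mulrCA.
Qed.

Lemma Lop_expsum f g a : L2 f -> L2 g -> rapid a -> aeq f (expsum logh 1 a) ->
  aeq g (expsum logh 1 (fun n => lam n * a n)) -> Lop h (f, g).
Proof.
move=> f2 g2 ra fa ga; split => //.
have s := smooth_expsum logh 1 ra.
exists (fun=> expsum logh 1 a); split => /=.
- by move=> _; split => //; exact: BC_expsum_pos.
- rewrite aeq_L2norm0//; [exact: cvg_cst|exact/ccont_L2/smooth_ccont|exact: aeq_sym].
- rewrite aeq_L2norm0//; first exact: cvg_cst.
    exact/ccont_L2/smooth_laplacian_ccont.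
  by rewrite laplacian_expsum//; exact: aeq_sym.
Qed.

Lemma L2dot_conj u f : L2 f -> ccont u ->
  L2dot (cconj u) f = (cintegral (fun x => f x * u x))^*%C.
Proof.
move=> f2 cu; rewrite -cintegral_conj; last by apply: cintM => //; exact: L2_cint.
by congr cintegral; apply/funext => x; rewrite /cconj rmorphM mulrC.
Qed.

Lemma adjoint_coef f g : adjoint (Lop h) (f, g) ->
  [/\ L2 f, L2 g & forall n, coef logh (- 1) g n = lam n * coef logh (- 1) f n].
Proof.
move=> [/= f2 g2 adj]; split => // n.
have ce := ccont_expo logh 1 n; have se := smooth_expo logh 1 n.
have be : BC h (expo logh 1 n) by rewrite -expsum_delta; exact/BC_expsum_pos/rapid_delta.
have := adj _ _ (Lop_smooth (smooth_conj se) (BC_conj se be)).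
rewrite laplacian_conj// !L2dot_conj//; last exact: smooth_laplacian_ccont.
move=> /(can_inj (@conjcK R)); rewrite /coef opprK => <-.
rewrite -cintegralZ; last by apply: cintM => //; exact: L2_cint.
by congr cintegral; apply/funext => x; rewrite laplacian_expo// mulrCA.
Qed.

Lemma adjoint_expsum f g a : L2 f -> L2 g -> rapid a ->
  aeq f (expsum logh (- 1) a) ->
  aeq g (expsum logh (- 1) (fun n => lam n * a n)) -> adjoint (Lop h) (f, g).
Proof.
move=> f2 g2 ra fa ga; split => //= u v Luv.
have s := smooth_expsum logh (- 1) ra; have b := BC_expsum_neg ra.
have := Lop_green Luv (smooth_conj s) (BC_conj s b).
have [/= u2 v2 _] := Luv.
rewrite (laplacian_conj s) (laplacian_expsum _ sqrN1 ra).
set G := expsum _ _ _; set G' := expsum _ _ _.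
have cG : ccont G by exact: smooth_ccont.
have cG' : ccont G'.
  by apply: ccont_expsum; apply: rapidM => //; exact: moderate_lam.
have rep (w p q : R * R -> R[i]) : L2 w -> L2 p -> ccont q -> aeq p q ->
    L2dot w p = cintegral (fun x => w x * cconj q x).
  move=> w2 p2 cq pq; apply: aeq_cintegral.
  - by apply: cmeasM; [exact: L2_cmeas|exact/cmeas_conj/L2_cmeas].
  - by apply: cmeasM; [exact: L2_cmeas|exact/cmeas_conj/ccont_cmeas].
  - by apply: ae_mono pq => x /[apply] ->.
move=> gr; apply: etrans (rep v f G v2 f2 cG fa) _; apply: etrans gr _.
exact: esym (rep u g G' u2 g2 cG' ga).
Qed.

End OperatorAndAdjoint.

(** * Distributions as sequences of moderate growth *)

Section Distributions.
Context {R : realType}.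
Variable h : R * R.
Hypotheses (h1_gt0 : 0 < h.1) (h2_gt0 : 0 < h.2).
Notation l := (logh h).
Notation lam := (lam l).
Notation testexp := (expo l (- 1)).
Notation testsum := (expsum l (- 1)).
Notation tcoef := (coef l (- 1)).
Notation adj := (adjoint (Lop h)).
Implicit Types (phi psi : R * R -> R[i]) (w : (R * R -> R[i]) -> R[i])
  (a b : nat -> R[i]) (c : R[i]).

Let sqr1 : 1 ^+ 2 = 1 :> R. Proof. by rewrite expr1n. Qed.
Let sqrN1 : (- 1) ^+ 2 = 1 :> R. Proof. by rewrite sqrrN expr1n. Qed.
Let Tc := adjoint_coef h1_gt0 h2_gt0.
Let Te := adjoint_expsum h1_gt0 h2_gt0.

Lemma Htest_of_sum phi a : L2 phi -> rapid a -> aeq phi (testsum a) -> Htest h phi.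
Proof. exact: (expsum_Hinf sqrN1 Tc Te). Qed.

Lemma Htest_L2 phi : Htest h phi -> L2 phi.
Proof. exact: (Hinf_L2 Tc). Qed.

Lemma Htest_rapid phi : Htest h phi -> rapid (tcoef phi).
Proof. exact: (Hinf_rapid Tc). Qed.

Lemma Htest_sum phi : Htest h phi -> aeq phi (testsum (tcoef phi)).
Proof. exact: (Hinf_expsum sqrN1 Tc). Qed.

Lemma Htest_testsum a : rapid a -> Htest h (testsum a).
Proof. exact: (expsum_in_Hinf sqrN1 Tc Te). Qed.

Lemma tcoef_of_sum phi a : L2 phi -> rapid a -> aeq phi (testsum a) -> tcoef phi = a.
Proof.
move=> p2 ra pa; rewrite (aeq_coef l (- 1) p2 _ pa); first exact: coef_expsum.
exact: L2_expsum.
Qed.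

Lemma Htest_lin (k : R[i]) phi psi : Htest h phi -> Htest h psi ->
  Htest h (k *: phi + psi) /\
  tcoef (k *: phi + psi) = fun n => k * tcoef phi n + tcoef psi n.
Proof.
move=> tp tq; have p2 := Htest_L2 tp; have q2 := Htest_L2 tq.
have rp := Htest_rapid tp; have rq := Htest_rapid tq.
have L : L2 (k *: phi + psi) by apply: L2D => //; exact: L2Z.
have rr : rapid (fun n => k * tcoef phi n + tcoef psi n) by apply: rapidD => //; exact: rapidZ.
have A : aeq (k *: phi + psi) (testsum (fun n => k * tcoef phi n + tcoef psi n)).
  apply: ae_mono (ae_and (Htest_sum tp) (Htest_sum tq)) => x [e1 e2] Ox.
  by rewrite expsumD//; [rewrite expsumZ// -e1// -e2|exact: rapidZ].
by split; [exact: (Htest_of_sum L rr A)|exact: tcoef_of_sum].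
Qed.

Lemma Htest_sub phi psi : Htest h phi -> Htest h psi ->
  Htest h (phi - psi) /\ tcoef (phi - psi) = fun n => tcoef phi n - tcoef psi n.
Proof.
move=> tp tq; have [t e] := Htest_lin (- 1) tq tp.
have s : phi - psi = (- 1) *: psi + phi by rewrite scaleN1r addrC.
by rewrite s e; split => //; apply/funext => n; rewrite mulN1r addrC.
Qed.

Lemma Htest_testexp n : Htest h (testexp n) /\ tcoef (testexp n) = delta n.
Proof.
rewrite -expsum_delta; have rd := rapid_delta (R := R) n.
by split; [exact: Htest_testsum|exact: coef_expsum].
Qed.

(** The coefficients of test functions and those of distributions belong to dual
    bases, so their pairing involves no conjugation. *)
Definition represents w b := moderate b /\
  forall phi, Htest h phi -> w phi = csum (fun n => tcoef phi n * b n).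

Lemma rapid_pairing a b : rapid a -> moderate b -> rapid (fun n => a n * b n).
Proof. by move=> ra mb; under eq_fun do rewrite mulrC; exact: rapidM. Qed.

Lemma represents_testexp w b n : represents w b -> w (testexp n) = b n.
Proof.
move=> [_ wb]; have [t e] := Htest_testexp n; rewrite wb// e.
by rewrite -[RHS](csum_delta b n); congr csum; apply/funext => m; rewrite mulrC.
Qed.

Lemma represents_exists b : moderate b -> exists w, represents w b.
Proof. by move=> mb; exists (fun phi => csum (fun n => tcoef phi n * b n)). Qed.

Lemma represents_linear w b : represents w b -> linear_dist h w.
Proof.
move=> [mb wb] k phi psi tp tq; have [t e] := Htest_lin k tp tq.
have [M pM] := rapid_qbounded (rapid_pairing (Htest_rapid tp) mb).
have [N qN] := rapid_qbounded (rapid_pairing (Htest_rapid tq) mb).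
have [M' kM] := rapid_qbounded (rapidZ k (rapid_pairing (Htest_rapid tp) mb)).
rewrite !wb// e -(csumZ k pM) -(csumD kM qN); congr csum; apply/funext => n.
by rewrite mulrDl mulrA.
Qed.

Lemma represents_continuous w b : represents w b -> continuous_dist h w.
Proof.
move=> [mb wb] phi0 t0 e e0; have [k [L bL]] := mb.
have [C [C0 cC]] := coef_decay Tc (k + 2)%N.
have L0 : 0 <= L by have := bL 0%N; rewrite expr1n mulr1; exact: le_trans.
have K0 : 0 < 4 * (L * C) + 1 by rewrite ltr_wpDl// !mulr_ge0.
exists (k + 2)%N, (e / (4 * (L * C) + 1)); split; first exact: divr_gt0.
move=> phi tp; rewrite ltr_pdivlMr// => small.
have [ts es] := Htest_sub tp t0.
have [M pM] := rapid_qbounded (rapid_pairing (Htest_rapid tp) mb).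
have [N qN] := rapid_qbounded (rapid_pairing (Htest_rapid t0) mb).
rewrite !wb// -(csumB pM qN).
apply: le_lt_trans small; set S := seminorm _ _ _.
have S0 : 0 <= S by exact: seminorm_ge0.
apply: (@le_trans _ _ (4 * (L * (C * S)))); last first.
  by rewrite mulrDr mulr1 [S * _]mulrC -!mulrA lerDl.
apply: csum_le => n; rewrite -mulrBl CmodM.
have := cC _ ts n; rewrite -/S es exprD => h1.
apply: (@le_trans _ _ (L * (Cmod (tcoef phi n - tcoef phi0 n) * (n.+1%:R ^+ k * n.+1%:R ^+ 2)))).
  rewrite [leRHS](_ : _ = Cmod (tcoef phi n - tcoef phi0 n) *
    (L * n.+1%:R ^+ k) * n.+1%:R ^+ 2); last by ring.
  by rewrite ler_wpM2r ?exprn_ge0// ler_wpM2l.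
by rewrite ler_wpM2l.
Qed.

Lemma represents_Hdist w b : represents w b -> Hdist h w.
Proof. by move=> wb; split; [exact: represents_linear wb|exact: represents_continuous wb]. Qed.

Lemma archimedean_quotient (K e : R) : 0 < e -> exists N, K / N.+1%:R <= e.
Proof.
move=> e0; exists (Num.truncn (K / e)).
rewrite ler_pdivrMr// mulrC -ler_pdivrMr//; exact/ltW/truncnS_gt.
Qed.

Lemma linear_dist0 w : linear_dist h w -> w 0 = 0.
Proof.
move=> lw; have t0 : Htest h (0 : R * R -> R[i]).
  have [t _] := Htest_testexp 0; have [+ _] := Htest_lin (- 1) t t.
  by rewrite scaleN1r addNr.
have := lw 1 0 0 t0 t0; rewrite scale1r addr0 mul1r => e.
by apply: (addrI (w 0)); rewrite -e addr0.
Qed.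

Lemma qbounded_uniform (b : nat -> nat -> R[i]) k p : (forall j, rapid (b j)) ->
  exists M : R, forall j n, (j <= k)%N -> Cmod (b j n) * n.+1%:R ^+ p <= M.
Proof.
move=> rb; elim: k => [|k [M bM]].
  by have [M bM] := rb 0%N p; exists M => j n; rewrite leqn0 => /eqP ->.
have [N bN] := rb k.+1 p; exists (Num.max M N) => j n.
rewrite leq_eqVlt => /predU1P[->|jk]; first by rewrite le_max bN orbT.
by rewrite le_max bM.
Qed.

(** Continuity at zero, tested on small multiples of the exponentials, bounds
    the values of a distribution on them polynomially. *)
Lemma Hdist_moderate w : Hdist h w -> moderate (fun n => w (testexp n)).
Proof.
move=> [lw cw]; have w0 := linear_dist0 lw.
have t0 : Htest h (0 : R * R -> R[i]).
  have [t _] := Htest_testexp 0; have [+ _] := Htest_lin (- 1) t t.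
  by rewrite scaleN1r addNr.
have [k [d [d0 small]]] := cw _ t0 1 ltr01.
have [C [C0 sC]] := seminorm_le sqrN1 Tc Te k.
have [q [L' lamL']] := moderate_lam l.
pose L := Num.max 1 L'.
have L1 : 1 <= L by rewrite le_max lexx.
have pw m i : 1 <= m.+1%:R ^+ i :> R by rewrite exprn_ege1// ler1n.
have lamL j m : (j <= k)%N -> Cmod (lam m) ^+ j <= (L * m.+1%:R ^+ q) ^+ k.
  move=> jk; have b1 : 1 <= L * m.+1%:R ^+ q.
    exact: (le_trans L1 (ler_peMr (le_trans ler01 L1) (pw m q))).
  apply: (@le_trans _ _ ((L * m.+1%:R ^+ q) ^+ j)); last exact: ler_weXn2l.
  rewrite lerXn2r ?nnegrE//; first exact: le_trans b1.
  apply: (le_trans (lamL' m)); rewrite ler_wpM2r ?exprn_ge0//.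
  by rewrite le_max lexx orbT.
exists (q * k + 2)%N, (2 * (C + 1) * L ^+ k / d) => n.
pose W : R := (L * n.+1%:R ^+ q) ^+ k * n.+1%:R ^+ 2.
have W0 : 0 < W by rewrite mulr_gt0 ?exprn_gt0// mulr_gt0 ?exprn_gt0// (lt_le_trans ltr01).
have C1 : 0 < 2 * (C + 1) by rewrite mulr_gt0// ltr_wpDl.
(* This multiple of the exponential has seminorm less than [d]. *)
pose t : R := d / (2 * (C + 1) * W).
have tp : 0 < t by rewrite divr_gt0// mulr_gt0.
have [te ce] := Htest_testexp n.
have [tt ct] := Htest_lin t%:C te t0.
rewrite addr0 in tt ct.
have small_t : seminorm adj k (t%:C *: testexp n - 0) < d.
  rewrite subr0.
  have rt : rapid (fun m => t%:C * delta n m) by exact/rapidZ/rapid_delta.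
  have e2 := Htest_L2 tt.
  have ae : aeq (t%:C *: testexp n) (testsum (fun m => t%:C * delta n m)).
    apply: aeq_refl => x _; rewrite expsumZ; last exact: rapid_delta.
    by rewrite expsum_delta.
  apply: (le_lt_trans (sC _ _ (t * W) e2 rt ae _)) => [j jk m|].
    rewrite CmodM CmodX CmodM Cmod_real (ger0_norm (ltW tp)) /delta.
    have [->|_] := eqVneq m n; last first.
      by rewrite Cmod0 mulr0 mulr0 mul0r mulr_ge0 ?ltW.
    rewrite Cmod1 mulr1 [_ * t]mulrC -mulrA ler_wpM2l ?(ltW tp)// ler_wpM2r ?exprn_ge0//.
    exact: lamL.
  rewrite /t (_ : C * _ = d * (C / (2 * (C + 1)))); last first.
    by field; rewrite !lt0r_neq0// ltr_wpDl.
  by rewrite gtr_pMr// ltr_pdivrMr// mul1r; lra.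
have := small _ tt small_t.
rewrite w0 subr0 -[_ *: _]addr0 lw// w0 addr0 CmodM Cmod_real (ger0_norm (ltW tp)) => le1.
rewrite -(ler_pM2l tp); apply: (le_trans (ltW le1)).
rewrite le_eqVlt; apply/orP; left; apply/eqP.
rewrite /t /W exprMn -exprM exprD.
have a0 : n.+1%:R ^+ (q * k) != 0 :> R by rewrite expf_neq0// pnatr_eq0.
have b0 : n.+1%:R ^+ 2 != 0 :> R by rewrite expf_neq0// pnatr_eq0.
have c0 : L ^+ k != 0 by rewrite expf_neq0// lt0r_neq0// (lt_le_trans ltr01).
have d00 : d != 0 by exact: lt0r_neq0.
have C10 : C + 1 != 0 by rewrite lt0r_neq0// ltr_wpDl.
move: a0 b0 c0; move: (n.+1%:R ^+ (q * k)) (n.+1%:R ^+ 2) (L ^+ k) => A B D a0 b0 c0.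
by field; rewrite a0 b0 c0 d00 C10.
Qed.

(** A distribution is determined by its values on exponentials: the partial sums
    of a test function converge in every seminorm. *)
Lemma Hdist_represents w : Hdist h w -> represents w (fun n => w (testexp n)).
Proof.
move=> Hw; have mw := Hdist_moderate Hw; split => // phi tp.
have [lw cw] := Hw; set b := fun n => w (testexp n); set a := tcoef phi.
have ra : rapid a by exact: Htest_rapid.
have tt N : Htest h (testsum (trunc N a)) by apply: Htest_testsum; exact: rapid_trunc.
have partial N : w (testsum (trunc N a)) = csum (trunc N (fun n => a n * b n)).
  rewrite (csum_finite (N := N)) => [|n Nn]; last by rewrite /trunc ltnNge Nn.
  elim: N => [|N ih].
    rewrite big_ord0 (_ : testsum (trunc 0 a) = 0) ?linear_dist0//.
    apply/funext => x; rewrite (_ : trunc 0 a = fun n => 0 * delta 0 n).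
      by rewrite expsumZ ?mul0r//; exact: rapid_delta.
    by apply/funext => n; rewrite mul0r.
  have tN : trunc N.+1 (fun n => a n * b n) N = a N * b N by rewrite /trunc ltnSn.
  rewrite big_ord_recr /= tN.
  rewrite (_ : testsum (trunc N.+1 a) = a N *: testexp N + testsum (trunc N a)).
    have [te _] := Htest_testexp N.
    rewrite lw// ih addrC; congr (_ + _); apply: eq_bigr => i _.
    by rewrite /trunc (ltn_ord i) (ltn_trans (ltn_ord i) (ltnSn N)).
  apply/funext => x; rewrite !fctE -expsum_delta -[_ *: _]expsumZ; last exact: rapid_delta.
  rewrite -expsumD; [|exact/rapidZ/rapid_delta|exact: rapid_trunc].
  congr (expsum _ _ _ x); apply/funext => n; rewrite /trunc /delta ltnS leq_eqVlt.
  by case: eqVneq => [->|_] /=; rewrite ?ltnn ?addr0 ?mulr1 ?mulr0 ?add0r.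
have [M' abM] := rapid_pairing ra mw 3%N.
apply/eqP; rewrite -subr_eq0 -Cmod_eq0 eq_le Cmod_ge0 andbT.
apply/ler_addgt0Pl => e e0; rewrite addr0.
have e2 : 0 < e / 2 by exact: divr_gt0.
have [k [d [d0 small]]] := cw _ tp _ e2.
have [C [C0 sC]] := seminorm_le sqrN1 Tc Te k.
have [M aM] := @qbounded_uniform (fun j n => lam n ^+ j * a n) k 3 (fun j => rapid_lamX l j ra).
have M0 : 0 <= M by apply: le_trans (aM 0%N 0%N (leq0n k)); rewrite mulr_ge0 ?exprn_ge0.
have [N1 N1d] := archimedean_quotient (C * M) (divr_gt0 d0 (ltr0n R 2)).
have [N2 N2e] := archimedean_quotient (4 * M') e2.
pose N := maxn N1 N2.
have mono (K : R) n m : 0 <= K -> (n <= m)%N -> K / m.+1%:R <= K / n.+1%:R.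
  by move=> K0 nm; rewrite ler_wpM2l// lef_pV2 ?posrE// ler_nat.
have close : seminorm adj k (testsum (trunc N a) - phi) < d.
  have [ts cs] := Htest_sub (tt N) tp.
  apply: (le_lt_trans (sC _ _ (M / N.+1%:R) (Htest_L2 ts) (Htest_rapid ts) (Htest_sum ts) _)).
    move=> j jk n; rewrite cs coef_expsum//; last exact: rapid_trunc.
    have := @qbounded_tail R M (fun n => lam n ^+ j * a n) N (fun n => aM j n jk) n.
    rewrite (_ : trunc N _ n = lam n ^+ j * trunc N a n); last first.
      by rewrite /trunc; case: ifP => _; rewrite ?mulr0.
    by rewrite -mulrBr !CmodM -[a n - _]opprB CmodN.
  rewrite mulrA; apply: (@le_lt_trans _ _ (d / 2)); last by rewrite ltr_pdivrMr// ltr_pMr// ltr1n.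
  by apply: le_trans N1d; apply: mono; [exact: mulr_ge0|exact: leq_maxl].
have c1 := small _ (tt N) close.
have c2 : Cmod (csum (fun n => a n * b n) - csum (trunc N (fun n => a n * b n))) <= e / 2.
  have [q1 h1] := rapid_qbounded (rapid_pairing ra mw).
  have [q2 h2] := rapid_qbounded (rapid_trunc N (fun n => a n * b n)).
  rewrite -(csumB h1 h2); apply: le_trans N2e.
  have q0 : 0 <= M' by apply: le_trans (abM 0%N); rewrite mulr_ge0 ?exprn_ge0.
  apply: (@le_trans _ _ (4 * M' / N.+1%:R)); last by apply: mono; [exact: mulr_ge0|exact: leq_maxr].
  by rewrite -mulrA; apply: csum_le; exact: qbounded_tail.
rewrite (_ : w phi - _ = - (w (testsum (trunc N a)) - w phi) -
  (csum (fun n => a n * b n) - csum (trunc N (fun n => a n * b n)))); last by rewrite partial; ring.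
apply: (le_trans (Cmod_le_add _ _)); rewrite !CmodN [e]splitr.
by apply: lerD => //; exact: ltW.
Qed.

Definition symbol c n : R[i] := mu l ord0 n + c * mu l ord_max n.

Lemma symbolE c n : symbol c n = sigmaP h c (freq n).
Proof. by []. Qed.

Lemma moderate_symbol c : moderate (symbol c).
Proof.
apply: moderateD; first exact: moderate_mu.
by apply: moderateM; [exact: moderate_cst|exact: moderate_mu].
Qed.

Lemma open_Omega : open (Omega : set (R * R)).
Proof.
rewrite (_ : Omega = fst @^-1` `]0, 1[%classic `&` snd @^-1` `]0, 1[%classic)//.
by apply: openI; apply: open_comp => [x _|]; (exact: cvg_fst || exact: cvg_snd || exact: interval_open).
Qed.

Lemma pd_local (F G : R * R -> R[i]) j : (forall x, Omega x -> F x = G x) ->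
  forall x, Omega x -> pd j F x = pd j G x.
Proof.
move=> FG x Ox; have nO : nbhs x Omega by apply: open_nbhs_nbhs; split => //; exact: open_Omega.
rewrite /pd; congr (_ +i* _); apply: near_eq_derive.
  by apply: filterS nO => y /FG ->.
by apply: filterS nO => y /FG ->.
Qed.

(** On the open square the smooth representative is the sum of the series of
    [phi], and this determines its derivatives there. *)
Lemma pd_smooth_rep phi j : Htest h phi ->
  Htest h (pd j (smooth_rep phi)) /\
  tcoef (pd j (smooth_rep phi)) = fun n => - mu l j n * tcoef phi n.
Proof.
move=> tp; have ra := Htest_rapid tp; set a := tcoef phi.
have ex : exists F : R * R -> R[i], smooth F /\ {ae leb2, forall x, Omega x -> F x = phi x}.
  by exists (testsum a); split; [exact: smooth_expsum|exact/aeq_sym/Htest_sum].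
have [sF Fphi] := @xgetPex _ phi [set F | smooth F /\ {ae leb2, forall x, Omega x -> F x = phi x}] ex.
rewrite -[xget _ _]/(smooth_rep phi) in sF Fphi.
have eqO := aeq_continuous (smooth_ccont sF) (ccont_expsum l (- 1) ra)
  (aeq_trans Fphi (Htest_sum tp)).
have rd := rapid_dseq l (- 1) j ra.
have ae : aeq (pd j (smooth_rep phi)) (testsum (dseq l (- 1) j a)).
  apply: aeq_refl => x Ox; rewrite (pd_local j eqO Ox) pd_expsum//.
have d2 : L2 (pd j (smooth_rep phi)) by exact/ccont_L2/smooth_ccont/smooth_pd.
split; first exact: Htest_of_sum d2 rd ae.
rewrite (tcoef_of_sum d2 rd ae); apply/funext => n.
by rewrite /dseq rmorphN mulN1r.
Qed.

Lemma represents_P c w b : represents w b ->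
  represents (P c w) (fun n => symbol c n * b n).
Proof.
move=> [mb wb]; split; first by apply: moderateM => //; exact: moderate_symbol.
move=> phi tp; have ra := Htest_rapid tp.
have part j : dist_pd j w phi = csum (fun n => mu l j n * (tcoef phi n * b n)).
  have [t e] := pd_smooth_rep j tp; rewrite /dist_pd wb// e.
  have [M rM] := rapid_qbounded (rapidM (moderate_mu l j) (rapid_pairing ra mb)).
  have -> : csum (fun n => - mu l j n * tcoef phi n * b n) =
      (- 1) * csum (fun n => mu l j n * (tcoef phi n * b n)).
    by rewrite -(csumZ (- 1) rM); congr csum; apply/funext => n; ring.
  by rewrite mulN1r opprK.
rewrite /P !part.
have r j := rapidM (moderate_mu l j) (rapid_pairing ra mb).
have [M rM] := rapid_qbounded (r ord0); have [N rN] := rapid_qbounded (r ord_max).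
have [N' rN'] := rapid_qbounded (rapidZ c (r ord_max)).
rewrite -(csumZ c rN) -(csumD rM rN'); congr csum; apply/funext => n.
by rewrite /symbol; ring.
Qed.

Lemma dist_of_smooth psi : Hsmooth h psi ->
  rapid (coef l 1 psi) /\ represents (dist_of psi) (coef l 1 psi).
Proof.
move=> Hp; have Lc := Lop_coef h1_gt0 h2_gt0.
have p2 := Hinf_L2 Lc Hp; have rp := Hinf_rapid Lc Hp.
split => //; split; first exact: rapid_moderate.
move=> phi tp; have ra := Htest_rapid tp.
transitivity (cintegral (fun x => psi x * testsum (tcoef phi) x)).
  apply: aeq_cintegral.
  - by apply: cmeasM; apply: L2_cmeas => //; exact: Htest_L2.
  - by apply: cmeasM; apply: L2_cmeas => //; exact: L2_expsum.
  - by apply: ae_mono (Htest_sum tp) => x /[apply] ->.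
by apply: etrans (cintegral_expsum _ _ p2 ra) _; rewrite opprK.
Qed.

(** Representing sequences are unique, because they are read off the
    exponentials; that of a smooth function consists of its coefficients. *)
Lemma smooth_distP w b : represents w b -> is_smooth_dist h w <-> rapid b.
Proof.
move=> wb; split=> [[psi Hp e]|rb].
  have [rp rep] := dist_of_smooth Hp.
  rewrite (_ : b = coef l 1 psi)//; apply/funext => n.
  have [t _] := Htest_testexp n.
  by rewrite -(represents_testexp n wb) -(represents_testexp n rep) e.
have Lc := Lop_coef h1_gt0 h2_gt0; have Le := Lop_expsum h1_gt0 h2_gt0.
have Hb := expsum_in_Hinf sqr1 Lc Le rb.
exists (expsum l 1 b) => // phi tp; have [_ [_ rep]] := dist_of_smooth Hb.
by have [_ ->] := wb => //; rewrite rep// coef_expsum.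
Qed.

Lemma conj_v n : (fun x => (v h (freq n) x)^*%C) = testexp n.
Proof.
apply/funext => x; rewrite /v /expo /phase; move: (freq n) => p.
rewrite /logh /=; have -> : h.1 `^ (- x.1) * h.2 `^ (- x.2) = expR (-1 * (ln h.1 * x.1 + ln h.2 * x.2)).
  rewrite /powR !gt_eqF// -expRD; congr expR; ring.
have Re_mk (a b : R) : complex.Re (a +i* b) = a by [].
have Im_mk (a b : R) : complex.Im (a +i* b) = b by [].
by apply: complex_ext; rewrite !(ReM, ImM, Re_conj, Im_conj, Re_mk, Im_mk)
  !mulN1r cosN sinN; ring.
Qed.

Lemma fourier_freq w n : fourier h w (freq n) = w (testexp n).
Proof. by rewrite /fourier conj_v. Qed.

Lemma hypoelliptic_iff c : globally_hypoelliptic h c <->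
  forall b, moderate b -> rapid (fun n => symbol c n * b n) -> rapid b.
Proof.
split=> [hyp b mb rb|hyp w Hw].
  have [w wb] := represents_exists mb.
  apply/(smooth_distP wb)/hyp; first exact: represents_Hdist wb.
  exact/(smooth_distP (represents_P c wb)).
have rep := Hdist_represents Hw.
by move=> /(smooth_distP (represents_P c rep)) rs; apply/(smooth_distP rep)/hyp; have [] := rep.
Qed.

Lemma solvable_iff c : globally_solvable h c <->
  forall f, moderate f -> (forall n, symbol c n = 0 -> f n = 0) ->
    exists2 b, moderate b & forall n, symbol c n * b n = f n.
Proof.
split=> [sol f mf f0|sol].
  have [F Ff] := represents_exists mf.
  have : [set F | Hdist h F /\ forall xi, sigmaP h c xi = 0 -> fourier h F xi = 0] F.
    split; first exact: represents_Hdist Ff.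
    move=> xi; rewrite -(freq_indexK xi) -symbolE => /f0.
    by rewrite fourier_freq (represents_testexp _ Ff).
  rewrite -sol => -[w Hw e]; have rep := Hdist_represents Hw.
  exists (fun n => w (testexp n)); first by have [] := rep.
  move=> n; have [t _] := Htest_testexp n.
  by rewrite -(represents_testexp n Ff) e// (represents_testexp n (represents_P c rep)).
apply/seteqP; split=> F /= [].
  move=> w Hw e; have rep := represents_P c (Hdist_represents Hw).
  have repF : represents F (fun n => symbol c n * w (testexp n)).
    by have [m r] := rep; split => // phi tp; rewrite e// r.
  split; first exact: represents_Hdist repF.
  move=> xi; rewrite -(freq_indexK xi) -symbolE => s0.
  by rewrite fourier_freq (represents_testexp _ repF) s0 mul0r.
move=> HF F0; have rep := Hdist_represents HF.
have [|n s0|b mb be] := sol (fun n => F (testexp n)); first by have [] := rep.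
  by rewrite -fourier_freq F0.
have [w wb] := represents_exists mb.
exists w; first exact: represents_Hdist wb.
move=> phi tp; have [_ ->] := rep => //; have [_ ->] := represents_P c wb => //.
by congr csum; apply/funext => n; rewrite be.
Qed.

End Distributions.

(** * Division of sequences by a symbol *)

Section Division.
Context {R : realType}.
Variable sigma : nat -> R[i].
Implicit Types (b f : nat -> R[i]).

(** The base [n.+2] is at least 2, so that a failure of the bound for every [k]
    makes the symbol arbitrarily small even along a bounded set of indices. *)
Definition diophantine := exists k, exists C : R, 0 < C /\
  forall n, sigma n != 0 -> C <= Cmod (sigma n) * n.+2%:R ^+ k.

Lemma diophantine_moderate_inv : diophantine -> moderate (fun n => (sigma n)^-1).
Proof.
move=> [k [C [C0 sC]]]; exists k, (2 ^+ k / C) => n.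
have [->|s0] := eqVneq (sigma n) 0.
  by rewrite invr0 Cmod0 mulr_ge0 ?exprn_ge0// divr_ge0 ?exprn_ge0// ltW.
have c0 : 0 < Cmod (sigma n) by rewrite lt_neqAle eq_sym Cmod_eq0 s0 Cmod_ge0.
rewrite CmodV -[leLHS]mul1r ler_pdivrMr//.
rewrite [leRHS](_ : _ = Cmod (sigma n) * (2 * n.+1%:R) ^+ k / C); last by rewrite exprMn; ring.
rewrite ler_pdivlMr// mul1r; apply: (le_trans (sC n s0)); rewrite ler_wpM2l//.
by rewrite lerXn2r ?nnegrE// -natrM ler_nat; lia.
Qed.

(** With the indicator of the nonzero set of the symbol on the right-hand side,
    the only possible solution there is the inverse of the symbol. *)
Lemma solvable_diophantine :
  (forall f, moderate f -> (forall n, sigma n = 0 -> f n = 0) ->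
    exists2 b, moderate b & forall n, sigma n * b n = f n) <-> diophantine.
Proof.
split=> [sol|dio f mf f0]; last first.
  exists (fun n => (sigma n)^-1 * f n).
    by apply: moderateM => //; exact: diophantine_moderate_inv.
  move=> n; have [s0|s0] := eqVneq (sigma n) 0; first by rewrite s0 mul0r f0.
  by rewrite mulVKf.
have [||b [k [M bM]] be] := sol (fun n => (sigma n != 0)%:R).
- exists 0%N, 1 => n; rewrite mulr1.
  by case: (sigma n != 0); rewrite ?Cmod1 ?Cmod0.
- by move=> n ->; rewrite eqxx.
exists k, (`|M| + 1)^-1; split; first by rewrite invr_gt0 ltr_wpDl.
move=> n s0; have := be n; rewrite s0 => /(congr1 (@Cmod R)); rewrite Cmod1 CmodM => e.
rewrite -[leLHS]mul1r ler_pdivrMr ?ltr_wpDl//.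
apply: (@le_trans _ _ (Cmod (sigma n) * Cmod (b n))); first by rewrite e.
rewrite -mulrA ler_wpM2l//.
apply: (le_trans (bM n)); rewrite [leRHS]mulrC; apply: ler_pM.
- by have := bM 0%N; rewrite expr1n mulr1; exact: le_trans.
- exact: exprn_ge0.
- by apply: (le_trans (ler_norm M)); rewrite lerDl.
- by rewrite lerXn2r ?nnegrE// ler_nat leqnSn.
Qed.

Lemma positive_below (v : nat -> R) N :
  exists d : R, 0 < d /\ forall n, (n < N)%N -> 0 < v n -> d <= v n.
Proof.
elim: N => [|N [d [d0 dv]]]; first by exists 1.
have [vN|vN] := ltP 0 (v N); last first.
  exists d; split => // n; rewrite ltnS leq_eqVlt => /predU1P[->|]; last exact: dv.
  by move/lt_le_trans => /(_ _ vN); rewrite ltxx.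
exists (Num.min d (v N)); split; first by rewrite lt_min d0.
move=> n; rewrite ltnS leq_eqVlt => /predU1P[->|nN] vn; first by rewrite ge_min lexx orbT.
by rewrite ge_min dv.
Qed.

(** If the Diophantine bound fails, the symbol decays rapidly along a sequence
    of indices; the indicator of its range is a nonsmooth solution. *)
Lemma hypoelliptic_diophantine :
  (forall b, moderate b -> rapid (fun n => sigma n * b n) -> rapid b) <->
  diophantine /\ exists N, forall n, sigma n = 0 -> (n < N)%N.
Proof.
have ind_moderate (P : nat -> bool) : moderate (fun n => (P n)%:R : R[i]).
  exists 0%N, 1 => n; rewrite mulr1.
  by case: (P n); rewrite ?Cmod1 ?Cmod0.
have ind_rapid (P : nat -> bool) : rapid (fun n => (P n)%:R : R[i]) ->
    exists N, forall n, P n -> (n < N)%N.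
  move=> /(_ 1%N)[M bM]; exists (Num.truncn M).+1 => n Pn.
  have := bM n; rewrite Pn Cmod1 mul1r expr1 => nM.
  rewrite -(ltr_nat R); apply: lt_trans (truncnS_gt M).
  by apply: lt_le_trans nM; rewrite ltr_nat.
split=> [hyp|[dio [N sN]] b mb rb]; last first.
  pose b' n := (sigma n)^-1 * (sigma n * b n).
  have rb' : rapid b' by apply: rapidM => //; exact: diophantine_moderate_inv.
  have rf : rapid (fun n => b n - b' n).
    apply: (@rapid_finite _ _ N) => n Nn; rewrite /b' mulKf ?subrr//.
    by apply/eqP => /sN; rewrite ltnNge Nn.
  have := rapidD rf rb'; congr rapid; apply/funext => n.
  by rewrite subrK.
split; last first.
  have [|N sN] := ind_rapid (fun n => sigma n == 0).
    apply: hyp; first exact: ind_moderate.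
    apply: (@rapid_finite _ _ 0) => n _.
    by case: eqVneq => [->|_]; rewrite ?mul0r ?mulr0.
  by exists N => n /eqP; exact: sN.
apply: contrapT => ndio.
have bad k : exists n, sigma n != 0 /\ Cmod (sigma n) * n.+2%:R ^+ k < 1.
  apply: contrapT => no; apply: ndio; exists k, 1; split => // n s0.
  by rewrite leNgt; apply/negP => lt; apply: no; exists n.
have [m mP] := choice bad.
pose P n := `[< exists k, m k = n >].
have [|N mN] := ind_rapid P.
  apply: hyp; first exact: ind_moderate.
  move=> K; exists (1 + \sum_(k < K) Cmod (sigma (m k)) * (m k).+1%:R ^+ K) => n.
  have S0 (s : seq 'I_K) (Q : pred 'I_K) :
      0 <= \sum_(k <- s | Q k) Cmod (sigma (m k)) * (m k).+1%:R ^+ K.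
    by apply: sumr_ge0 => k _; rewrite mulr_ge0 ?exprn_ge0.
  rewrite /P; case: asboolP => [[k <-]|_]; last by rewrite mulr0 Cmod0 mul0r addr_ge0.
  rewrite mulr1; have [kK|Kk] := ltnP k K.
    rewrite (bigD1 (Ordinal kK))//= addrCA lerDl addr_ge0//.
  apply: (@le_trans _ _ 1); last by rewrite lerDl.
  have [_ /ltW] := mP k; apply: le_trans; rewrite ler_wpM2l//.
  apply: (@le_trans _ _ ((m k).+2%:R ^+ K)); first by rewrite lerXn2r ?nnegrE// ler_nat leqnSn.
  by rewrite ler_weXn2l// ler1n.
(* On the finite range of [m] the nonzero values of the symbol have a positive
   minimum, which contradicts their decay along [m]. *)
have [d [d0 dle]] := positive_below (fun n => Cmod (sigma n)) N.
have small k : d * k%:R < 1.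
  have [s0 lt1] := mP k.
  have dk : d <= Cmod (sigma (m k)).
    apply: dle; first by apply: mN; apply/asboolP; exists k.
    by rewrite lt_neqAle eq_sym Cmod_eq0 s0 Cmod_ge0.
  apply: le_lt_trans lt1; apply: ler_pM => //; first exact: ltW.
  apply: (@le_trans _ _ (2 ^+ k)); last by rewrite lerXn2r ?nnegrE// ler_nat.
  by rewrite -natrX ler_nat ltnW// ltn_expl.
have := small (Num.truncn d^-1).+1; apply/negP; rewrite -leNgt.
by rewrite mulrC -ler_pdivrMr// div1r; exact/ltW/truncnS_gt.
Qed.

End Division.

(** * Diophantine properties of the symbol *)

Section LinearForms.
Context {R : realType}.
Implicit Types (c : R[i]) (y : R).

Definition linear_form c n : R[i] :=
  ((freq n).1%:~R)%:C + c * ((freq n).2%:~R)%:C.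

Lemma linear_form_real y n :
  linear_form y%:C n = ((freq n).1%:~R + y * (freq n).2%:~R)%:C.
Proof. by rewrite /linear_form rmorphD rmorphM. Qed.

Lemma one_le_absz (z : int) : z != 0 -> 1 <= `|z%:~R : R|.
Proof. by move=> z0; rewrite -intr_norm -abszE ler1n absz_gt0. Qed.

Lemma linear_form_nonreal c n : complex.Im c <> 0 -> linear_form c n = 0 ->
  freq n = (0, 0).
Proof.
move=> /eqP c0; rewrite /linear_form; case: (freq n) => p q /= /eqP.
rewrite eq_complex => /andP[].
rewrite !(ReD, ImD, ReM, ImM) /= !mulr0 !add0r subr0 mulf_eq0 (negbTE c0) /=.
by move=> + /eqP q0; rewrite q0 mulr0 addr0 intr_eq0 => /eqP ->;
  move/eqP: q0; rewrite intr_eq0 => /eqP ->.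
Qed.

Lemma diophantine_nonreal c : complex.Im c <> 0 -> diophantine (linear_form c).
Proof.
move=> /eqP c0; exists 0%N, (Num.min 1 `|complex.Im c|).
split; first by rewrite lt_min ltr01 normr_gt0.
move=> n; rewrite mulr1 => s0.
have [q0|q0] := eqVneq (freq n).2 0.
  have p0 : (freq n).1 != 0.
    have [p0|//] := eqVneq (freq n).1 0; case/eqP: s0.
    by rewrite /linear_form p0 q0 !rmorph0 mulr0 addr0.
  rewrite ge_min; apply/orP; left; rewrite /linear_form q0 rmorph0 mulr0 addr0 Cmod_real.
  exact: one_le_absz.
rewrite ge_min; apply/orP; right; apply: le_trans (normr_Im_le _).
rewrite /linear_form ImD ImM /= mulr0 !add0r normrM ler_peMr//.
exact: one_le_absz.
Qed.

(** At a rational point the linear form takes values in a discrete group. *)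
Lemma diophantine_rational y : rational y -> diophantine (linear_form y%:C).
Proof.
move=> [r _ <-]; have d0 : 0 < (denq r)%:~R :> R by rewrite ltr0z denq_gt0.
exists 0%N, ((denq r)%:~R)^-1; split; first by rewrite invr_gt0.
move=> n; rewrite mulr1 linear_form_real => s0; rewrite Cmod_real.
rewrite -[leLHS]mul1r ler_pdivrMr// -[X in _ * X](ger0_norm (ltW d0)) -normrM.
have e : ((freq n).1%:~R + ratr r * (freq n).2%:~R) * (denq r)%:~R =
    ((freq n).1 * denq r + numq r * (freq n).2)%:~R :> R.
  rewrite /ratr rmorphD !rmorphM /=; field; exact: lt0r_neq0.
rewrite e; apply: one_le_absz; rewrite -(@intr_eq0 R) -e.
apply: mulf_neq0; last exact: lt0r_neq0.
by apply/eqP => z; case/eqP: s0; rewrite z.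
Qed.

Lemma zeros_rational y : rational y ->
  forall N, exists2 n, (N <= n)%N & linear_form y%:C n = 0.
Proof.
move=> [r _ <-] N.
have d0 : (denq r)%:~R != 0 :> R by rewrite intr_eq0 denq_neq0.
exists (freq_index (- numq r * N.+1%:Z, denq r * N.+1%:Z)).
  have := absz_freq_le (freq_index (- numq r * N.+1%:Z, denq r * N.+1%:Z)).
  rewrite freq_indexK /= !abszM /= => le; rewrite -ltnS; apply: leq_trans le.
  apply: leq_trans (leq_addl _ _); rewrite leq_pmull// absz_gt0; exact: denq_neq0.
rewrite linear_form_real freq_indexK /ratr !rmorphM rmorphN /=.
by rewrite (_ : _ + _ = 0)//; field.
Qed.

Lemma linear_form_irrational y n : irrational y -> linear_form y%:C n = 0 ->
  freq n = (0, 0).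
Proof.
move=> irr; rewrite linear_form_real => /(@complexI R) e.
have [q0|q0] := eqVneq (freq n).2 0.
  move/eqP: e; rewrite q0 rmorph0 mulr0 addr0 intr_eq0 => /eqP p0.
  by rewrite [freq n]surjective_pairing p0 q0.
exfalso; apply: irr; exists (- (freq n).1%:Q / (freq n).2%:Q) => //.
have q0' : (freq n).2%:~R != 0 :> R by rewrite intr_eq0.
rewrite fmorph_div rmorphN /= !ratr_int; apply: (mulIf q0').
by rewrite divfK//; apply/eqP; rewrite eq_sym -subr_eq0 opprK addrC e.
Qed.

Lemma finite_lower_bound (T : choiceType) (A : set T) (v : T -> R) :
  finite_set A -> (forall x, A x -> 0 < v x) ->
  exists d : R, 0 < d /\ forall x, A x -> d <= v x.
Proof.
move=> /finite_seqP[s ->] vp.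
have [d [d0 dv]] : exists d : R, 0 < d /\ forall x, x \in s -> d <= v x.
  elim: s vp => [|x s ih] vp; first by exists 1; split.
  have [z zs|d [d0 dv]] := ih; first by apply: vp; rewrite /= inE zs orbT.
  exists (Num.min d (v x)); split; first by rewrite lt_min d0 vp//= mem_head.
  move=> z; rewrite inE => /predU1P[->|zs]; first by rewrite ge_min lexx orbT.
  by rewrite ge_min dv.
by exists d.
Qed.

Lemma distance_to_integers y : irrational y ->
  exists d : R, 0 < d /\ forall p : int, d <= `|y - p%:~R|.
Proof.
move=> irr; pose m := Num.floor y.
have ym (p : int) : y != p%:~R.
  by apply/eqP => e; apply: irr; exists p%:~R => //; rewrite ratr_int.
have my : m%:~R < y by rewrite lt_neqAle eq_sym ym floor_le_tmp.
have ym1 : y < (m + 1)%:~R by exact: floorD1_gt.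
exists (Num.min (y - m%:~R) ((m + 1)%:~R - y)).
split; first by rewrite lt_min !subr_gt0 my.
move=> p; rewrite ge_min; have [pm|mp] := leP p m.
  apply/orP; left; have : p%:~R <= m%:~R :> R by rewrite ler_int.
  by move=> h; rewrite ger0_norm; lra.
apply/orP; right; have : (m + 1)%:~R <= p%:~R :> R by rewrite ler_int; lia.
by move=> h; rewrite ler0_norm; lra.
Qed.

(** The form at [(p, q)] is [q] times the distance from [y] to a fraction of
    denominator [q].  For [`|q|] at least 2 only finitely many fractions are
    closer to [y] than a fixed power of [1 / q]; the denominators 0 and 1, excluded
    from the definition of Liouville numbers, are bounded below separately. *)
Lemma diophantine_nonLiouville y : irrational y -> ~ Liouville y ->
  diophantine (linear_form y%:C).
Proof.
move=> irr nL.
have [m [m0 fin]] : exists m, (0 < m)%N /\ finite_set [set pq : int * int | 1 < pq.2 /\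
    0 < `|y - pq.1%:~R / pq.2%:~R| < 1 / (pq.2%:~R ^+ m)].
  apply: contrapT => no; apply: nL => m m0 fin; apply: no; by exists m.
have [d [d0 dA]] := finite_lower_bound fin
  (v := fun pq => `|y - pq.1%:~R / pq.2%:~R|) (fun pq h => (andP h.2).1).
have [e [e0 eZ]] := distance_to_integers irr.
exists m, (Num.min 1 (Num.min d e)); split; first by rewrite !lt_min ltr01 d0 e0.
move=> n; rewrite linear_form_real Cmod_real => s0.
have pw : 1 <= n.+2%:R ^+ m :> R by rewrite exprn_ege1// ler1n.
have enough (K : R) : (K = 1 \/ K = d \/ K = e) -> forall x : R, K <= x ->
    Num.min 1 (Num.min d e) <= x.
  by move=> KE x; apply: le_trans; rewrite !ge_min; case: KE => [|[|]] ->; rewrite lexx ?orbT.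
have [q0|q0] := eqVneq (freq n).2 0.
  have p0 : (freq n).1 != 0.
    have [p0|//] := eqVneq (freq n).1 0; case/eqP: s0.
    by rewrite p0 q0 mulr0 addr0.
  apply: (enough 1); first by left.
  rewrite q0 mulr0 addr0; apply: (le_trans (one_le_absz p0)).
  by rewrite ler_peMr.
pose q : int := `|(freq n).2|%N; pose p := - Num.sg (freq n).2 * (freq n).1.
have qq : q%:~R = `|(freq n).2%:~R| :> R by rewrite /q -intr_norm -abszE.
have q1 : 1 <= q by rewrite /q; lia.
have qn : q%:~R <= n.+2%:R :> R.
  by rewrite -[n.+2%:R]/((n.+2%:Z)%:~R) ler_int /q; have := absz_freq_le n; lia.
have qR : 1 <= q%:~R :> R by rewrite -[1]/(1%:~R) ler_int.
have form : `|(freq n).1%:~R + y * (freq n).2%:~R| = q%:~R * `|y - p%:~R / q%:~R|.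
  rewrite -[X in _ = X * _](ger0_norm (le_trans ler01 qR)) -normrM mulrBr.
  have q00 : q%:~R != 0 :> R by rewrite lt0r_neq0// (lt_le_trans ltr01).
  rewrite [_ * (_ / _)]mulrC divfK// qq /p.
  have [sg|sg|sg] := ltgtP (freq n).2 0; last by rewrite sg eqxx in q0.
    have nb : `|(freq n).2%:~R| = - (freq n).2%:~R :> R by rewrite ltr0_norm// ltrz0.
    rewrite nb ltr0_sg// opprK mul1r -normrN; apply: (congr1 (fun z : R => `|z|)); ring.
  have nb : `|(freq n).2%:~R| = (freq n).2%:~R :> R by rewrite gtr0_norm// ltr0z.
  rewrite nb gtr0_sg// mulN1r rmorphN opprK; apply: (congr1 (fun z : R => `|z|)); ring.
rewrite form; have [q1'|q1'] := eqVneq q 1.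
  apply: (enough e); first by right; right.
  rewrite q1' mul1r divr1; apply: (le_trans (eZ p)); exact: ler_peMr.
have [Apq|nA] := pselect ([set pq : int * int | 1 < pq.2 /\
    0 < `|y - pq.1%:~R / pq.2%:~R| < 1 / (pq.2%:~R ^+ m)] (p, q)).
  apply: (enough d); first by right; left.
  apply: (le_trans (dA _ Apq)) => /=; rewrite -mulrA mulrCA ler_peMr//.
  by rewrite mulr_ege1.
apply: (enough 1); first by left.
have pos : 0 < `|y - p%:~R / q%:~R|.
  rewrite normr_gt0 subr_eq0; apply/eqP => e'; apply: irr.
  by exists (p%:~R / q%:~R) => //; rewrite fmorph_div /= !ratr_int.
have far : 1 / q%:~R ^+ m <= `|y - p%:~R / q%:~R|.
  rewrite leNgt; apply/negP => lt; apply: nA; split => /=; first by rewrite lt_neqAle eq_sym q1'.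
  by rewrite pos lt.
have qm : 0 < q%:~R ^+ m :> R by rewrite exprn_gt0// (lt_le_trans ltr01).
apply: (@le_trans _ _ (1 * (1 / q%:~R ^+ m) * q%:~R ^+ m)).
  by rewrite mul1r divfK// lt0r_neq0.
apply: ler_pM => //; first by rewrite mul1r divr_ge0// ltW.
- exact: ltW.
- by apply: ler_pM => //; rewrite divr_ge0// ltW.
- by rewrite lerXn2r ?nnegrE// (le_trans ler01).
Qed.

(** The index of [(- p, q)] is at most quadratic in [q], so an approximation of
    order [2 * k + 1 + j] violates the bound of order [k] by a factor [2 ^+ j],
    which [j] makes larger than the constants. *)
Lemma nonLiouville_diophantine y : irrational y -> diophantine (linear_form y%:C) ->
  ~ Liouville y.
Proof.
move=> irr [k [C [C0 bound]]] L.
pose D : R := (5 + 2 * `|y|) ^+ 2 + 1.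
have D0 : 0 < D by rewrite ltr_wpDl// exprn_ge0.
pose j := (Num.truncn (D ^+ k / C)).+1.
have big : D ^+ k < 2 ^+ j * C.
  rewrite -ltr_pdivrMr//; apply: (lt_trans (truncnS_gt _)).
  by rewrite -natrX ltr_nat ltn_expl.
have m0 : (0 < 2 * k + 1 + j)%N by lia.
have [[p q] [/= q1 /andP[pos close]]] : [set pq : int * int | 1 < pq.2 /\
    0 < `|y - pq.1%:~R / pq.2%:~R| < 1 / (pq.2%:~R ^+ (2 * k + 1 + j))] !=set0.
  by apply: infinite_setN0; exact: L.
pose Q : R := q%:~R; pose P : R := p%:~R.
have Q2 : 2 <= Q by rewrite /Q -[2]/(2%:~R) ler_int; lia.
have Q0 : 0 < Q by lra.
have Q00 : Q != 0 by exact: lt0r_neq0.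
pose n := freq_index (- p, q).
have form : `|(freq n).1%:~R + y * (freq n).2%:~R| = Q * `|y - P / Q|.
  rewrite freq_indexK /= -[X in _ = X * _](ger0_norm (ltW Q0)) -normrM mulrBr.
  by rewrite [Q * (_ / _)]mulrC divfK// rmorphN /= addrC [y * _]mulrC.
have := bound n; rewrite linear_form_real => b.
have {}b : C <= Q * `|y - P / Q| * n.+2%:R ^+ k.
  rewrite -form -Cmod_real; apply: b; rewrite -Cmod_eq0 Cmod_real form.
  by rewrite mulf_neq0// lt0r_neq0.
set t := `|y - P / Q| in close pos b.
have Qm : 0 < Q ^+ (2 * k + 1 + j) by exact: exprn_gt0.
have t1 : t <= 1 by apply: (le_trans (ltW close)); rewrite ler_pdivrMr// mul1r exprn_ege1//; lra.
have PQ : `|P| <= Q * (`|y| + 1).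
  rewrite (_ : P = Q * y - Q * (y - P / Q)); last by field.
  apply: (le_trans (ler_normB _ _)); rewrite !normrM (ger0_norm (ltW Q0)) -/t.
  by rewrite mulrDr mulr1 lerD2l ler_piMr// ltW.
have nD : n.+2%:R <= D * Q ^+ 2.
  have le1 : n.+1%:R <= (1 + 2 * `|P| + 2 * Q) ^+ 2 :> R.
    rewrite -(ger0_norm (ltW Q0)) -[`|P|]normrN -[- P]rmorphN; exact: freq_index_leR.
  have le2 : (1 + 2 * `|P| + 2 * Q) ^+ 2 <= ((5 + 2 * `|y|) * Q) ^+ 2.
    rewrite lerXn2r ?nnegrE ?addr_ge0 ?mulr_ge0 ?addr_ge0 ?mulr_ge0 ?(ltW Q0)//.
    by have := normr_ge0 y; nra.
  rewrite -natr1 /D mulrDl mul1r -exprMn; apply: lerD; first exact: le_trans le1 le2.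
  by rewrite exprn_ege1//; lra.
have nDk : n.+2%:R ^+ k <= D ^+ k * Q ^+ (2 * k).
  by rewrite exprM -exprMn lerXn2r ?nnegrE ?mulr_ge0 ?exprn_ge0 ?(ltW Q0) ?(ltW D0).
have t2 : t * Q ^+ (2 * k + 1 + j) < 1 by rewrite -ltr_pdivlMr.
have Qj : 2 ^+ j <= Q ^+ j by rewrite lerXn2r ?nnegrE// ltW.
have chain : C * 2 ^+ j <= D ^+ k * (t * Q ^+ (2 * k + 1 + j)).
  apply: (@le_trans _ _ (Q * t * (D ^+ k * Q ^+ (2 * k)) * Q ^+ j)).
    apply: ler_pM => //; first exact: ltW.
    apply: (le_trans b); apply: ler_wpM2l => //.
    by rewrite mulr_ge0 ?(ltW Q0) ?(ltW pos).
  by rewrite !exprD expr1 le_eqVlt; apply/orP; left; apply/eqP; ring.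
have Dk0 : 0 < D ^+ k by exact: exprn_gt0.
have : D ^+ k < D ^+ k.
  apply: (lt_trans big); rewrite mulrC; apply: (le_lt_trans chain).
  by rewrite gtr_pMr.
by rewrite ltxx.
Qed.

End LinearForms.

Lemma symbol_linear_form (R : realType) (h : R * R) (c : R[i]) :
  c * (ln h.2)%:C = - (ln h.1)%:C ->
  symbol h c = fun n => (0 +i* (2 * pi)) * linear_form c n.
Proof.
move=> hc; apply/funext => n; rewrite /symbol /mu /coord /linear_form /=.
move: (freq n).1 (freq n).2 => p q.
have split_mu (x y : R) : x +i* (2 * pi * y) = x%:C + (0 +i* (2 * pi)) * y%:C.
  by apply: complex_ext; rewrite ?ReD ?ImD ?ReM ?ImM /=; ring.
rewrite !split_mu [c * _]mulrDr hc addrACA addrN add0r; ring.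
Qed.

Lemma diophantine_scale (R : realType) (sigma : nat -> R[i]) (k : R[i]) : k != 0 ->
  diophantine sigma -> diophantine (fun n => k * sigma n).
Proof.
move=> k0 [m [C [C0 sC]]]; exists m, (Cmod k * C); split.
  by rewrite mulr_gt0// lt_neqAle eq_sym Cmod_eq0 k0 Cmod_ge0.
move=> n; rewrite mulf_eq0 negb_or k0 /= => s0.
by rewrite CmodM -mulrA ler_wpM2l// sC.
Qed.

Lemma diophantine_linear_formP (R : realType) (c : R[i]) :
  diophantine (linear_form c) <->
  [\/ complex.Im c <> 0, exists y : R, c = y%:C /\ rational y |
      exists y : R, [/\ c = y%:C, irrational y & ~ Liouville y]].
Proof.
split=> [dio|[|[y [->]]|[y [-> irr nL]]]]; last first.
- exact: diophantine_nonLiouville.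
- exact: diophantine_rational.
- exact: diophantine_nonreal.
have [c0|c0] := pselect (complex.Im c = 0); last by constructor 1.
have cE : c = (complex.Re c)%:C by apply: complex_ext.
have [rat|irr] := pselect (rational (complex.Re c)).
  by constructor 2; exists (complex.Re c).
constructor 3; exists (complex.Re c); split => //.
by rewrite cE in dio; exact: nonLiouville_diophantine dio.
Qed.

Lemma bounded_zerosP (R : realType) (c : R[i]) :
  (exists N, forall n, linear_form c n = 0 -> (n < N)%N) <->
  complex.Im c <> 0 \/ exists y : R, c = y%:C /\ irrational y.
Proof.
split=> [[N zN]|cases].
  have [c0|c0] := pselect (complex.Im c = 0); last by left.
  have cE : c = (complex.Re c)%:C by apply: complex_ext.
  right; exists (complex.Re c); split => // rat.
  have [n Nn z] := zeros_rational rat N.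
  by move: (zN n); rewrite cE z ltnNge Nn => /(_ erefl).
exists (freq_index (0, 0)).+1 => n z; rewrite ltnS -[n]freqK.
suff -> : freq n = (0, 0) by [].
case: cases => [c0|[y [cy irr]]]; first exact: linear_form_nonreal c0 z.
by rewrite cy in z; exact: linear_form_irrational irr z.
Qed.

Theorem theorem4p7 (R : realType) (h : R * R) (c : R[i])
    (h1_gt0 : 0 < h.1) (h2_gt0 : 0 < h.2) (c_neq0 : c != 0)
    (hc : c * (ln h.2)%:C = - (ln h.1)%:C) :
  (globally_hypoelliptic h c <->
     complex.Im c <> 0 \/
     exists y : R, [/\ c = y%:C, irrational y & ~ Liouville y])
  /\
  (globally_solvable h c <->
     [\/ complex.Im c <> 0,
         exists y : R, c = y%:C /\ rational y |
         exists y : R, [/\ c = y%:C, irrational y & ~ Liouville y]]).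
Proof.
have k0 : (0 +i* (2 * pi) : R[i]) != 0.
  by rewrite eq_complex /= eqxx /= mulf_neq0// lt0r_neq0// pi_gt0.
have dioE : diophantine (symbol h c) <-> diophantine (linear_form c).
  rewrite (symbol_linear_form hc); split=> [dio|]; last exact: diophantine_scale.
  have := diophantine_scale (invr_neq0 k0) dio; congr diophantine.
  by apply/funext => n; rewrite mulKf.
have zeroE n : symbol h c n = 0 <-> linear_form c n = 0.
  rewrite (symbol_linear_form hc); split=> [/eqP|->]; last by rewrite mulr0.
  by rewrite mulf_eq0 (negbTE k0) => /eqP.
have zerosE : (exists N, forall n, symbol h c n = 0 -> (n < N)%N) <->
    (exists N, forall n, linear_form c n = 0 -> (n < N)%N).
  by split=> -[N zN]; exists N => n /zeroE; exact: zN.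
rewrite hypoelliptic_iff// solvable_iff// hypoelliptic_diophantine solvable_diophantine.
rewrite dioE zerosE diophantine_linear_formP bounded_zerosP; split => //.
split=> [[[c0|[y [cy rat]]|H] zeros]|[c0|H]].
- by left.
- left; case: zeros => [//|[y' [cy' irr]]]; exfalso; apply: irr.
  by have [<-] : y%:C = y'%:C :> R[i] by rewrite -cy.
- by right.
- by split; [constructor 1|left].
- split; first by constructor 3.
  by case: H => y [cy irr _]; right; exists y.
Qed.
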